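(* Assume (H1), (H2), (H3) (spelled out in the context) and that $(X_k)_{k\ge 1}$ has policy $(q_k)_{k\ge 0}$ with $q_k=(1-\lambda_k)f_k+\lambda_k q_0$ for all $k\ge 1$, where $f_k$ is the weighted kernel estimate built from $X_1,\dots,X_k$. If there exists $\epsilon>0$ such that $a_n+h_n^4\ll \lambda_n^{1+\epsilon}\ll 1$, and if $g:\mathbb R^d\to\mathbb R$ is a (measurable) function with $\int g^2q_0<\infty$, then, as $n\to\infty$, $$\sqrt n\left(\sum_{k=1}^nW_{n,k}\,g(X_k)-\int gf\right)\ \text{ converges in distribution to }\ \mathcal N\big(0,V(f,g)\big),$$ where $V(f,g)=\int g^2f-\big(\int gf\big)^2$.
   Context: Let $f_U:\mathbb R^d\to[0,\infty)$ be measurable with $0<\int f_U<\infty$ (all integrals are with respect to Lebesgue measure), and $f=f_U/\int f_U$. Let $(X_k)_{k\ge1}$ be $\mathbb R^d$-valued random variables, $\mathcal F_k=\sigma(X_1,\dots,X_k)$ for $k\ge 1$, $\mathcal F_0$ trivial. A policy of $(X_k)_{k\ge 1}$ is a sequence $(q_k)_{k\ge0}$ of (random) probability densities on $\mathbb R^d$, adapted to $(\mathcal F_k)_{k\ge0}$, such that conditionally on $\mathcal F_{k-1}$, $X_k$ has density $q_{k-1}$, for all $k\ge1$. The density $q_0$ is deterministic. Importance weights: $W_k=f_U(X_k)/q_{k-1}(X_k)$; normalized weights: $W_{n,k}=W_k/\sum_{j=1}^nW_j$, $k=1,\dots,n$. Kernel estimate: $f_n(x)=\sum_{k=1}^nW_{n,k}K_{h_n}(x-X_k)$,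 where $K_h(u)=K(u/h)/h^d$. Sequences (deterministic): $(h_k)_{k\ge1}$ is positive and bounded; $(\lambda_k)_{k\ge1}\subset(0,1]$ is nonincreasing; $a_n=\sqrt{\log(n)/(nh_n^d)}$. For nonnegative sequences, $u_n\ll v_n$ means $u_n/v_n\to0$. Assumptions: (H1) $f$ is a probability density on $\mathbb R^d$, twice continuously differentiable with bounded second derivatives. (H2) $q_0$ is a probability density on $\mathbb R^d$; for every $\eta\in(0,1]$ there is $c_\eta>0$ with $f(x)^\eta\le c_\eta q_0(x)$ for all $x\in\mathbb R^d$; and there are $C_0,r_0>0$ with $q_0(x)\le C_0(1+\|x\|)^{-r_0}$ for all $x$. (H3) $K:\mathbb R^d\to[0,\infty)$ is a Lipschitz probability density with $\int uK(u)\,du=0$, $\int\|u\|^2K(u)\,du<\infty$, and there are $C_K,r_K>0$ with $K(x)\le C_K(1+\|x\|)^{-r_K}$ for all $x$. *)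

(* Defs.v *)
From HB Require Import structures.
From mathcomp Require Import all_boot all_order all_algebra.
From mathcomp Require Import all_classical all_reals all_analysis.

Set Implicit Arguments.
Unset Strict Implicit.
Unset Printing Implicit Defensive.

Import Order.TTheory GRing.Theory Num.Theory.
Import numFieldNormedType.Exports.

Local Open Scope classical_set_scope.
Local Open Scope ring_scope.

Definition rV_display : measure_display.
Proof. exact: default_measure_display. Qed.

(* Row vectors carry the sigma-algebra generated by the coordinates, i.e. the
   Borel sigma-algebra of R^n. *)
Section measurable_rV.
Context {R : realType} {n : nat}.

Definition rV_coord (i : 'I_n) (x : 'rV[R]_n) : measurableTypeR R := x ord0 i.

Let rV_set0 : g_sigma_preimage rV_coord set0.
Proof. exact: sigma_algebra0. Qed.

Let rV_setC A : g_sigma_preimage rV_coord A -> g_sigma_preimage rV_coord (~` A).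
Proof. exact: sigma_algebraC. Qed.

Let rV_bigcup (F : _^nat) : (forall i, g_sigma_preimage rV_coord (F i)) ->
  g_sigma_preimage rV_coord (\bigcup_i (F i)).
Proof. exact: sigma_algebra_bigcup. Qed.

HB.instance Definition _ := @isMeasurable.Build rV_display
  'rV[R]_n (g_sigma_preimage rV_coord) rV_set0 rV_setC rV_bigcup.

End measurable_rV.


Section lebesgue_rV.
Context {R : realType}.

Definition rV_cons n (z : measurableTypeR R * 'rV[R]_n) : 'rV[R]_n.+1 :=
  \row_j oapp (fun i => z.2 ord0 i) z.1 (unlift ord0 j).

(* The library has no Lebesgue measure on R^n: it is the n-fold product of the
   one-dimensional one, transported to row vectors. *)
Fixpoint lebesgue_rV n : set 'rV[R]_n -> \bar R :=
  if n is n'.+1 then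
    pushforward (lebesgue_measure \x @lebesgue_rV n')%E (@rV_cons n')
  else \d_(0 : 'rV[R]_0).

Lemma measurable_rVP d (T : measurableType d) n (f : T -> 'rV[R]_n) :
  measurable_fun [set: T] f <->
  forall i, measurable_fun [set: T] (fun x => f x ord0 i : measurableTypeR R).
Proof.
apply: (@iff_trans _ (g_sigma_preimage
    (fun i => rV_coord i \o f) `<=` measurable)).
  rewrite g_sigma_preimage_comp; split=> [mf A [/= C preC <-]|prefS].
    exact: mf.
  by move=> _ A mA; apply: prefS; exists A.
split=> [fS i|mf].
- move=> _ A mA.
  apply: fS; apply: sub_sigma_algebra.
  case: n i => [[] []//|n i] in f *.
  rewrite -bigcup_mkord_ord.
  exists i; first exact: ltn_ord.
  by exists A => //; rewrite inord_val.
- apply: smallest_sub; first exact: sigma_algebra_measurable.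
  case: n => [|n] in f mf *; first by rewrite big_ord0.
  rewrite -bigcup_mkord_ord; apply: bigcup_sub => i Ii.
  by move=> A [B mB <-]; exact: mf.
Qed.

Lemma measurable_rV_coord n (i : 'I_n) : measurable_fun setT (@rV_coord R n i).
Proof. by move: i; apply/measurable_rVP; exact: measurable_id. Qed.

Lemma measurable_rV_cons n : measurable_fun setT (@rV_cons n).
Proof.
apply/measurable_rVP => j; rewrite /rV_cons.
under eq_fun do rewrite mxE.
case: (unlift ord0 j) => [i|] /=; last exact: measurable_fst.
exact: measurableT_comp (measurable_rV_coord i) measurable_snd.
Qed.

Definition rV_uncons n (x : 'rV[R]_n.+1) : measurableTypeR R * 'rV[R]_n :=
  (x ord0 ord0, \row_i x ord0 (lift ord0 i)).

Lemma measurable_rV_uncons n : measurable_fun setT (@rV_uncons n).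
Proof.
apply/measurable_fun_pairP; split; first exact: measurable_rV_coord.
apply/measurable_rVP => i; rewrite /rV_uncons /comp /=.
under eq_fun do rewrite mxE.
exact: measurable_rV_coord.
Qed.

Lemma rV_consK n : cancel (@rV_cons n) (@rV_uncons n).
Proof.
move=> [a x]; rewrite /rV_cons /rV_uncons !mxE unlift_none /=; congr pair.
by apply/rowP => i; rewrite !mxE liftK.
Qed.

Section lebesgue_rV_step.
Variables (n : nat) (m : {sigma_finite_measure set 'rV[R]_n -> \bar R}).

Let mu := pushforward (lebesgue_measure \x m)%E (@rV_cons n).

Let mu_measure : {measure set _ -> \bar R} :=
  measure_function_pushforward__canonical__measure_function_Measure
    (lebesgue_measure \x m)%E (@measurable_rV_cons n).

HB.instance Definition _ := Measure.copy mu mu_measure.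

Let mu_sigma_finite : sigma_finite setT mu.
Proof.
have /sigma_finiteP[F [TF ndF Foo]] := sigma_finiteT (@lebesgue_measure R).
have /sigma_finiteP[G [TG ndG Goo]] := sigma_finiteT m.
exists (fun i => @rV_uncons n @^-1` (F i `*` G i)).
  rewrite -preimage_bigcup -[LHS](preimage_setT (@rV_uncons n)).
  congr (_ @^-1` _); rewrite -setXTT TF TG predeqE => -[x y]; split.
    move=> [/= [k _ Fkx] [l _ Gly]]; exists (maxn k l) => //; split.
    - by move: x Fkx; exact/subsetPset/ndF/leq_maxl.
    - by move: y Gly; exact/subsetPset/ndG/leq_maxr.
  by move=> [k _ []/= ? ?]; split; exists k.
move=> k; have [? ?] := Foo k; have [? ?] := Goo k; split.
  rewrite -[X in measurable X]setTI.
  by apply: measurable_rV_uncons => //; exact: measurableX.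
rewrite /mu /= /pushforward -comp_preimage.
rewrite (_ : _ \o _ = id); last by apply/funext => z /=; rewrite rV_consK.
by rewrite preimage_id product_measure1E// lte_mul_pinfty// ge0_fin_numE.
Qed.

HB.instance Definition _ :=
  Measure_isSigmaFinite.Build _ _ _ mu mu_sigma_finite.

Let sigma_finite_mu : {sigma_finite_measure set 'rV[R]_n.+1 -> \bar R} := mu.

Lemma lebesgue_rV_step :
  exists m' : {sigma_finite_measure set 'rV[R]_n.+1 -> \bar R},
    pushforward (lebesgue_measure \x m)%E (@rV_cons n)
      = m' :> (set _ -> \bar R).
Proof. by exists sigma_finite_mu. Qed.

End lebesgue_rV_step.

Lemma lebesgue_rV_sigma_finite_measure n :
  exists m : {sigma_finite_measure set 'rV[R]_n -> \bar R},
    @lebesgue_rV n = m :> (set _ -> \bar R).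
Proof.
elim: n => [|n [m mE]] /=; first by exists (\d_(0 : 'rV[R]_0)).
by have [m' m'E] := lebesgue_rV_step m; exists m'; rewrite mE.
Qed.

Section lebesgue_rV_instances.
Variable n : nat.

Let lebesgue_rV0 : @lebesgue_rV n set0 = 0%E.
Proof.
by have [m ->] := lebesgue_rV_sigma_finite_measure n; exact: measure0.
Qed.

Let lebesgue_rV_ge0 A : (0 <= @lebesgue_rV n A)%E.
Proof.
by have [m ->] := lebesgue_rV_sigma_finite_measure n; exact: measure_ge0.
Qed.

Let lebesgue_rV_sigma_additive : semi_sigma_additive (@lebesgue_rV n).
Proof.
have [m ->] := lebesgue_rV_sigma_finite_measure n.
exact: measure_semi_sigma_additive.
Qed.

HB.instance Definition _ := isMeasure.Build _ _ _ (@lebesgue_rV n)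
  lebesgue_rV0 lebesgue_rV_ge0 lebesgue_rV_sigma_additive.

Let lebesgue_rV_sigma_finite : sigma_finite setT (@lebesgue_rV n).
Proof.
by have [m ->] := lebesgue_rV_sigma_finite_measure n; exact: sigma_finiteT.
Qed.

HB.instance Definition _ := Measure_isSigmaFinite.Build _ _ _ (@lebesgue_rV n)
  lebesgue_rV_sigma_finite.

End lebesgue_rV_instances.

Lemma lebesgue_rV_prod n (A : 'I_n -> set (measurableTypeR R)) :
  (forall i, measurable (A i)) ->
  @lebesgue_rV n [set x | forall i, A i (x ord0 i)] =
    (\prod_(i < n) lebesgue_measure (A i))%E.
Proof.
elim: n A => [|n IH] A mA /=.
  by rewrite big_ord0 diracE mem_set//= => -[].
rewrite big_ord_recl -(IH (fun i => A (lift ord0 i)))//.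
have mB : measurable [set x : 'rV[R]_n | forall i, A (lift ord0 i) (x ord0 i)].
  rewrite (_ : mkset _ =
      \bigcap_(i in [set: 'I_n]) (rV_coord i @^-1` A (lift ord0 i))).
    apply: fin_bigcap_measurable => // i _; rewrite -[X in measurable X]setTI.
    by apply: measurable_rV_coord.
  by apply/seteqP; split => x /= Ax i; [move=> _|]; exact: Ax.
have [m mE] := lebesgue_rV_sigma_finite_measure n; rewrite [in RHS]mE.
rewrite -product_measure1E//= -mE /pushforward; congr product_measure1.
apply/seteqP; split => -[a x]/=.
  move=> H; split => [|i]; first by have := H ord0; rewrite mxE unlift_none.
  by have := H (lift ord0 i); rewrite mxE liftK.
by move=> [Aa Ax] i; rewrite mxE; case: unliftP => [j ->|->].
Qed.

End lebesgue_rV.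
Arguments lebesgue_rV {R n}.

Section R_d.
Context {R : realType} {d : nat}.
Implicit Types (p f K : 'rV[R]_d -> R) (x : 'rV[R]_d).

(* The norm `|x| that the library puts on row vectors is the sup norm. *)
Definition enorm x : R := Num.sqrt (\sum_(i < d) x ord0 i ^+ 2).

Definition prob_density p : Prop :=
  [/\ measurable_fun [set: 'rV[R]_d] p,
      forall x, 0 <= p x &
      (\int[lebesgue_rV]_x (p x)%:E = 1)%E].

Definition C2_bounded_second_derivatives f : Prop :=
  [/\ continuous f,
      forall i x, derivable f x 'e_i,
      forall i, continuous (fun x => 'D_('e_i) f x),
      forall i j x, derivable (fun y => 'D_('e_i) f y) x 'e_j &
      forall i j, continuous (fun x => 'D_('e_j) (fun y => 'D_('e_i) f y) x) /\
        exists M, forall x, `|'D_('e_j) (fun y => 'D_('e_i) f y) x| <= M].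

Definition H1 f : Prop := prob_density f /\ C2_bounded_second_derivatives f.

Definition H2 f (q0 : 'rV[R]_d -> R) : Prop :=
  [/\ prob_density q0,
      forall eta : R, 0 < eta <= 1 ->
        exists2 c, 0 < c & forall x, f x `^ eta <= c * q0 x &
      exists C0 r0 : R, [/\ 0 < C0, 0 < r0 &
        forall x, q0 x <= C0 * (1 + enorm x) `^ (- r0)]].

Definition H3 K : Prop :=
  [/\ prob_density K,
      exists L, forall x y, `|K x - K y| <= L * enorm (x - y),
      forall i : 'I_d, \int[lebesgue_rV]_u (u ord0 i * K u) = 0,
      (\int[lebesgue_rV]_u (enorm u ^+ 2 * K u)%:E < +oo)%E &
      exists CK rK : R, [/\ 0 < CK, 0 < rK &
        forall x, K x <= CK * (1 + enorm x) `^ (- rK)]].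

Definition scaled_kernel K (h : R) x : R := K (h^-1 *: x) / h ^+ d.

End R_d.

Section policy.
Context {R : realType} {d : nat} {dO : measure_display}.
Context {Omega : measurableType dO} {P : probability Omega R}.
(* All sequences are indexed by nat; the value X 0 is never used. *)
Variables (X : nat -> {RV P >-> 'rV[R]_d}) (q : nat -> Omega -> 'rV[R]_d -> R).

(* sigma(X_1, ..., X_k); for k = 0 the generating family is empty, so that the
   sigma-algebra is trivial. *)
Definition past (k : nat) : set (set Omega) :=
  g_sigma_preimage (fun i : 'I_k => X i.+1 : Omega -> 'rV[R]_d).

(* Adaptedness of the random density q k is joint measurability of
   (w, x) |-> q k w x with respect to past k and the Borel sets of R^d.
   The last clause says that q k is a version of the conditional density of
   X k.+1 given past k. *)
Definition is_policy : Prop :=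
  [/\ forall k w, prob_density (q k w),
      forall k, measurable_fun
        [set: g_sigma_algebraType (past k) * 'rV[R]_d]
        (fun z => q k z.1 z.2) &
      forall k (A : set Omega) (B : set 'rV[R]_d),
        past k A -> measurable B ->
        P (A `&` X k.+1 @^-1` B) =
        (\int[P]_(w in A) \int[lebesgue_rV]_(x in B) (q k w x)%:E)%E].

Variables (fU K : 'rV[R]_d -> R) (h : nat -> R).

Definition weight k w : R := fU (X k w) / q k.-1 w (X k w).

Definition total_weight n w : R := \sum_(1 <= j < n.+1) weight j w.

Definition normalized_weight n k w : R := weight k w / total_weight n w.

Definition kernel_estimate n w x : R :=
  \sum_(1 <= k < n.+1)
    normalized_weight n k w * scaled_kernel K (h n) (x - X k w).

(* The kernel estimate is the expression 0/0 on the event where all the weights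
   vanish, which may have positive probability when fU is not everywhere
   positive.  There, and only there, fk k is allowed to be any probability
   density. *)
Definition is_kernel_estimate (fk : nat -> Omega -> 'rV[R]_d -> R) : Prop :=
  forall k w, (0 < k)%N ->
    if 0 < total_weight k w then fk k w = kernel_estimate k w
    else prob_density (fk k w).

Definition weighted_sum (g : 'rV[R]_d -> R) n w : R :=
  \sum_(1 <= k < n.+1) normalized_weight n k w * g (X k w).

End policy.

Definition much_less {R : realType} (u v : nat -> R) : Prop :=
  (fun n => u n / v n) @ \oo --> (0 : R).

Definition a_seq {R : realType} (d : nat) (h : nat -> R) (n : nat) : R :=
  Num.sqrt (ln n%:R / (n%:R * h n ^+ d)).

(* The library's normal_prob m 0 is a uniform law, not the Dirac mass at m. *)
Definition centered_normal {R : realType} (v : R) :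
    probability (measurableTypeR R) R :=
  if v == 0 then \d_(0 : measurableTypeR R) : probability _ R
  else normal_prob 0 (Num.sqrt v) : probability _ R.

Definition cvg_in_distribution {R : realType} {dO : measure_display}
    {Omega : measurableType dO} (P : probability Omega R)
    (Z : nat -> Omega -> R) (mu : probability (measurableTypeR R) R) : Prop :=
  (forall n, measurable_fun [set: Omega] (Z n)) /\
  forall phi : R -> R, continuous phi ->
    (exists M, forall y, `|phi y| <= M) ->
    'E_P[phi \o Z n]%E @[n --> \oo] --> (\int[mu]_y (phi y)%:E)%E.

Definition asymptotic_variance {R : realType} {d : nat}
    (f g : 'rV[R]_d -> R) : R :=
  \int[lebesgue_rV]_x (g x ^+ 2 * f x) - (\int[lebesgue_rV]_x (g x * f x)) ^+ 2.

(* Main.v *)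
(* Write U_k = f(X_k) / q_(k-1)(X_k), gc = g - int g f, and let D_n be the mean of U_1, ..., U_n.
   The normalized error is (S_n / sqrt n) / D_n, where S_n sums the martingale differences
   U_k gc(X_k).  Given the past, the variance of the k-th one is int gc^2 f^2 / q_(k-1), so
   everything rests on comparing f^2 / q_k with f.  Pointwise in x, Chebyshev's inequality for D_k
   and for the unnormalized kernel estimate shows that q_k(x) is comparable to f(x) outside an
   event of probability O(rho_k / f(x)^2) with rho_k = O(lambda_k^(1 + eps)), and on that event
   q_k >= lambda_k q0.  Raising the probability to the power 1 / (1 + eps) absorbs 1 / lambda_k
   and leaves f^(2 eps / (1 + eps)) / q0 = O(q0) by (H2).  Hence E[f^2 / q_k] = O(q0) uniformly in
   k, E|f^2 / q_k - f| tends to 0 pointwise, and dominated convergence against gc^2 q0 gives the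
   hypotheses of the martingale central limit theorem.  The latter is proved for real
   characteristic functions by replacing one increment at a time, and is transferred to weak
   convergence by Gaussian smoothing. *)
From HB Require Import structures.
Require Import Defs.
From mathcomp Require Import all_boot all_order all_algebra.
From mathcomp Require Import all_classical all_reals all_analysis.
From mathcomp Require Import measurable_realfun ring lra.

Set Implicit Arguments.
Unset Strict Implicit.
Unset Printing Implicit Defensive.

Import Order.TTheory GRing.Theory Num.Theory.
Import numFieldNormedType.Exports.

Local Open Scope classical_set_scope.
Local Open Scope ring_scope.

(** * Integrals of real functions *)

(** The obstacle is a circle: [q k] is built from weights that are themselves ratios with
    denominators [q 0], ..., [q k.-1], and these are bounded only by c / lambda. Two levels of
    precision break it. The crude bound f^2 / q_k <= (c / lambda_k) f, with lambda nonincreasing,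
    controls the variances of D_k and of the kernel estimate at the price of a factor 1 / lambda_k;
    the resulting rate rho_k is still small enough to give the sharp bound on E[f^2 / q_k], free of
    lambda. All of this happens at a fixed point x, and the integral over x comes last.

    Conditional expectations are never formed: the policy is always tested by integrating against
    functions measurable for the past, such as cos (th S_k + b). The phase b replaces complex
    exponentials, a sine being a cosine with shifted phase.

    Replacing D_n by 1 relies on n lambda_n^2 -> oo: the variance of D_n is at most c / (n
    lambda_n), and it is divided once more by lambda_n in a weighted AM-GM inequality. This growth
    follows from a_n << lambda_n^(1 + eps) and the boundedness of h. *)

Section real_integrals.
Context d (T : measurableType d) (R : realType) (mu : {measure set T -> \bar R}).
Implicit Types f g : T -> R.

Lemma integrable_dominated f g : measurable_fun [set: T] f ->
  (forall x, `|f x| <= g x) -> mu.-integrable [set: T] (EFin \o g) ->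
  mu.-integrable [set: T] (EFin \o f).
Proof.
move=> mf fg; apply: le_integrable => //; first exact/measurable_EFinP.
by move=> x _ /=; rewrite lee_fin (le_trans (fg x))// ler_norm.
Qed.

Lemma EFin_Rintegral f : mu.-integrable [set: T] (EFin \o f) ->
  (\int[mu]_x f x)%:E = (\int[mu]_x (f x)%:E)%E.
Proof. by move=> fi; rewrite /Rintegral fineK//; exact: integrable_fin_num. Qed.

Lemma integrable_ge0_lty f : measurable_fun [set: T] f -> (forall x, 0 <= f x) ->
  (\int[mu]_x (f x)%:E < +oo)%E -> mu.-integrable [set: T] (EFin \o f).
Proof.
move=> mf f0 foo; apply/integrableP; split; first exact/measurable_EFinP.
rewrite (eq_integral (fun x => (f x)%:E))// => x _.
by rewrite /= ger0_norm.
Qed.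

Lemma ler_Rintegral f g : mu.-integrable [set: T] (EFin \o f) ->
  mu.-integrable [set: T] (EFin \o g) -> (forall x, f x <= g x) ->
  \int[mu]_x f x <= \int[mu]_x g x.
Proof. by move=> fi gi fg; apply: le_Rintegral. Qed.

Lemma norm_Rintegral_le f g : measurable_fun [set: T] f ->
  (forall x, `|f x| <= g x) -> mu.-integrable [set: T] (EFin \o g) ->
  `|\int[mu]_x f x| <= \int[mu]_x g x.
Proof.
move=> mf fg gi; have fi := integrable_dominated mf fg gi.
apply: le_trans (le_normr_Rintegral _ fi) _ => //.
by apply: ler_Rintegral => //; exact: integrable_norm.
Qed.

Lemma Rintegral_dominated_cvg (f_ : nat -> T -> R) f g :
  (forall n, measurable_fun [set: T] (f_ n)) -> measurable_fun [set: T] f ->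
  (forall x, f_ n x @[n --> \oo] --> f x) ->
  (forall n x, `|f_ n x| <= g x) -> mu.-integrable [set: T] (EFin \o g) ->
  \int[mu]_x f_ n x @[n --> \oo] --> \int[mu]_x f x.
Proof.
move=> mf_ mf f_f fg gi.
have [|||||fi _ H] := @dominated_convergence _ _ _ mu _ measurableT
  (fun n x => (f_ n x)%:E) (EFin \o f) (EFin \o g).
- by move=> n; exact/measurable_EFinP.
- exact/measurable_EFinP.
- by apply: aeW => x _; apply: cvg_EFin; [exact: nearW|exact: f_f].
- by [].
- by apply: aeW => x n _ /=; rewrite lee_fin.
by apply: fine_cvg; rewrite EFin_Rintegral.
Qed.

Lemma integrableD_real f g : mu.-integrable [set: T] (EFin \o f) ->
  mu.-integrable [set: T] (EFin \o g) ->
  mu.-integrable [set: T] (EFin \o (fun x => f x + g x)).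
Proof. by move=> fi gi; exact: (integrableD measurableT fi gi). Qed.

Lemma integrableB_real f g : mu.-integrable [set: T] (EFin \o f) ->
  mu.-integrable [set: T] (EFin \o g) ->
  mu.-integrable [set: T] (EFin \o (fun x => f x - g x)).
Proof. by move=> fi gi; exact: (integrableB measurableT fi gi). Qed.

Lemma integrableZl_real (c : R) f : mu.-integrable [set: T] (EFin \o f) ->
  mu.-integrable [set: T] (EFin \o (fun x => c * f x)).
Proof. by move=> fi; exact: (integrableZl measurableT c fi). Qed.

Lemma integrable_measurable f : mu.-integrable [set: T] (EFin \o f) ->
  measurable_fun [set: T] f.
Proof. by move=> /integrableP[/measurable_EFinP]. Qed.

Lemma Rintegral_sum (I : Type) (s : seq I) (F : I -> T -> R) :
  (forall i, mu.-integrable [set: T] (EFin \o F i)) ->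
  mu.-integrable [set: T] (EFin \o (fun x => \sum_(i <- s) F i x)) /\
  \int[mu]_x (\sum_(i <- s) F i x) = \sum_(i <- s) \int[mu]_x F i x.
Proof.
move=> Fi; elim: s => [|i s [IHi IHE]].
  under eq_fun do rewrite big_nil.
  split; first exact: integrable0.
  by rewrite big_nil Rintegral_cst// mul0r.
have -> : (fun x => \sum_(j <- i :: s) F j x) = (fun x => F i x + \sum_(j <- s) F j x).
  by apply/funext => x; rewrite big_cons.
split; first exact: (integrableD _ (Fi i) IHi).
by rewrite RintegralD// big_cons IHE.
Qed.

End real_integrals.

Section finite_measure_integrals.
Context d (T : measurableType d) (R : realType) (mu : {finite_measure set T -> \bar R}).

Lemma integrable_bounded (f : T -> R) (M : R) : measurable_fun [set: T] f ->
  (forall x, `|f x| <= M) -> mu.-integrable [set: T] (EFin \o f).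
Proof.
move=> mf fM; apply: (@integrable_dominated _ _ _ mu f (cst M)) => //.
exact: finite_measure_integrable_cst.
Qed.

End finite_measure_integrals.

Lemma probability_Rintegral_cst d (T : measurableType d) (R : realType)
  (P : probability T R) (c : R) : \int[P]_w c = c.
Proof. by rewrite (Rintegral_cst P measurableT c)/= probability_setT/= mulr1. Qed.

Lemma integrable_mul_of_sqr d (T : measurableType d) (R : realType)
    (mu : {measure set T -> \bar R}) (f g : T -> R) :
  measurable_fun [set: T] f -> measurable_fun [set: T] g ->
  mu.-integrable [set: T] (EFin \o (fun x => f x ^+ 2)) ->
  mu.-integrable [set: T] (EFin \o (fun x => g x ^+ 2)) ->
  mu.-integrable [set: T] (EFin \o (fun x => f x * g x)).
Proof.
move=> mf mg fi gi.
apply: (@integrable_dominated _ _ _ mu _ (fun x => f x ^+ 2 + g x ^+ 2)).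
- exact: measurable_funM.
- move=> x; rewrite ler_norml; apply/andP; split; nra.
- exact: (integrableD _ fi gi).
Qed.

(** * Integration against a measure with a density *)

Section density.
Context d (T : measurableType d) (R : realType).
Variables (mu nu : {measure set T -> \bar R}) (p : T -> R).
Hypotheses (mp : measurable_fun [set: T] p) (p_ge0 : forall x, 0 <= p x).
Hypothesis nuE : forall A, measurable A -> nu A = (\int[mu]_(x in A) (p x)%:E)%E.

Import HBNNSimple.

(** By monotone convergence and linearity it is enough to treat indicators, for which the identity
    is [nuE]. *)
Lemma ge0_integral_density (f : T -> \bar R) : measurable_fun [set: T] f ->
  (forall x, 0 <= f x)%E ->
  (\int[nu]_x f x = \int[mu]_x (f x * (p x)%:E))%E.
Proof.
move=> mf f0.
pose f_ := nnsfun_approx measurableT mf.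
transitivity (limn (fun n => \int[nu]_x (f_ n x)%:E)%E).
  rewrite -monotone_convergence//.
  - apply: eq_integral => y _; apply/esym/cvg_lim => //.
    by apply: cvg_nnsfun_approx.
  - by move=> n; exact/measurable_EFinP/measurable_funP.
  - by move=> n y _; rewrite lee_fin.
  - by move=> y _ m n mn; rewrite lee_fin; exact/lefP/nd_nnsfun_approx.
transitivity (limn (fun n => \int[mu]_x ((f_ n x)%:E * (p x)%:E))%E); last first.
  rewrite -monotone_convergence//.
  - apply: eq_integral => y _; apply/cvg_lim => //.
    apply: cvgeZr => //.
    by apply: cvg_nnsfun_approx.
  - move=> n; apply: emeasurable_funM; last exact/measurable_EFinP.
    by exact/measurable_EFinP/measurable_funP.
  - by move=> n y _; rewrite mule_ge0// lee_fin.
  - move=> y _ m n mn; apply: lee_wpmul2r; first by rewrite lee_fin.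
    by rewrite lee_fin; exact/lefP/nd_nnsfun_approx.
congr (limn _); apply/funext => n.
under eq_integral do rewrite fimfunE -fsumEFin//.
rewrite ge0_integral_fsum//; last 2 first.
- by move=> y; exact/measurable_EFinP/measurable_funM.
- by move=> y x _; rewrite nnfun_muleindic_ge0.
under [RHS]eq_integral.
  move=> x _; rewrite fimfunE -fsumEFin// ge0_mule_fsuml; last first.
    by move=> r; rewrite nnfun_muleindic_ge0.
  over.
rewrite ge0_integral_fsum//; last 2 first.
- move=> y; apply: emeasurable_funM; last exact/measurable_EFinP.
  by exact/measurable_EFinP/measurable_funM.
- move=> y x _; rewrite mule_ge0 ?lee_fin//.
  by rewrite -lee_fin EFinM nnfun_muleindic_ge0.
apply: eq_fsbigr => r _.
rewrite (integralZl_indic_nnsfun _ _ _ _)// integral_indic// setIT nuE; last exact: measurable_funPTI.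
(* The finite sum runs over all reals [r]; the negative ones have an empty preimage because the
   simple functions are nonnegative. *)
have [r0|r0] := leP 0 r; last first.
  rewrite preimage_nnfun0// integral_set0 mule0.
  under eq_integral do rewrite indic0 mulr0 mul0e.
  by rewrite integral0.
rewrite integral_mkcond.
under [RHS]eq_integral do rewrite EFinM -muleA.
rewrite ge0_integralZl//; last 2 first.
- apply: emeasurable_funM; last exact/measurable_EFinP.
  exact/measurable_EFinP.
- by move=> x _; rewrite mule_ge0// lee_fin.
congr (_ * _)%E; apply: eq_integral => x _.
by rewrite patchE indicE; case: ifPn; rewrite ?mul1e ?mul0e.
Qed.

End density.

Lemma measurable_fun_lt_nat d (T : measurableType d) (R : realType) (f g : T -> R) :
  measurable_fun [set: T] f -> measurable_fun [set: T] g ->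
  measurable_fun [set: T] (fun x => (f x < g x)%R%:R : R).
Proof.
move=> mf mg.
have -> : (fun x => (f x < g x)%R%:R : R) = \1_[set x | f x < g x].
  apply/funext => x; rewrite indicE; congr (_%:R); congr nat_of_bool.
  by apply/idP/idP; rewrite inE.
apply: measurable_indic; rewrite -[X in measurable X]setTI.
have /(_ measurableT [set true]) := measurable_fun_ltr mf mg; exact.
Qed.

(** The measurability proof is an explicit argument, so that bare functions can be used without
    first being packed as measurable functions. *)
Definition pushforward_measure d d' (T : measurableType d) (T' : measurableType d')
    (R : realType) (mu : {measure set T -> \bar R}) (f : T -> T')
    (mf : measurable_fun [set: T] f) : {measure set T' -> \bar R} :=
  measure_function_pushforward__canonical__measure_function_Measure mu mf.

(** * Fubini for dominated real functions *)

Section real_fubini.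
Context d1 d2 (T1 : measurableType d1) (T2 : measurableType d2) (R : realType).
Variables (m1 : {sigma_finite_measure set T1 -> \bar R}).
Variables (m2 : {finite_measure set T2 -> \bar R}).
Variables (f : T1 -> T2 -> R) (g : T1 -> R).
Hypothesis mf : measurable_fun [set: T1 * T2] (fun z => f z.1 z.2).
Hypothesis fg : forall x y, `|f x y| <= g x.
Hypothesis ig : m1.-integrable [set: T1] (EFin \o g).

Let mfE : measurable_fun [set: T1 * T2] (fun z => (f z.1 z.2)%:E).
Proof. exact/measurable_EFinP. Qed.

Let mf1 x : measurable_fun [set: T2] (f x).
Proof. exact: (measurableT_comp mf (pair1_measurable x)). Qed.

Let mf2 y : measurable_fun [set: T1] (f ^~ y).
Proof. exact: (measurableT_comp mf (pair2_measurable y)). Qed.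

Lemma dominated_section1 x : m2.-integrable [set: T2] (EFin \o f x).
Proof. by apply: (@integrable_bounded _ _ _ _ _ (g x)). Qed.

Lemma dominated_section2 y : m1.-integrable [set: T1] (EFin \o f ^~ y).
Proof. by apply: integrable_dominated ig. Qed.

(** The bound [g] depends on the first variable alone and [m2] has finite mass, so the double
    integral of the absolute value is at most that mass times the integral of [|g|]. *)
Let fint : (m1 \x m2)%E.-integrable [set: T1 * T2] (fun z => (f z.1 z.2)%:E).
Proof.
apply/(integrable12ltyP m1 m2 mfE) => /=.
have foo : (m2 setT < +oo)%E by rewrite -ge0_fin_numE// fin_num_measure.
have [mg igoo] := integrableP _ _ _ ig.
apply: (@le_lt_trans _ _ (\int[m1]_x (`|(g x)%:E| * m2 setT))%E).
  apply: ge0_le_integral => //.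
  - by move=> x _; apply: integral_ge0.
  - apply: (measurable_fun_fubini_tonelli_F (m2 := m2) (fun z => `|(f z.1 z.2)%:E|%E)) => //.
    exact: measurableT_comp.
  - by apply: emeasurable_funM => //; exact: measurableT_comp.
  - move=> x _; rewrite -integral_cst//; apply: ge0_le_integral => //.
    + by apply/measurable_EFinP; exact: measurableT_comp.
    + by move=> y _ /=; rewrite lee_fin (le_trans (fg x y))// ler_norm.
rewrite ge0_integralZr//; last exact: measurableT_comp.
by rewrite lte_mul_pinfty// ?integral_ge0// ge0_fin_numE ?integral_ge0.
Qed.

Lemma Rintegral_fubini :
  \int[m1]_x \int[m2]_y f x y = \int[m2]_y \int[m1]_x f x y.
Proof.
have := Fubini fint => /= FE.
rewrite /Rintegral; congr fine.
transitivity (\int[m1]_x \int[m2]_y (f x y)%:E)%E.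
  by apply: eq_integral => x _; rewrite -EFin_Rintegral//; exact: dominated_section1.
rewrite FE.
by apply: eq_integral => x _; rewrite -EFin_Rintegral//; exact: dominated_section2.
Qed.

Lemma measurable_Rintegral1 : measurable_fun [set: T1] (fun x => \int[m2]_y f x y).
Proof.
apply: (measurableT_comp (fine_measurable measurableT)).
exact: measurable_fubini_F fint.
Qed.

Lemma measurable_Rintegral2 : measurable_fun [set: T2] (fun y => \int[m1]_x f x y).
Proof.
apply: (measurableT_comp (fine_measurable measurableT)).
exact: measurable_fubini_G fint.
Qed.

End real_fubini.

(** * A martingale central limit theorem *)

Section trigonometric_bounds.
Context {R : realType}.
Implicit Types x y u : R.

(** Asking for the bound on the derivative only where [|s| <= |u|] lets each remainder estimate
    below follow from the preceding order, with constants that are not sharp. *)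
Lemma derivative_bound (f df : R -> R) (B u : R) :
  (forall s : R, is_derive s 1 f (df s)) ->
  (forall s, `|s| <= `|u| -> `|df s| <= B) -> `|f u - f 0| <= B * `|u|.
Proof.
move=> fdf dfB.
have cf : continuous f.
  by move=> s; apply/differentiable_continuous/derivable1_diffP; case: (fdf s).
have cfw A : {within A, continuous f} by apply: continuous_subspaceT.
have [u0|u0] := leP 0 u.
  have [c /[!in_itv]/= /andP[c0 cu] ->] := MVT_segment u0 (fun x _ => fdf x) (cfw _).
  rewrite subr0 normrM ler_wpM2r// dfB//.
  by rewrite !ger0_norm// (le_trans c0).
have [c /[!in_itv]/= /andP[c0 cu] E] := MVT_segment (ltW u0) (fun x _ => fdf x) (cfw _).
rewrite distrC E sub0r normrM normrN ler_wpM2r// dfB//.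
by rewrite !ler0_norm ?(ltW u0)// lerN2.
Qed.

Lemma norm_sin_le u : `|sin u| <= `|u|.
Proof.
have := @derivative_bound sin cos 1 u (fun s => is_derive_sin s).
by rewrite sin0 subr0 mul1r; apply => s _; exact: cos_max.
Qed.

Lemma norm_cos_sub1_le u : `|cos u - 1| <= `|u|.
Proof.
have := @derivative_bound cos (fun s => - sin s) 1 u (fun s => is_derive_cos s).
by rewrite cos0 mul1r; apply => s _; rewrite normrN; exact: sin_max.
Qed.

Lemma norm_cos_sub1_le2 u : `|cos u - 1| <= `|u| ^+ 2.
Proof.
have := @derivative_bound cos (fun s => - sin s) `|u| u (fun s => is_derive_cos s).
by rewrite cos0 expr2; apply => s su; rewrite normrN (le_trans (norm_sin_le _)).
Qed.

Lemma norm_sin_sub_le2 u : `|sin u - u| <= `|u| ^+ 2.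
Proof.
have := @derivative_bound (fun s => sin s - s) (fun s => cos s - 1) `|u| u
  (fun s => is_deriveB _ _).
rewrite sin0 subrr subr0 expr2; apply => s su.
exact: le_trans (norm_cos_sub1_le _) su.
Qed.

Lemma norm_sin_sub_le3 u : `|sin u - u| <= `|u| ^+ 3.
Proof.
have := @derivative_bound (fun s => sin s - s) (fun s => cos s - 1) (`|u| ^+ 2) u
  (fun s => is_deriveB _ _).
rewrite sin0 subrr subr0 -exprSr; apply => s su.
by apply: le_trans (norm_cos_sub1_le2 _) _; rewrite lerXn2r ?nnegrE.
Qed.

Let cos2 : R -> R := fun s => cos s - 1 + s ^+ 2 / 2.

Let is_derive_cos2 (s : R) : is_derive s 1 cos2 (s - sin s).
Proof.
rewrite /cos2.
apply: is_derive_eq.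
by rewrite /GRing.scale /=; lra.
Qed.

(** Quadratic bounds serve for large increments, which have only second moments; cubic ones serve
    for increments below a truncation level. *)
Lemma norm_cos_taylor_le2 u : `|cos u - 1 + u ^+ 2 / 2| <= `|u| ^+ 2 *+ 2.
Proof.
apply: le_trans (ler_normD _ _) _; rewrite [leRHS]mulr2n; apply: lerD; first exact: norm_cos_sub1_le2.
have u2 := sqr_ge0 u; rewrite real_normK ?num_real// ger0_norm ?divr_ge0//.
by rewrite ler_pdivrMr// ler_peMr// ler1n.
Qed.

Lemma norm_cos_taylor_le3 u : `|cos u - 1 + u ^+ 2 / 2| <= `|u| ^+ 3.
Proof.
have := @derivative_bound cos2 _ (`|u| ^+ 2) u is_derive_cos2.
rewrite /cos2 cos0 subrr expr0n/= mul0r add0r subr0 -exprSr; apply => s su.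
rewrite distrC; apply: le_trans (norm_sin_sub_le2 _) _; rewrite lerXn2r ?nnegrE//.
Qed.

Lemma cos_lipschitz x y : `|cos x - cos y| <= `|x - y|.
Proof.
have D (s : R) : is_derive s 1 (fun s => cos (s + y)) (- sin (s + y)).
  by apply: is_derive_eq; rewrite ?addr0 /GRing.scale/= mulr1.
have := @derivative_bound _ _ 1 (x - y) D.
rewrite subrK add0r mul1r; apply => s _; rewrite normrN; exact: sin_max.
Qed.

Lemma expRN_taylor_le2 x : 0 <= x -> `|1 - x - expR (- x)| <= x ^+ 2.
Proof.
move=> x0; have h := expR_ge1Dx (- x); have h1 := expR_ge1Dx x.
rewrite ler_norml; apply/andP; split; last by have := sqr_ge0 x; lra.
have : expR (- x) <= (1 + x)^-1.
  by rewrite expRN lef_pV2 ?posrE ?expR_gt0//; lra.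
have : (1 + x)^-1 <= 1 - x + x ^+ 2.
  rewrite -[leLHS]mul1r ler_pdivrMr; last lra.
  have : 0 <= x ^+ 3 by rewrite exprn_ge0.
  by rewrite !exprS expr0; lra.
lra.
Qed.

End trigonometric_bounds.

(** * The central limit theorem under abstract conditions *)

Section martingale_clt.
Context {R : realType} {dO : measure_display} {Omega : measurableType dO}.
Context {P : probability Omega R}.
Variables (xi : nat -> Omega -> R) (V C : R) (delta : nat -> R).

Let S k w := \sum_(0 <= i < k) xi i w.

Hypothesis mxi : forall k, measurable_fun [set: Omega] (xi k).
Hypothesis xi2 : forall k, P.-integrable [set: Omega] (EFin \o (fun w => xi k w ^+ 2)).
Hypothesis V_ge0 : 0 <= V.
(** The martingale property and the conditional variance are tested against these cosines of the
    partial sum, which stand for the functions of the past. *)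
Hypothesis orth : forall k (th b : R), \int[P]_w (cos (th * S k w + b) * xi k w) = 0.
Hypothesis condvar : forall k (th b : R),
  `|\int[P]_w (cos (th * S k w + b) * (xi k w ^+ 2 - V))| <= delta k.
Hypothesis delta0 : delta @ \oo --> 0.
Hypothesis xi2C : forall k, \int[P]_w (xi k w ^+ 2) <= C.
(** A Lindeberg condition that is uniform in [k < n] instead of averaged over [k]. *)
Hypothesis lindeberg : forall eps eta : R, 0 < eps -> 0 < eta ->
  \forall n \near \oo, forall k, (k < n)%N ->
    \int[P]_w (xi k w ^+ 2 * (eps * Num.sqrt n%:R < `|xi k w|)%R%:R) <= eta.

Let mS k : measurable_fun [set: Omega] (S k).
Proof. exact: measurable_sum. Qed.

Let mcosS k th b : measurable_fun [set: Omega] (fun w => cos (th * S k w + b)).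
Proof.
apply: (@measurableT_comp _ _ _ _ _ _ (@cos R)); first exact: continuous_measurable_fun (@continuous_cos R).
by apply: measurable_funD => //; apply: measurable_funM.
Qed.

Let alpha th b k := \int[P]_w cos (th * S k w + b).

Let cosS_int k th b : P.-integrable [set: Omega] (EFin \o (fun w => cos (th * S k w + b))).
Proof. by apply: (@integrable_bounded _ _ _ _ _ 1) => // w; exact: cos_max. Qed.

Let mind (T : R) k : measurable_fun [set: Omega] (fun w => (T < `|xi k w|)%R%:R : R).
Proof.
by apply: measurable_fun_lt_nat => //; exact: measurableT_comp.
Qed.

(* Taylor expansion of cos (th * S k.+1 + b) in the increment: the first-order term vanishes by
   [orth] and the second-order one is compared with V by [condvar]. *)
Let clt_step th b k (T : R) : 0 <= T ->
  `|alpha th b k.+1 - expR (- (th ^+ 2 * V / 2)) * alpha th b k| <=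
  4 * th ^+ 2 * \int[P]_w (xi k w ^+ 2 * (T < `|xi k w|)%R%:R)
  + 2 * `|th| ^+ 3 * T * C + th ^+ 2 / 2 * delta k + (th ^+ 2 * V / 2) ^+ 2.
Proof.
move=> T0; set e := expR _.
pose A w := th * S k w + b.
pose rest w := cos (A w) * (cos (th * xi k w) - 1 + (th * xi k w) ^+ 2 / 2)
  - sin (A w) * (sin (th * xi k w) - th * xi k w).
have mthxi : measurable_fun [set: Omega] (fun w => th * xi k w) by exact: measurable_funM.
have msin : measurable_fun [set: R] (@sin R) by exact: continuous_measurable_fun (@continuous_sin R).
have mcos : measurable_fun [set: R] (@cos R) by exact: continuous_measurable_fun (@continuous_cos R).
have mA : measurable_fun [set: Omega] A.
  by apply: measurable_funD => //; exact: measurable_funM.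
have mrest : measurable_fun [set: Omega] rest.
  apply: measurable_funB; apply: measurable_funM.
  - exact: measurableT_comp.
  - apply: measurable_funD; first by apply: measurable_funB => //; exact: measurableT_comp.
    by apply: measurable_funM => //; exact: measurable_funX.
  - exact: measurableT_comp.
  - by apply: measurable_funB => //; exact: measurableT_comp.
have mxi2 : measurable_fun [set: Omega] (fun w => xi k w ^+ 2) by exact: measurable_funX.
have trunc_int : P.-integrable [set: Omega] (EFin \o (fun w => xi k w ^+ 2 * (T < `|xi k w|)%R%:R)).
  apply: integrable_dominated (xi2 k).
    exact: (measurable_funM mxi2 (mind T k)).
  move=> w; rewrite normrM ger0_norm ?sqr_ge0// ler_piMr ?sqr_ge0//.
  by case: (T < _); rewrite ?normr1 ?normr0.
(* Above the threshold [T] the quadratic bounds apply (2 + 1 <= 4); below it the cubic ones do (1 +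
   1 = 2), with one factor [|xi k w|] traded for [T]. *)
pose bd w := 4 * th ^+ 2 * (xi k w ^+ 2 * (T < `|xi k w|)%R%:R) + 2 * `|th| ^+ 3 * T * xi k w ^+ 2.
have bd_int : P.-integrable [set: Omega] (EFin \o bd).
  by apply: integrableD_real => //; apply: integrableZl_real.
have rest_bd w : `|rest w| <= bd w.
  have th3 : 0 <= `|th| ^+ 3 by rewrite exprn_ge0.
  have x2 := sqr_ge0 (xi k w).
  have t2 := sqr_ge0 th.
  apply: le_trans (ler_normB _ _) _; rewrite !normrM.
  apply: (@le_trans _ _ (`|cos (th * xi k w) - 1 + (th * xi k w) ^+ 2 / 2|
     + `|sin (th * xi k w) - th * xi k w|)).
    by apply: lerD; rewrite ler_piMl// ?cos_max ?sin_max.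
  rewrite /bd; have [xT|xT] := ltP T `|xi k w|.
    apply: (@le_trans _ _ (`|th * xi k w| ^+ 2 *+ 2 + `|th * xi k w| ^+ 2)).
      by apply: lerD; [exact: norm_cos_taylor_le2|exact: norm_sin_sub_le2].
    rewrite -normrX ger0_norm ?sqr_ge0// exprMn mulr1 mulr2n.
    have : 0 <= th ^+ 2 * xi k w ^+ 2 by exact: mulr_ge0.
    have : 0 <= `|th| ^+ 3 * T * xi k w ^+ 2 by apply: mulr_ge0 => //; exact: mulr_ge0.
    lra.
  apply: (@le_trans _ _ (`|th * xi k w| ^+ 3 + `|th * xi k w| ^+ 3)).
    by apply: lerD; [exact: norm_cos_taylor_le3|exact: norm_sin_sub_le3].
  rewrite mulr0 mulr0 add0r normrM exprMn.
  have -> : `|xi k w| ^+ 3 = xi k w ^+ 2 * `|xi k w|.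
    by rewrite exprS mulrC -normrX ger0_norm ?sqr_ge0.
  have : `|th| ^+ 3 * (xi k w ^+ 2 * `|xi k w|) <= `|th| ^+ 3 * (xi k w ^+ 2 * T).
    by rewrite ler_wpM2l// ler_wpM2l.
  lra.
have rest_int := integrable_dominated mrest rest_bd bd_int.
(* The phase [b - pi / 2] turns the sine of the first-order term into a cosine, to which [orth]
   applies. *)
have lin_int : P.-integrable [set: Omega] (EFin \o (fun w => cos (th * S k w + (b - pi / 2)) * xi k w)).
  apply: integrable_mul_of_sqr => //.
  apply: (@integrable_bounded _ _ _ _ _ 1).
    by apply: measurable_funX.
  by move=> w; rewrite normrX exprn_ile1// cos_max.
have sq_int : P.-integrable [set: Omega] (EFin \o (fun w => cos (th * S k w + b) * (xi k w ^+ 2 - V))).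
  apply: (@integrable_dominated _ _ _ _ _ (fun w => xi k w ^+ 2 + V)).
  - by apply: measurable_funM => //; apply: measurable_funB => //; exact: measurable_funX.
  - move=> w; rewrite normrM; apply: (@le_trans _ _ (`|xi k w ^+ 2 - V|)).
      by rewrite ler_piMl// cos_max.
    by rewrite (le_trans (ler_normB _ _))// !ger0_norm// sqr_ge0.
  - by apply: integrableD_real => //; exact: finite_measure_integrable_cst.
have E w : cos (th * S k.+1 w + b) = e * cos (th * S k w + b) + (rest w +
    (- th) * (cos (th * S k w + (b - pi / 2)) * xi k w)
    + (- (th ^+ 2 / 2)) * (cos (th * S k w + b) * (xi k w ^+ 2 - V))
    + (1 - th ^+ 2 * V / 2 - e) * cos (th * S k w + b)).
  have -> : th * S k.+1 w + b = A w + th * xi k w.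
    by rewrite /S /A big_nat_recr//= /S; ring.
  rewrite cosD [in cos (_ + (b - _))]addrA cosBpihalf -/(A w) /rest.
  by field.
rewrite {1}/alpha; under eq_Rintegral do rewrite E.
rewrite RintegralD//; last 2 first.
- exact: integrableZl_real.
- apply: integrableD_real => //; last exact: integrableZl_real.
  apply: integrableD_real => //; last exact: integrableZl_real.
  by apply: integrableD_real => //; exact: integrableZl_real.
rewrite RintegralZl// -/(alpha th b k) addrAC subrr add0r.
rewrite RintegralD//; last 2 first.
- apply: integrableD_real => //; last exact: integrableZl_real.
  by apply: integrableD_real => //; exact: integrableZl_real.
- exact: integrableZl_real.
rewrite RintegralD//; last 2 first.
- by apply: integrableD_real => //; exact: integrableZl_real.
- exact: integrableZl_real.
rewrite RintegralD//; last exact: integrableZl_real.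
rewrite !RintegralZl// orth mulr0 addr0 -/(alpha th b k).
apply: le_trans (ler_normD _ _) _; apply: lerD; last first.
  rewrite normrM -[leRHS]mulr1; apply: ler_pM => //.
    by apply: expRN_taylor_le2; rewrite divr_ge0// mulr_ge0// sqr_ge0.
  apply: le_trans (@norm_Rintegral_le _ _ _ P _ (cst 1) _ _ _) _ => //.
  - by move=> w; exact: cos_max.
  - exact: finite_measure_integrable_cst.
  - by rewrite Rintegral_cst//= probability_setT mulr1.
apply: le_trans (ler_normD _ _) _; apply: lerD; last first.
  have th2 : 0 <= th ^+ 2 / 2 by rewrite divr_ge0 ?sqr_ge0.
  by rewrite normrM normrN (ger0_norm th2) ler_wpM2l.
apply: le_trans (norm_Rintegral_le mrest rest_bd bd_int) _.
rewrite /bd RintegralD//; last 2 first.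
- exact: integrableZl_real.
- exact: integrableZl_real.
by rewrite !RintegralZl// lerD2l ler_wpM2l// !mulr_ge0// exprn_ge0.
Qed.

(** With [th = t / sqrt n], the target exponential is the n-th power of the one-step factor of
    [clt_step]. This factor is at most 1, so the [n] one-step errors simply add up. *)
Theorem martingale_clt_cos (t b : R) :
  \int[P]_w cos (t * (S n w / Num.sqrt n%:R) + b) @[n --> \oo] -->
  expR (- (t ^+ 2 * V / 2)) * cos b.
Proof.
apply/cvgrPdist_le => /= kap kap0.
have C0 : 0 <= C.
  by apply: le_trans (xi2C 0%N); apply: Rintegral_ge0 => w _; exact: sqr_ge0.
(* [eps] and [eta] bring the cubic error and the Lindeberg error below [kap / 4] each; the [+ 1]
   keeps the denominators positive when [t] or [C] vanishes. *)
pose eps := kap / 4 / (2 * `|t| ^+ 3 * C + 1).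
have den0 : 0 < 2 * `|t| ^+ 3 * C + 1.
  by rewrite ltr_pwDr// !mulr_ge0// exprn_ge0.
have eps0 : 0 < eps by rewrite !divr_gt0.
pose eta := kap / 4 / (4 * t ^+ 2 + 1).
have den1 : 0 < 4 * t ^+ 2 + 1 by have := sqr_ge0 t; lra.
have eta0 : 0 < eta by rewrite !divr_gt0.
(* The conditional variance errors enter only through their average, hence Cesaro. *)
have ces : (t ^+ 2 / 2) * arithmetic_mean delta n @[n --> \oo] --> (t ^+ 2 / 2) * 0.
  by apply: cvgMr; exact: cesaro.
have quad : (t ^+ 2 * V / 2) ^+ 2 / n.+1%:R @[n --> \oo] --> (t ^+ 2 * V / 2) ^+ 2 * 0.
  by apply: cvgMr; exact: cvg_harmonic.
rewrite mulr0 in ces; rewrite mulr0 in quad.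
have k4 : 0 < kap / 4 by rewrite divr_gt0.
move/cvgr0Pnorm_le : ces => /(_ _ k4) ces.
move/cvgr0Pnorm_le : quad => /(_ _ k4) quad.
(* Stated at [n.+1] so that the scaling factor is positive. *)
have step n : `|\int[P]_w cos (t * (S n.+1 w / Num.sqrt n.+1%:R) + b)
     - expR (- (t ^+ 2 * V / 2)) * cos b| <=
   \sum_(0 <= k < n.+1) (4 * t ^+ 2 / n.+1%:R *
        \int[P]_w (xi k w ^+ 2 * (eps * Num.sqrt n.+1%:R < `|xi k w|)%R%:R)
     + 2 * `|t| ^+ 3 * eps * C / n.+1%:R + t ^+ 2 / 2 / n.+1%:R * delta k
     + (t ^+ 2 * V / 2) ^+ 2 / n.+1%:R ^+ 2).
  set r := Num.sqrt n.+1%:R.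
  have r0 : 0 < r by rewrite sqrtr_gt0.
  have rn0 : r != 0 by rewrite gt_eqF.
  have r2 : n.+1%:R = r ^+ 2 by rewrite sqr_sqrtr.
  pose th := t / r.
  have th2 : th ^+ 2 = t ^+ 2 / n.+1%:R by rewrite r2 expr_div_n.
  have nn0 : n.+1%:R != 0 :> R by rewrite pnatr_eq0.
  under eq_Rintegral do rewrite mulrCA mulrC -mulrA (mulrC r^-1) mulrA mulrAC -/th.
  pose e := expR (- (th ^+ 2 * V / 2)).
  have eE : expR (- (t ^+ 2 * V / 2)) = e ^+ n.+1.
    rewrite /e -expRM_natl th2; congr expR; rewrite -mulNr; field.
    by rewrite -natr1 in nn0; rewrite addrC.
  rewrite eE -/(alpha th b n.+1).
  have al0 : alpha th b 0%N = cos b.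
    rewrite /alpha; under eq_Rintegral do rewrite /S big_geq// mulr0 add0r.
    by rewrite Rintegral_cst//= probability_setT mulr1.
  have e01 : 0 <= e <= 1.
    rewrite expR_ge0/= -[leRHS]expR0 ler_expR oppr_le0 divr_ge0// mulr_ge0//.
    exact: sqr_ge0.
  set F := (X in _ <= \sum_(0 <= k < n.+1) X k).
  suff G m : `|alpha th b m - e ^+ m * cos b| <= \sum_(0 <= k < m) F k by exact: G.
  elim: m => [|m IH]; first by rewrite expr0 mul1r al0 subrr normr0 big_geq.
  rewrite big_nat_recr//= exprS -mulrA.
  have -> : alpha th b m.+1 - e * (e ^+ m * cos b) =
     e * (alpha th b m - e ^+ m * cos b) + (alpha th b m.+1 - e * alpha th b m) by ring.
  apply: le_trans (ler_normD _ _) _; apply: lerD.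
    rewrite normrM; case/andP : e01 => e0 e1; rewrite (ger0_norm e0).
    by apply: le_trans IH; rewrite ler_piMl.
  have T0 : 0 <= eps * r by rewrite mulr_ge0// ltW.
  apply: le_trans (clt_step th b m T0) _; rewrite /F -/r th2.
  have -> : 2 * `|th| ^+ 3 * (eps * r) * C = 2 * `|t| ^+ 3 * eps * C / n.+1%:R.
    rewrite /th normrM normfV (gtr0_norm r0) r2 exprMn; by field.
  have -> : t ^+ 2 / n.+1%:R / 2 = t ^+ 2 / 2 / n.+1%:R by rewrite mulrAC.
  have -> : (t ^+ 2 / n.+1%:R * V / 2) ^+ 2 = (t ^+ 2 * V / 2) ^+ 2 / n.+1%:R ^+ 2.
    by move: nn0; set m' : R := n.+1%:R => nn0; field.
  by rewrite mulrA.
have lind := lindeberg eps0 eta0.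
suff : \forall n \near \oo, `|expR (- (t ^+ 2 * V / 2)) * cos b -
    \int[P]_w cos (t * (S n.+1 w / Num.sqrt n.+1%:R) + b)| <= kap.
  move=> [N _ HN]; exists N.+1 => // -[|n] //= Nn.
  exact: HN.
have lind1 : \forall n \near \oo, forall k, (k < n.+1)%N ->
    \int[P]_w (xi k w ^+ 2 * (eps * Num.sqrt n.+1%:R < `|xi k w|)%R%:R) <= eta.
  by move: lind => [N _ HN]; exists N => // n /= Nn; apply: HN; rewrite /= leqW.
near=> n.
rewrite distrC; apply: le_trans (step n) _.
have nn0 : n.+1%:R != 0 :> R by rewrite pnatr_eq0.
have n0 : 0 < n.+1%:R :> R by rewrite ltr0n.
rewrite !big_split/=.
rewrite -[leRHS](_ : kap / 4 + kap / 4 + kap / 4 + kap / 4 = kap); last by field.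
have sumc (c : R) : \sum_(0 <= k < n.+1) c = c * n.+1%:R.
  by rewrite big_const_nat subn0 iter_addr_0 mulr_natr.
apply: lerD; [apply: lerD; [apply: lerD|]|].
- apply: (@le_trans _ _ (\sum_(0 <= k < n.+1) (4 * t ^+ 2 / n.+1%:R * eta))).
    rewrite big_nat_cond [leRHS]big_nat_cond; apply: ler_sum => k /andP[/andP[_ kn] _].
    rewrite ler_wpM2l//; first by rewrite divr_ge0 ?ler0n// mulr_ge0 ?ler0n ?sqr_ge0.
    by move: k kn; near: n.
  rewrite sumc mulrAC divfK//.
  rewrite /eta mulrA ler_pdivrMr// mulrC ler_wpM2l ?ltW//.
  by rewrite ltrDl.
- rewrite sumc divfK// /eps -!mulrA mulrCA mulrA (mulrA 2) mulrA.
  rewrite [leLHS](_ : _ = (kap / 4) * ((2 * `|t| ^+ 3 * C) / (2 * `|t| ^+ 3 * C + 1))); last by field; rewrite gt_eqF.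
  by rewrite ler_piMr// ?(ltW k4)// ler_pdivrMr// mul1r lerDl.
- rewrite -mulr_sumr.
  apply: le_trans (ler_norm _) _; rewrite -mulrA.
  rewrite (_ : _ * \sum_(0 <= k < n.+1) _ = arithmetic_mean delta n); last by [].
  near: n; exact: ces.
- rewrite sumc.
  rewrite (_ : _ * _ = (t ^+ 2 * V / 2) ^+ 2 / n.+1%:R); last by field.
  apply: le_trans (ler_norm _) _; near: n; exact: quad.
Unshelve. all: by end_near. Qed.

End martingale_clt.

(** * Lebesgue measure on R^d *)

Section lebesgue_rV_change_of_variables.
Context {R : realType}.

(** The reflection [a - h * r] is the substitution [y = x - h * u] of kernel smoothing; with [h = 1]
    it also flips a convolution. *)
Lemma lebesgue_measure_affine (a h : R) (A : set R) : 0 < h -> measurable A ->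
  (h%:E * pushforward lebesgue_measure (fun r : measurableTypeR R => (a - h * r)%R : measurableTypeR R) A
   = lebesgue_measure A)%E.
Proof.
move=> h0 mA.
have mphi : measurable_fun [set: measurableTypeR R] ((fun r => a - h * r) : measurableTypeR R -> measurableTypeR R).
  by apply: measurable_funB => //; exact: measurable_funM.
pose m := mscale (NngNum (ltW h0)) (pushforward_measure (@lebesgue_measure R) mphi).
transitivity (m A); first by [].
apply/esym/lebesgue_measure_unique => //= _ [[b c] /= bc] <-.
rewrite /m /mscale/= /pushforward.
(* The reflection exchanges the open and the closed end of the interval. *)
rewrite (_ : _ @^-1` _ = `[((a - c) / h), ((a - b) / h)[%classic); last first.
  apply/seteqP; split => r /=; rewrite !in_itv/= => /andP[].
    move=> H1 H2; apply/andP; split.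
      by rewrite ler_pdivrMr//; lra.
    by rewrite ltr_pdivlMr//; lra.
  rewrite ler_pdivrMr// ltr_pdivlMr// => H1 H2; apply/andP; split; lra.
rewrite !lebesgue_measure_itv/= !lte_fin.
rewrite ltr_pM2r ?invr_gt0// ltrD2l ltrN2.
case: ifPn => _; last by rewrite mule0.
by rewrite -!EFinB -EFinM; congr EFin; field; rewrite gt_eqF.
Qed.

Lemma ge0_integral_affine (a h : R) (F : measurableTypeR R -> \bar R) : 0 < h ->
  measurable_fun [set: measurableTypeR R] F -> (forall r, 0 <= F r)%E ->
  (\int[lebesgue_measure]_r F r = h%:E * \int[lebesgue_measure]_r F (a - h * r)%R)%E.
Proof.
move=> h0 mF F0.
have mphi : measurable_fun [set: measurableTypeR R] ((fun r => a - h * r) : measurableTypeR R -> measurableTypeR R).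
  by apply: measurable_funB => //; exact: measurable_funM.
pose m := mscale (NngNum (ltW h0)) (pushforward_measure (@lebesgue_measure R) mphi).
rewrite (@eq_measure_integral _ _ _ _ m); last first.
  by move=> A mA _; exact/esym/lebesgue_measure_affine.
rewrite ge0_integral_mscale//= ; congr (_ * _)%E.
by rewrite (ge0_integral_pushforward mphi).
Qed.

(** In dimension [n.+1] the measure unfolds to the pushforward of a product, so Tonelli splits off
    the first coordinate. *)
Lemma ge0_integral_lebesgue_rVS n (F : 'rV[R]_n.+1 -> \bar R) :
  measurable_fun [set: 'rV[R]_n.+1] F -> (forall x, 0 <= F x)%E ->
  (\int[lebesgue_rV]_x F x =
   \int[lebesgue_measure]_a \int[lebesgue_rV]_z F (rV_cons (a, z)))%E.
Proof.
move=> mF F0.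
have -> : (\int[lebesgue_rV]_x F x =
  \int[pushforward (lebesgue_measure \x @lebesgue_rV R n) (@rV_cons R n)]_x F x)%E by [].
rewrite (ge0_integral_pushforward (@measurable_rV_cons R n))// preimage_setT.
have mFc : measurable_fun setT (F \o @rV_cons R n).
  exact: measurableT_comp mF (@measurable_rV_cons R n).
exact: (fubini_tonelli1 (F \o @rV_cons R n) mFc (fun z => F0 _)).
Qed.

Lemma measurable_rV_affine n (x : 'rV[R]_n) (h : R) :
  measurable_fun [set: 'rV[R]_n] (fun u => x - h *: u).
Proof.
apply/measurable_rVP => i.
under eq_fun do rewrite !mxE.
apply: measurable_funB => //; apply: measurable_funM => //.
exact: measurable_rV_coord.
Qed.

(** Induction on the dimension: the tail of the vector contributes [h ^+ n] and the first coordinate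
    the last factor [h]. *)
Lemma ge0_integral_rV_affine n (x : 'rV[R]_n) (h : R) (F : 'rV[R]_n -> \bar R) : 0 < h ->
  measurable_fun [set: 'rV[R]_n] F -> (forall x, 0 <= F x)%E ->
  (\int[lebesgue_rV]_y F y = (h ^+ n)%:E * \int[lebesgue_rV]_u F (x - h *: u)%R)%E.
Proof.
move=> h0; elim: n x F => [|n IH] x F mF F0.
  rewrite expr0 mul1e; apply: eq_integral => y _; congr F.
  by apply/rowP => -[].
rewrite ge0_integral_lebesgue_rVS// ge0_integral_lebesgue_rVS//; last first.
  exact: measurableT_comp mF (measurable_rV_affine _ _).
have mFc : measurable_fun setT (F \o @rV_cons R n).
  exact: measurableT_comp mF (@measurable_rV_cons R n).
have mFa (a : measurableTypeR R) : measurable_fun setT (fun z => F (rV_cons (a, z))).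
  exact: (measurableT_comp mFc (pair1_measurable a)).
pose x' : 'rV[R]_n := \row_i x ord0 (lift ord0 i).
transitivity (\int[lebesgue_measure]_a ((h ^+ n)%:E * \int[lebesgue_rV]_z F (rV_cons (a, x' - h *: z)%R)))%E.
  apply: eq_integral => a _; exact: (IH x' _ (mFa a)).
have mG : measurable_fun [set: measurableTypeR R * 'rV[R]_n] (fun z => F (rV_cons (z.1, x' - h *: z.2))).
  apply: (measurableT_comp mFc); apply/measurable_fun_pairP; split.
    exact: measurable_fst.
  exact: (measurableT_comp (measurable_rV_affine x' h) measurable_snd).
have mG1 := measurable_fun_fubini_tonelli_F (m2 := @lebesgue_rV R n) _ mG (fun z => F0 _).
rewrite ge0_integralZl//; last 2 first.
- by move=> a _; apply: integral_ge0.
- by rewrite lee_fin exprn_ge0// ltW.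
rewrite [X in ((h ^+ n)%:E * X)%E](@ge0_integral_affine (x ord0 ord0) h)//; last first.
  by move=> a; apply: integral_ge0.
rewrite muleA -EFinM -exprSr; congr (_ * _)%E.
apply: eq_integral => a _; apply: eq_integral => z _; congr F.
apply/rowP => j; rewrite /rV_cons !mxE/=.
by case: unliftP => [i ->|->] /=; rewrite ?mxE.
Qed.

End lebesgue_rV_change_of_variables.

(** * A second-order Taylor bound from partial derivatives *)

Section taylor_rV.
Context {R : realType} {d : nat}.
Implicit Types (f g : 'rV[R]_d -> R) (x v : 'rV[R]_d).

Lemma is_derive_along_line g x v (s : R) : derivable g (x + s *: v) v ->
  is_derive s 1 (fun s : R => g (x + s *: v)) ('D_v g (x + s *: v)).
Proof.
move=> dg.
have E : (fun r : R => r^-1 *: (g (x + (r *: 1 + s) *: v) - g (x + s *: v))) =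
   (fun r : R => r^-1 *: (g (r *: v + (x + s *: v)) - g (x + s *: v))).
  by apply/funext => r; rewrite scalerDl scaler1 addrCA.
apply: DeriveDef.
  by rewrite /derivable E.
by rewrite /derive E.
Qed.

Lemma partial_lipschitz1 g x (i : 'I_d) (M c : R) :
  (forall y, derivable g y 'e_i) -> (forall y, `|'D_('e_i) g y| <= M) ->
  `|g (x + c *: 'e_i) - g x| <= M * `|c|.
Proof.
move=> dg gM.
have := @derivative_bound _ _ _ M c (fun s => is_derive_along_line (dg (x + s *: 'e_i))).
by rewrite scale0r addr0; apply => s _; exact: gM.
Qed.

(** The point is moved one coordinate at a time along [s], so that the mean value theorem is used
    only on lines parallel to the axes. *)
Lemma partial_taylor f x v (M : R) (s : seq 'I_d) : 0 <= M ->
  (forall i y, derivable f y 'e_i) ->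
  (forall i j y, derivable (fun z => 'D_('e_i) f z) y 'e_j) ->
  (forall i j y, `|'D_('e_j) (fun z => 'D_('e_i) f z) y| <= M) ->
  `|f (x + \sum_(i <- s) v ord0 i *: 'e_i) - f x - \sum_(i <- s) v ord0 i * 'D_('e_i) f x|
    <= M * (\sum_(i <- s) `|v ord0 i|) ^+ 2.
Proof.
move=> M0 df ddf fM; elim: s x => [|i s IH] x.
  by rewrite !big_nil addr0 subrr subr0 normr0 expr0n/= mulr0.
rewrite !big_cons addrA; set y := x + _.
set A := \sum_(j <- s) `|_|.
have A0 : 0 <= A by apply: sumr_ge0.
(* Three errors: the remaining coordinates from [y], the replacement of the partial derivatives at
   [y] by those at [x], and the move from [x] to [y]. They sum to
   [M * (A ^+ 2 + A * |v_i| + |v_i| ^+ 2)], which is at most [M * (|v_i| + A) ^+ 2]. *)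
have -> : f (y + \sum_(j <- s) v ord0 j *: 'e_j) - f x -
   (v ord0 i * 'D_('e_i) f x + \sum_(j <- s) v ord0 j * 'D_('e_j) f x) =
  (f (y + \sum_(j <- s) v ord0 j *: 'e_j) - f y - \sum_(j <- s) v ord0 j * 'D_('e_j) f y)
  + \sum_(j <- s) v ord0 j * ('D_('e_j) f y - 'D_('e_j) f x)
  + (f y - f x - v ord0 i * 'D_('e_i) f x).
  have -> : \sum_(j <- s) v ord0 j * ('D_('e_j) f y - 'D_('e_j) f x) =
      \sum_(j <- s) v ord0 j * 'D_('e_j) f y - \sum_(j <- s) v ord0 j * 'D_('e_j) f x.
    by rewrite -sumrB; apply: eq_bigr => j _; rewrite mulrBr.
  by ring.
have h1 : `|f (y + \sum_(j <- s) v ord0 j *: 'e_j) - f y - \sum_(j <- s) v ord0 j * 'D_('e_j) f y| <= M * A ^+ 2 by exact: IH.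
have h2 : `|\sum_(j <- s) v ord0 j * ('D_('e_j) f y - 'D_('e_j) f x)| <= A * (M * `|v ord0 i|).
  apply: le_trans (ler_norm_sum _ _ _) _; rewrite /A mulr_suml; apply: ler_sum => j _.
  rewrite normrM ler_wpM2l//; apply: (@partial_lipschitz1 (fun z => 'D_('e_j) f z)) => //.
have h3 : `|f y - f x - v ord0 i * 'D_('e_i) f x| <= M * `|v ord0 i| ^+ 2.
  have D (r : R) : is_derive r 1 (fun r : R => f (x + r *: 'e_i) - r * 'D_('e_i) f x)
      ('D_('e_i) f (x + r *: 'e_i) - 'D_('e_i) f x).
    have := is_derive_along_line (df i (x + r *: 'e_i)) => D1.
    apply: is_deriveB.
    apply: is_derive_eq.
    by rewrite scaler0 add0r /GRing.scale/= mulr1.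
  have := @derivative_bound _ _ _ (M * `|v ord0 i|) (v ord0 i) D.
  rewrite scale0r addr0 mul0r subr0 -mulrA -expr2 addrAC; apply => r rv.
  apply: le_trans (@partial_lipschitz1 (fun z => 'D_('e_i) f z) x i M r _ _) _ => //.
  by rewrite ler_wpM2l.
have vi := normr_ge0 (v ord0 i).
apply: le_trans (ler_normD _ _) _; apply: le_trans (lerD (ler_normD _ _) (lexx _)) _.
apply: le_trans (lerD (lerD h1 h2) h3) _.
have := mulr_ge0 M0 (mulr_ge0 A0 vi).
nra.
Qed.

Lemma norm_coord_le_enorm v i : `|v ord0 i| <= enorm v.
Proof.
rewrite /enorm -sqrtr_sqr ler_wsqrtr// (bigD1 i)//= lerDl sumr_ge0// => j _.
exact: sqr_ge0.
Qed.

Lemma taylor_rV f x v (M : R) : 0 <= M ->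
  (forall i y, derivable f y 'e_i) ->
  (forall i j y, derivable (fun z => 'D_('e_i) f z) y 'e_j) ->
  (forall i j y, `|'D_('e_j) (fun z => 'D_('e_i) f z) y| <= M) ->
  `|f (x + v) - f x - \sum_i v ord0 i * 'D_('e_i) f x| <= M * d%:R ^+ 2 * enorm v ^+ 2.
Proof.
move=> M0 df ddf fM.
have := @partial_taylor f x v M (index_enum 'I_d) M0 df ddf fM.
rewrite -row_sum_delta => /le_trans; apply.
rewrite -mulrA ler_wpM2l// -exprMn lerXn2r ?nnegrE ?mulr_ge0 ?sqrtr_ge0 ?sumr_ge0//.
apply: (@le_trans _ _ (\sum_(i < d) enorm v)).
  by apply: ler_sum => i _; exact: norm_coord_le_enorm.
by rewrite sumr_const card_ord mulr_natl.
Qed.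

End taylor_rV.

(** * Levy's continuity theorem *)

Section integral_of_derivative.
Context {R : realType}.
Local Notation leb := (@lebesgue_measure R).

(** The fundamental theorem on [-n, n] followed by dominated convergence. This is the form of
    integration by parts behind the Gaussian integrals below. *)
Lemma Rintegral_derivative_vanishing (F f : R -> R) :
  (forall x : R, is_derive x 1 F (f x)) -> continuous f ->
  leb.-integrable [set: R] (EFin \o f) ->
  F n%:R @[n --> \oo] --> 0 -> F (- n%:R) @[n --> \oo] --> 0 ->
  \int[leb]_x f x = 0.
Proof.
move=> dF cf fi F0 FN0.
pose fn (n : nat) x := f x * \1_(`[- n%:R, n%:R]%classic : set R) x.
have mfn n : measurable_fun [set: R] (fn n).
  apply: measurable_funM; first exact: integrable_measurable fi.
  exact: measurable_indic.
have fn_f x : fn n x @[n --> \oo] --> f x.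
  apply: cvg_near_cst; near=> n.
  rewrite /fn indicE mem_set ?mulr1//= in_itv/= -ler_norml.
  near: n; exact: nbhs_infty_ger.
have fn_le n x : `|fn n x| <= `|f x|.
  by rewrite /fn normrM ler_piMr// indicE; case: (_ \in _); rewrite ?normr1 ?normr0.
have cv := @Rintegral_dominated_cvg _ _ _ leb _ _ _ mfn (integrable_measurable fi) fn_f fn_le (integrable_norm fi).
(* At [n.+1] the interval is nondegenerate. *)
have fnE n : \int[leb]_x fn n.+1 x = F n.+1%:R - F (- n.+1%:R).
  have ab : - n.+1%:R < n.+1%:R :> R by rewrite (@lt_trans _ _ 0)// ?oppr_lt0 ltr0n.
  have cF : continuous F.
    by move=> x; apply/differentiable_continuous/derivable1_diffP; case: (dF x).
  have H : (\int[leb]_(x in `[(- n.+1%:R)%R, n.+1%:R%R]) (f x)%:E)%E = ((F n.+1%:R)%:E - (F (- n.+1%:R)%R)%:E)%E.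
    apply: continuous_FTC2 => //.
    - exact: continuous_subspaceT.
    - split; first by move=> x _; case: (dF x).
      + by apply: cvg_at_right_filter; exact: cF.
      + by apply: cvg_at_left_filter; exact: cF.
    - by move=> x _; rewrite derive1E; case: (dF x).
  rewrite /Rintegral.
  suff -> : (\int[leb]_x (fn n.+1 x)%:E = \int[leb]_(x in `[(- n.+1%:R)%R, n.+1%:R%R]) (f x)%:E)%E by rewrite H.
  rewrite [RHS]integral_mkcond; apply: eq_integral => x _.
  by rewrite /fn patchE indicE; case: ifPn => _; rewrite ?mulr1 ?mulr0.
have cv2 : (fun n => \int[leb]_x fn n.+1 x) @ \oo --> ((0:R) - (0:R)).
  under eq_fun do rewrite fnE.
  by apply: cvgB; [rewrite (cvg_shiftS (fun n => F n%:R))|rewrite (cvg_shiftS (fun n => F (- n%:R)))].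
rewrite subr0 in cv2.
have cv1 : (fun n => \int[leb]_x fn n.+1 x) @ \oo --> \int[leb]_x f x.
  by rewrite (cvg_shiftS (fun n => \int[leb]_x fn n x)).
by have := cvg_unique _ cv1 cv2; apply.
Unshelve. all: by end_near. Qed.

End integral_of_derivative.

(** * Gaussian integrals *)

Section gaussian_integrals.
Context {R : realType}.
Variable s : R.
Hypothesis s0 : s != 0.
Local Notation leb := (@lebesgue_measure R).
Let pdf : R -> R := normal_pdf 0 s.

Lemma is_derive_normal_pdf (y : R) : is_derive y 1 pdf (- (y / s ^+ 2) * pdf y).
Proof.
rewrite /pdf normal_pdfE//.
rewrite [X in is_derive _ _ X _](_ : _ = (fun x => normal_peak s * expR (- (x ^+ 2 / (s ^+ 2 *+ 2))))); last first.
  by apply/funext => x; rewrite /normal_fun subr0 mulNr.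
apply: is_derive_eq.
rewrite /normal_fun subr0 (mulNr (y ^+ 2)) /GRing.scale/=.
by set E := expR _; field.
Qed.

(** Doubling the standard deviation absorbs polynomial factors, so integrability and decay reduce to
    those of another Gaussian density. *)
Lemma normal_pdf_moments_le : exists2 C, 0 <= C & forall y : R,
  (`|y| + y ^+ 2) * pdf y <= C * normal_pdf 0 (2 * s) y.
Proof.
(* The two exponents differ by [3 / 8 * y ^+ 2 / s ^+ 2], whose exponential is at least 1 plus
   itself. The factor [1 + 4 * s ^+ 2] then produces [1 + 3 / 2 * y ^+ 2], which exceeds
   [|y| + y ^+ 2]. *)
have s20 : 2 * s != 0 by rewrite mulf_neq0.
have s2 : 0 < s ^+ 2 by rewrite exprn_even_gt0.
exists ((1 + 4 * s ^+ 2) * normal_peak s / normal_peak (2 * s)).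
  by rewrite !mulr_ge0 ?invr_ge0 ?normal_peak_ge0// addr_ge0// mulr_ge0// ltW.
move=> y; rewrite /pdf !normal_pdfE//.
have pk := normal_peak_gt0 s0; have pk2 := normal_peak_gt0 s20.
rewrite [leRHS](_ : _ = normal_peak s * ((1 + 4 * s ^+ 2) * normal_fun 0 (2 * s) y)); last first.
  by field; rewrite gt_eqF.
rewrite [leLHS]mulrCA ler_pM2l// /normal_fun !subr0.
have -> : - y ^+ 2 / (s ^+ 2 *+ 2) = - y ^+ 2 / ((2 * s) ^+ 2 *+ 2) - 3 / 8 * y ^+ 2 / s ^+ 2.
  by field.
rewrite expRD mulrCA mulrC ler_pM2r ?expR_gt0//.
rewrite expRN ler_pdivrMr ?expR_gt0//.
have y2 := sqr_ge0 y.
have e1 : 1 + 3 / 8 * y ^+ 2 / s ^+ 2 <= expR (3 / 8 * y ^+ 2 / s ^+ 2) by exact: expR_ge1Dx.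
apply: le_trans (ler_wpM2l _ e1); last by rewrite addr_ge0// mulr_ge0// ltW.
have -> : (1 + 4 * s ^+ 2) * (1 + 3 / 8 * y ^+ 2 / s ^+ 2) =
  1 + 4 * s ^+ 2 + 3 / 8 * (y ^+ 2 / s ^+ 2) + 3 / 2 * y ^+ 2 by field.
have : 0 <= y ^+ 2 / s ^+ 2 by rewrite divr_ge0// ltW.
have : `|y| <= 1 + 2^-1 * y ^+ 2.
  rewrite -(real_normK (num_real y)); have := sqr_ge0 (`|y| - 1); lra.
lra.
Qed.

Lemma integrable_normal_moments :
  leb.-integrable [set: R] (EFin \o (fun y => (`|y| + y ^+ 2) * pdf y)).
Proof.
have [C C0 HC] := normal_pdf_moments_le.
apply: (@integrable_dominated _ _ _ leb _ (fun y => C * normal_pdf 0 (2 * s) y)).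
- apply: measurable_funM; last exact: measurable_normal_pdf.
  by apply: measurable_funD; [exact: normr_measurable|exact: measurable_funX].
- move=> y; rewrite ger0_norm// mulr_ge0 ?normal_pdf_ge0// addr_ge0//.
  exact: sqr_ge0.
- by apply: integrableZl_real; exact: integrable_normal_pdf.
Qed.

(** The sequence [u] stands for both [n] and [- n], the two ends of a boundary term. *)
Lemma normal_pdf_vanishes (u : nat -> R) : (forall n, `|u n| = n%:R) ->
  (1 + `|u n|) * pdf (u n) @[n --> \oo] --> 0.
Proof.
move=> un; have [C C0 HC] := normal_pdf_moments_le.
pose D := C * normal_peak (2 * s) * 2.
have s20 : 2 * s != 0 by rewrite mulf_neq0.
rewrite -(cvg_shiftS (fun n => (1 + `|u n|) * pdf (u n))).
apply: (@squeeze_cvgr _ _ _ _ (cst 0) (fun n => D * n.+1%:R^-1)).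
- apply: nearW => n /=; rewrite mulr_ge0 ?normal_pdf_ge0//=.
  rewrite ler_pdivlMr ?ltr0n//.
  apply: (@le_trans _ _ (2 * ((`|u n.+1| + u n.+1 ^+ 2) * pdf (u n.+1)))).
    rewrite mulrAC mulrA ler_wpM2r ?normal_pdf_ge0//.
    rewrite -(real_normK (num_real (u n.+1))) un.
    have : 1 <= n.+1%:R :> R by rewrite ler1n.
    nra.
  rewrite /D mulrC ler_wpM2r//; apply: le_trans (HC _) _.
  by rewrite ler_wpM2l// normal_pdf_ub.
- exact: cvg_cst.
- rewrite -[X in _ --> X](mulr0 D); apply: cvgMr.
  exact: cvg_harmonic.
Qed.

Lemma continuous_pdf : continuous pdf.
Proof. exact: continuous_normal_pdf. Qed.

Lemma Rintegral_normal_pdf : \int[leb]_y pdf y = 1.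
Proof. by rewrite /Rintegral integral_normal_pdf. Qed.

(** The derivative of [y * pdf y] is [pdf y - y ^+ 2 / s ^+ 2 * pdf y] and integrates to zero. *)
Lemma Rintegral_sqr_normal_pdf : \int[leb]_y (y ^+ 2 * pdf y) = s ^+ 2.
Proof.
have mi := integrable_normal_moments.
have i2 : leb.-integrable [set: R] (EFin \o (fun y => y ^+ 2 * pdf y)).
  apply: integrable_dominated mi.
    by apply: measurable_funM; [exact: measurable_funX|exact: measurable_normal_pdf].
  move=> x; have x2 := sqr_ge0 x; have px := normal_pdf_ge0 0 s x.
  rewrite ger0_norm; last exact: mulr_ge0.
  by rewrite ler_wpM2r ?normal_pdf_ge0// lerDr.
have i0 : leb.-integrable [set: R] (EFin \o pdf) by exact: integrable_normal_pdf.
have D (x : R) : is_derive x 1 (fun y => y * pdf y) (pdf x - s ^- 2 * (x ^+ 2 * pdf x)).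
  have d1 := is_derive_normal_pdf x.
  apply: is_derive_eq.
  by rewrite /GRing.scale/=; field.
have van (u : nat -> R) : (forall n, `|u n| = n%:R) -> u n * pdf (u n) @[n --> \oo] --> 0.
  move=> un; apply: norm_cvg0; have := normal_pdf_vanishes un.
  apply: squeeze_cvgr; last exact: cvg_cst.
  apply: nearW => n; rewrite normr_ge0/= normrM (ger0_norm (normal_pdf_ge0 _ _ _)).
  by rewrite ler_wpM2r ?normal_pdf_ge0// lerDr.
have di : leb.-integrable [set: R] (EFin \o (fun x => pdf x - s ^- 2 * (x ^+ 2 * pdf x))).
  by apply: integrableB_real => //; exact: integrableZl_real.
have := @Rintegral_derivative_vanishing _ _ _ D _ di _ _.
rewrite RintegralB// ?RintegralZl//; last exact: integrableZl_real.
rewrite Rintegral_normal_pdf => H.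
have /eqP : 1 - s ^- 2 * \int[leb]_y (y ^+ 2 * pdf y) = 0.
  apply: H.
  - move=> x; apply: cvgB; first exact: continuous_pdf.
    apply: cvgM; first exact: cvg_cst.
    by apply: cvgM; [exact: exprn_continuous|exact: continuous_pdf].
  - by apply: van => n; rewrite normr_nat.
  - by apply: van => n; rewrite normrN normr_nat.
rewrite subr_eq0 => /eqP E.
by rewrite -[LHS](mulVKf (expf_neq0 2 s0)) -E mulr1.
Qed.

(** As a function of [t] the integral satisfies F' = - s^2 t F: differentiate under the integral,
    then integrate by parts ([ibp]). Hence [F t * expR (t ^+ 2 * s ^+ 2 / 2)] is constant. *)
Lemma Rintegral_cos_normal_pdf (t b : R) :
  \int[leb]_y (cos (t * y + b) * pdf y) = expR (- (t ^+ 2 * s ^+ 2 / 2)) * cos b.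
Proof.
pose F (t : R) := \int[leb]_y (cos (t * y + b) * pdf y).
have mphase (x : R) : measurable_fun [set: measurableTypeR R] (fun y : R => x * y + b).
  by apply: measurable_funD => //; exact: measurable_funM.
have mcos x : measurable_fun [set: measurableTypeR R] (fun y : R => cos (x * y + b)).
  exact: (measurableT_comp (continuous_measurable_fun (@continuous_cos R)) (mphase x)).
have msin x : measurable_fun [set: measurableTypeR R] (fun y : R => sin (x * y + b)).
  exact: (measurableT_comp (continuous_measurable_fun (@continuous_sin R)) (mphase x)).
have mpdf : measurable_fun [set: measurableTypeR R] pdf by exact: measurable_normal_pdf.
have i0 : leb.-integrable [set: R] (EFin \o pdf) by exact: integrable_normal_pdf.
have icos x : leb.-integrable [set: R] (EFin \o (fun y => cos (x * y + b) * pdf y)).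
  apply: (@integrable_dominated _ _ _ leb _ pdf) => //.
    exact: measurable_funM.
  move=> y; rewrite normrM (ger0_norm (normal_pdf_ge0 _ _ _)).
  by rewrite ler_piMl ?normal_pdf_ge0// cos_max.
have mi := integrable_normal_moments.
have i1 : leb.-integrable [set: R] (EFin \o (fun y => `|y| * pdf y)).
  apply: (@integrable_dominated _ _ _ leb _ _ _ _ mi).
    by apply: measurable_funM => //; exact: normr_measurable.
  move=> y; rewrite normrM normr_id (ger0_norm (normal_pdf_ge0 _ _ _)).
  by rewrite ler_wpM2r ?normal_pdf_ge0// lerDl sqr_ge0.
have isin x : leb.-integrable [set: R] (EFin \o (fun y => y * sin (x * y + b) * pdf y)).
  apply: (@integrable_dominated _ _ _ leb _ _ _ _ i1).
    by apply: measurable_funM => //; exact: measurable_funM.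
  move=> y; rewrite !normrM (ger0_norm (normal_pdf_ge0 _ _ _)).
  by rewrite ler_wpM2r ?normal_pdf_ge0// ler_piMr// sin_max.
have ibp x : \int[leb]_y (y * sin (x * y + b) * pdf y) = s ^+ 2 * x * F x.
  have D (y : R) : is_derive y 1 (fun y => sin (x * y + b) * pdf y)
     (x * (cos (x * y + b) * pdf y) - s ^- 2 * (y * sin (x * y + b) * pdf y)).
    have d1 := is_derive_normal_pdf y.
    apply: is_derive_eq.
    by rewrite /GRing.scale/=; field.
  have di : leb.-integrable [set: R] (EFin \o (fun y =>
      x * (cos (x * y + b) * pdf y) - s ^- 2 * (y * sin (x * y + b) * pdf y))).
    by apply: integrableB_real; exact: integrableZl_real.
  have cphase : continuous (fun y : R => x * y + b).
    move=> y; apply: cvgD; last exact: cvg_cst.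
    by apply: cvgM; [exact: cvg_cst|exact: cvg_id].
  have csin : continuous (fun y : R => sin (x * y + b)).
    by move=> y; apply: (@continuous_comp _ _ _ (fun y : R => x * y + b) (@sin R) y); [exact: cphase|exact: continuous_sin].
  have ccos : continuous (fun y : R => cos (x * y + b)).
    by move=> y; apply: (@continuous_comp _ _ _ (fun y : R => x * y + b) (@cos R) y); [exact: cphase|exact: continuous_cos].
  have van (u : nat -> R) : (forall n, `|u n| = n%:R) -> sin (x * u n + b) * pdf (u n) @[n --> \oo] --> 0.
    move=> un; apply: norm_cvg0; have := normal_pdf_vanishes un.
    apply: squeeze_cvgr; last exact: cvg_cst.
    apply: nearW => n; rewrite normr_ge0/= normrM (ger0_norm (normal_pdf_ge0 _ _ _)).
    rewrite ler_wpM2r ?normal_pdf_ge0//; apply: le_trans (sin_max _) _.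
    by rewrite lerDl.
  have := @Rintegral_derivative_vanishing _ _ _ D _ di _ _.
  rewrite RintegralB//; [|exact: integrableZl_real..].
  rewrite !RintegralZl// -/(F x) => H.
  have /eqP : x * F x - s ^- 2 * \int[leb]_y (y * sin (x * y + b) * pdf y) = 0.
    apply: H.
    - move=> y; apply: cvgB.
        apply: cvgM; first exact: cvg_cst.
        by apply: cvgM; [exact: ccos|exact: continuous_pdf].
      apply: cvgM; first exact: cvg_cst.
      apply: cvgM; last exact: continuous_pdf.
      by apply: cvgM; [exact: cvg_id|exact: csin].
    - by apply: van => n; rewrite normr_nat.
    - by apply: van => n; rewrite normrN normr_nat.
  rewrite subr_eq0 => /eqP E.
  by rewrite -[LHS](mulVKf (expf_neq0 2 s0)) -E mulrA.
have dF (x : R) : is_derive x 1 F (- (s ^+ 2 * x * F x)).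
  have dphase (y r : R) : is_derive r 1 (fun r => cos (r * y + b) * pdf y) (- (y * sin (r * y + b) * pdf y)).
    apply: is_derive_eq.
    by rewrite /GRing.scale/=; ring.
  have p1E r y : partial1of2 (fun r y => cos (r * y + b) * pdf y) r y = - (y * sin (r * y + b) * pdf y).
    by rewrite partial1of2E; case: (dphase y r).
  have xin : (`]x - 1, x + 1[%classic : set R) x.
    by rewrite /= in_itv/= ltrDl ltrBlDr ltrDl !ltr01.
  have pb r y : `]x - 1, x + 1[%classic r -> [set: R] y ->
      `|partial1of2 (fun r y => cos (r * y + b) * pdf y) r y| <= `|y| * pdf y.
    move=> _ _; rewrite p1E normrN !normrM (ger0_norm (normal_pdf_ge0 _ _ _)).
    by rewrite ler_wpM2r ?normal_pdf_ge0// ler_piMr// sin_max.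
  have dr r y : `]x - 1, x + 1[%classic r -> [set: R] y ->
      derivable ((fun r y => cos (r * y + b) * pdf y) ^~ y) r 1.
    by move=> _ _; case: (dphase y r).
  have pge y : 0 <= `|y| * pdf y by rewrite mulr_ge0// normal_pdf_ge0.
  have E1 := @differentiation_under_integral R _ _ leb
     (fun r y => cos (r * y + b) * pdf y) setT measurableT x (x - 1) (x + 1) xin
     (fun r _ => icos r) dr (fun y => `|y| * pdf y) pge i1 pb.
  have E2 := @derivable_under_integral R _ _ leb
     (fun r y => cos (r * y + b) * pdf y) setT measurableT x (x - 1) (x + 1) xin
     (fun r _ => icos r) dr (fun y => `|y| * pdf y) pge i1 pb.
  apply: DeriveDef; first exact: E2.
  rewrite -derive1E E1.
  rewrite -ibp -[RHS]mulN1r -RintegralZl//.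
  by apply: eq_Rintegral => y _; rewrite p1E mulN1r.
have dH (x : R) : is_derive x 1 (fun x => F x * expR (x ^+ 2 * s ^+ 2 / 2)) 0.
  have d1 := dF x.
  apply: is_derive_eq.
  by rewrite /GRing.scale/=; field.
have := @derivative_bound _ _ _ 0 t dH.
have H0 (r : R) : `|r| <= `|t| -> `|0 : R| <= 0 by rewrite normr0.
move=> /(_ H0); rewrite mul0r normr_le0 subr_eq0 expr0n/= !mul0r expR0 mulr1 => /eqP H.
have F0 : F 0 = cos b.
  rewrite /F; under eq_Rintegral do rewrite mul0r add0r.
  by rewrite RintegralZl// Rintegral_normal_pdf mulr1.
by rewrite -F0 -H -/(F t) mulrCA -expRD addNr expR0 mulr1.
Qed.

End gaussian_integrals.

Section normal_characteristic_function.
Context {R : realType}.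
Local Notation leb := (@lebesgue_measure R).

Lemma measurable_cos_affine (t b : R) :
  measurable_fun [set: measurableTypeR R] (fun y : R => cos (t * y + b)).
Proof.
apply: (measurableT_comp (continuous_measurable_fun (@continuous_cos R))).
by apply: measurable_funD => //; exact: measurable_funM.
Qed.

Lemma Rintegral_cos_normal_prob (s t b : R) : s != 0 ->
  \int[normal_prob 0 s]_y cos (t * y + b) = expR (- (t ^+ 2 * s ^+ 2 / 2)) * cos b.
Proof.
move=> s0; rewrite -Rintegral_cos_normal_pdf//.
have mc := measurable_cos_affine t b.
have ipdf : leb.-integrable [set: R] (EFin \o normal_pdf 0 s) by exact: integrable_normal_pdf.
have mpdf : measurable_fun [set: measurableTypeR R] (normal_pdf 0 s) by exact: measurable_normal_pdf.
have cos_int (P : probability (measurableTypeR R) R) :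
    P.-integrable [set: measurableTypeR R] (EFin \o (fun y : R => cos (t * y + b))).
  by apply: (@integrable_bounded _ _ _ P _ 1) => // y; exact: cos_max.
have c1 (P : probability (measurableTypeR R) R) :
    P.-integrable [set: measurableTypeR R] (EFin \o cst 1).
  exact: finite_measure_integrable_cst.
have icp : leb.-integrable [set: R] (EFin \o (fun y => cos (t * y + b) * normal_pdf 0 s y)).
  apply: (@integrable_dominated _ _ _ leb _ (normal_pdf 0 s)) => //.
    exact: measurable_funM.
  move=> y; rewrite normrM (ger0_norm (normal_pdf_ge0 _ _ _)).
  by rewrite ler_piMl ?normal_pdf_ge0// cos_max.
(* Adding 1 makes the integrand nonnegative, as [ge0_integral_density] requires. *)
have H : \int[normal_prob 0 s]_y (cos (t * y + b) + 1) =
    \int[leb]_y ((cos (t * y + b) + 1) * normal_pdf 0 s y).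
  rewrite /Rintegral; congr fine.
  under [RHS]eq_integral do rewrite EFinM.
  apply: ge0_integral_density => //.
  - by move=> y; exact: normal_pdf_ge0.
  - by apply/measurable_EFinP; apply: measurable_funD.
have E1 : \int[normal_prob 0 s]_y (cos (t * y + b) + 1) = \int[normal_prob 0 s]_y cos (t * y + b) + 1.
  pose nu : probability (measurableTypeR R) R := normal_prob 0 s.
  apply: etrans (RintegralD measurableT (cos_int nu) (c1 nu)) _.
  exact: (congr1 (fun z => \int[nu]_y cos (t * y + b) + z) (probability_Rintegral_cst nu 1)).
have E2 : \int[leb]_y ((cos (t * y + b) + 1) * normal_pdf 0 s y) =
    \int[leb]_y (cos (t * y + b) * normal_pdf 0 s y) + 1.
  under eq_Rintegral do rewrite mulrDl mul1r.
  by rewrite RintegralD// Rintegral_normal_pdf.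
rewrite E1 E2 in H.
exact: addIr H.
Qed.

Lemma Rintegral_cos_centered_normal (v t b : R) : 0 <= v ->
  \int[centered_normal v]_y cos (t * y + b) = expR (- (t ^+ 2 * v / 2)) * cos b.
Proof.
move=> v0; rewrite /centered_normal; have [->|vn0] := eqVneq v 0.
  rewrite mulr0 mul0r oppr0 expR0 mul1r /Rintegral integral_dirac//.
    by rewrite diracT mul1e/= mulr0 add0r.
  by apply/measurable_EFinP; exact: measurable_cos_affine.
rewrite Rintegral_cos_normal_prob ?sqr_sqrtr//.
by rewrite sqrtr_eq0 -ltNge lt_neqAle eq_sym vn0.
Qed.

End normal_characteristic_function.

(** A modulus of the form [a + c * (y - x) ^+ 2] integrates exactly against the Gaussian, which
    spares a splitting into near and far points. *)
Lemma normal_smoothing_close {R : realType} (phi : R -> R) (s M a c y : R) : s != 0 ->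
  measurable_fun [set: measurableTypeR R] phi -> (forall x, `|phi x| <= M) ->
  0 <= a -> 0 <= c -> (forall x, `|phi x - phi y| <= a + c * (y - x) ^+ 2) ->
  `|\int[lebesgue_measure]_x (phi x * normal_pdf 0 s (y - x)) - phi y| <= a + c * s ^+ 2.
Proof.
move=> s0 mphi phiM a0 c0 mod.
set leb := @lebesgue_measure R.
pose G x := (a + c * x ^+ 2) * normal_pdf 0 s x.
have mi := integrable_normal_moments s0.
have mpdf := @measurable_normal_pdf R 0 s.
have i2 : leb.-integrable [set: R] (EFin \o (fun y => y ^+ 2 * normal_pdf 0 s y)).
  apply: integrable_dominated mi.
    by apply: measurable_funM; [exact: measurable_funX|exact: measurable_normal_pdf].
  move=> x; have x2 := sqr_ge0 x; have px := normal_pdf_ge0 0 s x.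
  rewrite ger0_norm; last exact: mulr_ge0.
  by rewrite ler_wpM2r ?normal_pdf_ge0// lerDr.
have i0 : leb.-integrable [set: R] (EFin \o normal_pdf 0 s) by exact: integrable_normal_pdf.
have GE : G = fun x => a * normal_pdf 0 s x + c * (x ^+ 2 * normal_pdf 0 s x).
  by apply/funext => x; rewrite /G; ring.
have iG : leb.-integrable [set: R] (EFin \o G).
  by rewrite GE; apply: integrableD_real; exact: integrableZl_real.
have G0 x : 0 <= G x.
  apply: mulr_ge0 (normal_pdf_ge0 _ _ _); apply: addr_ge0; first exact: a0.
  exact: mulr_ge0 (sqr_ge0 _).
have mG := integrable_measurable iG.
have flip (F : R -> R) : leb.-integrable [set: R] (EFin \o F) -> (forall x, 0 <= F x) ->
    leb.-integrable [set: R] (EFin \o (fun x => F (y - x))) /\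
    \int[leb]_x F (y - x) = \int[leb]_x F x.
  move=> iF F0; have mF := integrable_measurable iF.
  have FE : (\int[leb]_x (F x)%:E = \int[leb]_x (F (y - x)%R)%:E)%E.
    rewrite (@ge0_integral_affine _ y 1)//.
    - by rewrite mul1e; apply: eq_integral => x _; rewrite mul1r.
    - exact/measurable_EFinP.
  split; last by rewrite /Rintegral -FE.
  apply: integrable_ge0_lty => //.
    by apply: (measurableT_comp mF); exact: measurable_funB.
  by rewrite -FE; exact: integrable_lty.
have [iGy GyE] := flip _ iG G0.
have [ipy pyE] := flip _ i0 (normal_pdf_ge0 0 s).
rewrite (Rintegral_normal_pdf s) in pyE.
have ipy2 := integrableZl_real (phi y) ipy.
have ismooth : leb.-integrable [set: R] (EFin \o (fun x => phi x * normal_pdf 0 s (y - x))).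
  apply: (@integrable_dominated _ _ _ leb _ (fun x => M * normal_pdf 0 s (y - x))).
  - apply: measurable_funM => //; apply: (measurableT_comp mpdf); exact: measurable_funB.
  - by move=> x; rewrite normrM (ger0_norm (normal_pdf_ge0 _ _ _)) ler_wpM2r ?normal_pdf_ge0.
  - exact: integrableZl_real.
have -> : \int[leb]_x (phi x * normal_pdf 0 s (y - x)) - phi y = \int[leb]_x (phi x * normal_pdf 0 s (y - x) - phi y * normal_pdf 0 s (y - x)).
  by rewrite (RintegralB measurableT ismooth ipy2) (@RintegralZl _ _ _ leb _ _ (phi y) measurableT ipy) pyE mulr1.
apply: (@le_trans _ _ (\int[leb]_x G (y - x))).
  apply: (@norm_Rintegral_le _ _ _ leb _ (fun x => G (y - x)) _ _ iGy).
    exact: (integrable_measurable (integrableB_real ismooth ipy2)).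
  move=> x; rewrite -mulrBl normrM (ger0_norm (normal_pdf_ge0 _ _ _)).
  by rewrite ler_wpM2r ?normal_pdf_ge0.
rewrite GyE GE (RintegralD measurableT (integrableZl_real a i0) (integrableZl_real c i2)).
rewrite (@RintegralZl _ _ _ leb _ _ a measurableT i0) (@RintegralZl _ _ _ leb _ _ c measurableT i2).
by rewrite (Rintegral_normal_pdf s) (Rintegral_sqr_normal_pdf s0) mulr1.
Qed.

(** * Weak convergence from convergence of cosines *)

Section levy_continuity.
Context {R : realType}.
Variables (m : nat -> probability (measurableTypeR R) R) (mu : probability (measurableTypeR R) R).
Local Notation leb := (@lebesgue_measure R).
(** Letting the phase [b] vary makes this the convergence of the complex characteristic function. *)
Hypothesis cvg_cos : forall t b : R,
  \int[m n]_y cos (t * y + b) @[n --> \oo] --> \int[mu]_y cos (t * y + b).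

Let prob_int (P : probability (measurableTypeR R) R) (f : R -> R) (M : R) :
  measurable_fun [set: measurableTypeR R] f -> (forall y, `|f y| <= M) ->
  P.-integrable [set: measurableTypeR R] (EFin \o f).
Proof. by move=> mf fM; exact: (@integrable_bounded _ _ _ P f M). Qed.

Let prob_le (P : probability (measurableTypeR R) R) (f : R -> R) (M : R) :
  measurable_fun [set: measurableTypeR R] f -> (forall y, `|f y| <= M) ->
  `|\int[P]_y f y| <= M.
Proof.
move=> mf fM; apply: le_trans (@norm_Rintegral_le _ _ _ P f (cst M) mf fM _) _.
  exact: finite_measure_integrable_cst.
by rewrite Rintegral_cst//= probability_setT mulr1.
Qed.

(* A Gaussian bump is a Gaussian average of cosines. *)
Let cvg_gauss (r x : R) : r != 0 ->
  \int[m n]_y expR (- ((y - x) ^+ 2 * r ^+ 2 / 2)) @[n --> \oo] -->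
  \int[mu]_y expR (- ((y - x) ^+ 2 * r ^+ 2 / 2)).
Proof.
move=> r0.
have mcos2 : measurable_fun [set: measurableTypeR R * measurableTypeR R]
    (fun z => cos ((z.1 - x) * z.2 + 0)).
  apply: (measurableT_comp (continuous_measurable_fun (@continuous_cos R))).
  apply: measurable_funD => //; apply: measurable_funM; last exact: measurable_snd.
  by apply: measurable_funB => //; exact: measurable_fst.
have E (P : probability (measurableTypeR R) R) :
    \int[P]_y expR (- ((y - x) ^+ 2 * r ^+ 2 / 2)) =
    \int[normal_prob 0 r]_t \int[P]_y cos (t * y + - (t * x)).
  have Ecos y : expR (- ((y - x) ^+ 2 * r ^+ 2 / 2)) = \int[normal_prob 0 r]_t cos ((y - x) * t + 0).
    by rewrite Rintegral_cos_normal_prob// cos0 mulr1.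
  under eq_Rintegral do rewrite Ecos.
  pose nu : probability (measurableTypeR R) R := normal_prob 0 r.
  have c1 : P.-integrable [set: measurableTypeR R] (EFin \o cst 1).
    exact: finite_measure_integrable_cst.
  have bd (y t : measurableTypeR R) : `|cos ((y - x) * t + 0)| <= cst 1 y by exact: cos_max.
  apply: etrans (@Rintegral_fubini _ _ _ _ _ P nu (fun y t => cos ((y - x) * t + 0)) _ mcos2 bd c1) _.
  apply: eq_Rintegral => t _; apply: eq_Rintegral => y _.
  by congr cos; ring.
under eq_fun do rewrite E.
rewrite E.
have mE (P : probability (measurableTypeR R) R) :
   measurable_fun [set: measurableTypeR R] (fun t => \int[P]_y cos (t * y + - (t * x))).
  apply: (@measurable_Rintegral1 _ _ _ _ _ (normal_prob 0 r : probability _ _) P (fun t y => cos (t * y + - (t * x))) (cst 1)).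
  - apply: (measurableT_comp (continuous_measurable_fun (@continuous_cos R))).
    apply: measurable_funD.
      by apply: measurable_funM; [exact: measurable_fst|exact: measurable_snd].
    apply: measurableT_comp => //; apply: measurable_funM => //; exact: measurable_fst.
  - by move=> t y; exact: cos_max.
  - exact: finite_measure_integrable_cst.
apply: (@Rintegral_dominated_cvg _ _ _ (normal_prob 0 r) _ _ (cst 1)).
- by move=> n; exact: mE.
- exact: mE.
- by move=> t; exact: cvg_cos.
- move=> n t; apply: prob_le; first exact: measurable_cos_affine.
  by move=> y; exact: cos_max.
- exact: finite_measure_integrable_cst.
Qed.

Let cvg_pdf (s x : R) : s != 0 ->
  \int[m n]_y normal_pdf 0 s (y - x) @[n --> \oo] --> \int[mu]_y normal_pdf 0 s (y - x).
Proof.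
move=> s0.
have E (P : probability (measurableTypeR R) R) : \int[P]_y normal_pdf 0 s (y - x) =
    normal_peak s * \int[P]_y expR (- ((y - x) ^+ 2 * s^-1 ^+ 2 / 2)).
  rewrite -RintegralZl//.
    apply: eq_Rintegral => y _; rewrite normal_pdfE// /normal_fun subr0.
    congr (_ * expR _); rewrite mulNr exprVn; congr (- _); rewrite -mulrA; congr (_ * _).
    by rewrite -mulr_natr invfM.
  apply: (@prob_int P _ 1).
    apply: measurableT_comp => //; apply: measurableT_comp => //.
    apply: measurable_funM => //; apply: measurable_funM => //.
    by apply: measurable_funX; exact: measurable_funB.
  move=> y; rewrite ger0_norm ?expR_ge0// -expR0 ler_expR oppr_le0.
  by rewrite divr_ge0// mulr_ge0// sqr_ge0.
under eq_fun do rewrite E.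
by rewrite E; apply: cvgMr; apply: cvg_gauss; rewrite invr_eq0.
Qed.

Section compactly_supported.
Variables (phi : R -> R) (L M : R).
Hypothesis cphi : continuous phi.
Hypothesis phiM : forall y, `|phi y| <= M.
Hypothesis phi0 : forall y, L < `|y| -> phi y = 0.

Let mphi : measurable_fun [set: measurableTypeR R] phi.
Proof. exact: continuous_measurable_fun. Qed.

Let M0 : 0 <= M. Proof. exact: le_trans (phiM 0). Qed.

Let phi_int : leb.-integrable [set: R] (EFin \o phi).
Proof.
apply: (@integrable_dominated _ _ _ leb _ (fun y => M * \1_(`[- L, L]%classic : set R) y)) => //.
  move=> y; rewrite indicE; case: (boolP (_ \in _)) => yL.
    by rewrite mulr1.
  rewrite mulr0 phi0 ?normr0//.
  by rewrite ltNge; apply: contra yL; rewrite inE/= in_itv/= -ler_norml.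
by apply: integrableZl_real; exact: integrable_indic_itv.
Qed.

Let smooth (s y : R) := \int[leb]_x (phi x * normal_pdf 0 s (y - x)).

Let mpdf2 (s : R) : measurable_fun [set: measurableTypeR R * measurableTypeR R]
    (fun z => phi z.1 * normal_pdf 0 s (z.2 - z.1)).
Proof.
apply: measurable_funM.
  exact: (measurableT_comp mphi measurable_fst).
apply: (measurableT_comp (measurable_normal_pdf 0 s)).
by apply: measurable_funB; [exact: measurable_snd|exact: measurable_fst].
Qed.

Let pdf2_le (s : R) (s0 : s != 0) x y :
  `|phi x * normal_pdf 0 s (y - x)| <= normal_peak s * `|phi x|.
Proof.
rewrite normrM mulrC (ger0_norm (normal_pdf_ge0 _ _ _)).
by rewrite ler_wpM2r// normal_pdf_ub.
Qed.

Let dom_int (s : R) : leb.-integrable [set: R] (EFin \o (fun x => normal_peak s * `|phi x|)).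
Proof. by apply: integrableZl_real; exact: (@integrable_norm _ _ _ leb _ _ phi_int). Qed.

(** By Fubini, averaging [smooth s] over a law amounts to integrating [phi x] against the averages
    of [normal_pdf 0 s (y - x)]. These converge for each [x] by [cvg_pdf], and [normal_peak s]
    bounds them. *)
Let cvg_smooth (s : R) : s != 0 -> \int[m n]_y smooth s y @[n --> \oo] --> \int[mu]_y smooth s y.
Proof.
move=> s0.
have E (P : probability (measurableTypeR R) R) :
    \int[P]_y smooth s y = \int[leb]_x (phi x * \int[P]_y normal_pdf 0 s (y - x)).
  rewrite -(@Rintegral_fubini _ _ _ _ _ leb P _ _ (mpdf2 s) (pdf2_le s0) (dom_int s)).
  apply: eq_Rintegral => x _; rewrite RintegralZl//.
  apply: (@prob_int P _ (normal_peak s)).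
    apply: (measurableT_comp (measurable_normal_pdf 0 s)); exact: measurable_funB.
  by move=> y; rewrite ger0_norm ?normal_pdf_ge0// normal_pdf_ub.
under eq_fun do rewrite E.
rewrite E.
have pint (P : probability (measurableTypeR R) R) x :
   phi x * \int[P]_y normal_pdf 0 s (y - x) = \int[P]_y (phi x * normal_pdf 0 s (y - x)).
  rewrite RintegralZl//; apply: (@prob_int P _ (normal_peak s)).
    apply: (measurableT_comp (measurable_normal_pdf 0 s)); exact: measurable_funB.
  by move=> y; rewrite ger0_norm ?normal_pdf_ge0// normal_pdf_ub.
have mE (P : probability (measurableTypeR R) R) :
   measurable_fun [set: measurableTypeR R] (fun x => phi x * \int[P]_y normal_pdf 0 s (y - x)).
  under eq_fun do rewrite pint.
  exact: (@measurable_Rintegral1 _ _ _ _ _ leb P _ _ (mpdf2 s) (pdf2_le s0) (dom_int s)).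
apply: (@Rintegral_dominated_cvg _ _ _ leb _ _ _ _ _ _ _ (dom_int s)).
- by move=> n; exact: mE.
- exact: mE.
- by move=> x; apply: cvgMr; exact: cvg_pdf.
- move=> n x; rewrite pint; apply: prob_le.
    apply: measurable_funM => //.
    apply: (measurableT_comp (measurable_normal_pdf 0 s)); exact: measurable_funB.
  by move=> y; exact: pdf2_le.
Qed.

Let unif (e : R) : 0 < e -> exists2 del : R, 0 < del &
  forall x y, `|x - y| < del -> `|phi x - phi y| <= e.
Proof.
move=> e0.
(* The margin 1 matters: for points closer than 1, either the first lies in this interval or both
   lie where [phi] vanishes. *)
have K : compact (`[- (L + 1), L + 1]%classic : set R) by exact: segment_compact.
have /compact_near_coveringP cov := K.
have HH : forall x : R, `[- (L + 1), L + 1]%classic x ->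
   \forall x' \near x & i \near 0^'+, forall y, `|y - x'| < i -> `|phi y - phi x'| <= e.
  move=> x _.
  have e2 : 0 < e / 2 by rewrite divr_gt0.
  have cx : phi z @[z --> x] --> phi x by exact: cphi.
  move/cvgrPdist_lt : cx => /(_ _ e2).
  rewrite -nbhs_nbhs_norm => -[eta /= eta0 Heta].
  have eta2 : 0 < eta / 2 by rewrite divr_gt0.
  exists (ball x (eta / 2), [set i | 0 < i < eta / 2]).
    split; first exact: nbhsx_ballx.
    near=> i; apply/andP; split; near: i; first exact: nbhs_right_gt.
    exact: nbhs_right_lt.
  move=> [x' i] /= [xx' /andP[i0 ie]] y yx'.
  have h1 : `|phi x - phi x'| < e / 2.
    apply: Heta; rewrite /= ; apply: lt_trans xx' _; lra.
  have h2 : `|phi x - phi y| < e / 2.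
    apply: Heta => /=; rewrite -(subrKA x').
    apply: le_lt_trans (ler_normD _ _) _; rewrite (distrC x' y).
    move: xx'; rewrite /ball/=; lra.
  rewrite -(subrKA (phi x)); apply: le_trans (ler_normD _ _) _; rewrite distrC; lra.
have near_del := cov R (0^'+) _ _ HH.
have {}near_del := near_del (at_right_proper_filter (0:R)).
near (0:R)^'+ => del.
exists (Num.min del 1).
  by rewrite lt_min ltr01 andbT; near: del; exact: nbhs_right_gt.
have Hd : `[- (L + 1), L + 1]%classic `<=`
    (fun x' : R => forall y : R, `|y - x'| < del -> `|phi y - phi x'| <= e).
  by near: del; exact: near_del.
move=> x y; rewrite lt_min => /andP[xyd xy1].
have [xK|xK] := leP `|x| (L + 1).
  rewrite distrC; apply: Hd; last by rewrite distrC.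
  by rewrite /= in_itv/= -ler_norml.
rewrite !phi0 ?subrr ?normr0 ?(ltW e0)//; last by lra.
have := ler_normD y (x - y); rewrite subrKC; lra.
Unshelve. all: by end_near. Qed.

Let smooth_close (e : R) : 0 < e -> exists2 s : R, s != 0 &
  forall y, `|smooth s y - phi y| <= e.
Proof.
move=> e0; have e2 : 0 < e / 2 by rewrite divr_gt0.
have [del del0 Hdel] := unif e2.
(* Beyond distance [del] the oscillation is at most [2 * M], hence at most [c * (y - x) ^+ 2]; [s]
   is then chosen so that [c * s ^+ 2 <= e / 2]. *)
pose c := 2 * M / del ^+ 2.
have c0 : 0 <= c by rewrite divr_ge0 ?sqr_ge0// mulr_ge0.
have mod x y : `|phi x - phi y| <= e / 2 + c * (y - x) ^+ 2.
  have [xy|xy] := ltP `|x - y| del.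
    by apply: le_trans (Hdel _ _ xy) _; rewrite lerDl mulr_ge0 ?sqr_ge0.
  apply: (@le_trans _ _ (c * (y - x) ^+ 2)); last by rewrite lerDr ltW.
  apply: (@le_trans _ _ (2 * M)).
    by apply: le_trans (ler_normB _ _) _; have := phiM x; have := phiM y; lra.
  rewrite /c mulrAC ler_pdivlMr ?exprn_gt0// ler_wpM2l ?mulr_ge0//.
  by rewrite -(real_normK (num_real (y - x))) distrC lerXn2r ?nnegrE// ltW.
pose s := Num.sqrt (e / 2 / (c + 1)).
have c1 : 0 < c + 1 by rewrite ltr_pwDr.
have s0 : s != 0 by rewrite gt_eqF// sqrtr_gt0 divr_gt0.
have s2 : s ^+ 2 = e / 2 / (c + 1) by rewrite sqr_sqrtr// ltW// divr_gt0.
exists s => // y.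
apply: le_trans (normal_smoothing_close s0 mphi phiM (ltW e2) c0 (mod ^~ y)) _.
rewrite s2; have : c * (e / 2 / (c + 1)) <= e / 2.
  by rewrite mulrA ler_pdivrMr// mulrC ler_wpM2l ?ltW// ltrDl.
by rewrite [X in _ -> _ <= X](splitr e) lerD2l.
Qed.

Let msmooth (s : R) : s != 0 -> measurable_fun [set: measurableTypeR R] (smooth s).
Proof.
move=> s0.
exact: (@measurable_Rintegral2 _ _ _ _ _ leb mu _ _ (mpdf2 s) (pdf2_le s0) (dom_int s)).
Qed.

Lemma levy_compactly_supported : \int[m n]_y phi y @[n --> \oo] --> \int[mu]_y phi y.
Proof.
apply/cvgrPdist_le => e e0.
have e3 : 0 < e / 3 by rewrite divr_gt0.
have [s s0 Hs] := smooth_close e3.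
have smooth_le y : `|smooth s y| <= M + e / 3.
  rewrite -[smooth s y](subrK (phi y)) (le_trans (ler_normD _ _))// addrC.
  by apply: lerD; [exact: phiM|exact: Hs].
have D (P : probability (measurableTypeR R) R) :
    `|\int[P]_y smooth s y - \int[P]_y phi y| <= e / 3.
  rewrite -RintegralB//; last 2 first.
  - exact: (@prob_int P _ _ (msmooth s0) smooth_le).
  - exact: (@prob_int P _ _ mphi phiM).
  by apply: prob_le => //; apply: measurable_funB => //; exact: msmooth.
have /cvgrPdist_le /(_ _ e3) := cvg_smooth s0.
apply: filterS => n Hn.
have := D mu; have := D (m n); move: Hn; rewrite !ler_norml; lra.
Qed.

End compactly_supported.

(** Multiplying by the plateau [chi k] reduces to compact support. The mass cut off under [m n] is
    controlled by applying the compactly supported case to [chi k] itself, which is how tightness is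
    obtained. *)
Lemma levy_continuity (phi : R -> R) (M : R) : continuous phi -> (forall y, `|phi y| <= M) ->
  \int[m n]_y phi y @[n --> \oo] --> \int[mu]_y phi y.
Proof.
move=> cphi phiM.
pose chi (k : nat) (y : R) := Num.max 0 (Num.min 1 (k.+1%:R - `|y|)).
have cchi k : continuous (chi k).
  move=> y; apply: (@continuous_max _ _ (fun=> 0) (fun y => Num.min 1 (k.+1%:R - `|y|)) y).
    exact: cvg_cst.
  apply: (@continuous_min _ _ (fun=> 1) (fun y => k.+1%:R - `|y|) y).
    exact: cvg_cst.
  by apply: cvgB; [exact: cvg_cst|exact: norm_continuous].
have chi01 k y : 0 <= chi k y <= 1.
  by rewrite /chi le_max lexx/= ge_max ler01 ge_min lexx.
have chi0 k y : k.+1%:R < `|y| -> chi k y = 0.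
  by move=> ky; rewrite /chi max_l// ge_min subr_le0 (ltW ky) orbT.
have chi1 k y : `|y| <= k%:R -> chi k y = 1.
  move=> ky; have k1 : 1 <= k.+1%:R - `|y| by rewrite -natr1; lra.
  by rewrite /chi (min_l k1) max_r.
have M0 : 0 <= M by exact: le_trans (phiM 0).
have mchi k : measurable_fun [set: measurableTypeR R] (chi k) by exact: continuous_measurable_fun.
have mphi : measurable_fun [set: measurableTypeR R] phi by exact: continuous_measurable_fun.
have chiN k y : `|chi k y| <= 1.
  by case/andP: (chi01 k y) => a b; rewrite ger0_norm.
have chi_mu : \int[mu]_y chi k y @[k --> \oo] --> (1:R).
  rewrite -[X in _ --> X](_ : \int[mu]_y (cst 1 y) = 1); last first.
    by rewrite Rintegral_cst//= probability_setT mulr1.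
  apply: (@Rintegral_dominated_cvg _ _ _ mu _ _ (cst 1)) => //.
  - move=> y; apply: cvg_near_cst; near=> k; apply: chi1.
    near: k; exact: nbhs_infty_ger.
  - exact: finite_measure_integrable_cst.
apply/cvgrPdist_le => e e0.
(* The errors are [M * e'] for truncating under [mu], [2 * M * e'] under [m n], and [e'] between the
   truncated integrals. *)
pose e' := e / (3 * M + 1) / 2.
have e'0 : 0 < e' by rewrite !divr_gt0// ltr_pwDr// mulr_ge0.
have [k Hk] : exists k, 1 - e' <= \int[mu]_y chi k y.
  move/cvgrPdist_le : chi_mu => /(_ _ e'0) [k _ Hk]; exists k.
  have := Hk k (leqnn k); rewrite /= ler_norml; lra.
have phichiM y : `|phi y * chi k y| <= M.
  by rewrite normrM -[leRHS]mulr1; apply: ler_pM.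
have cpc : continuous (fun y => phi y * chi k y) by move=> y; exact: cvgM (cphi y) (cchi k y).
have pc0 y : k.+1%:R < `|y| -> phi y * chi k y = 0 by move=> ky; rewrite chi0// mulr0.
have c1 := @levy_compactly_supported _ k.+1%:R M cpc phichiM pc0.
have c2 := @levy_compactly_supported (chi k) k.+1%:R 1 (cchi k) (chiN k) (chi0 k).
have D (P : probability (measurableTypeR R) R) :
   `|\int[P]_y phi y - \int[P]_y (phi y * chi k y)| <= M * (1 - \int[P]_y chi k y).
  have ich : P.-integrable setT (EFin \o chi k) by exact: (@prob_int P _ _ (mchi k) (chiN k)).
  have i1 : P.-integrable setT (EFin \o cst 1) by exact: finite_measure_integrable_cst.
  have ipc : P.-integrable setT (EFin \o (fun y => phi y * chi k y)).
    by apply: (@prob_int P _ M) => //; exact: measurable_funM.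
  rewrite -RintegralB//; last exact: (@prob_int P _ _ mphi phiM).
  apply: le_trans (@norm_Rintegral_le _ _ _ P _ (fun y => M * (1 - chi k y)) _ _ _) _.
  - by apply: measurable_funB => //; exact: measurable_funM.
  - move=> y; rewrite -{1}[phi y]mulr1 -mulrBr normrM; case/andP: (chi01 k y) => a b.
    by rewrite [X in _ * X]ger0_norm ?subr_ge0// ler_wpM2r// subr_ge0.
  - by apply: integrableZl_real; exact: integrableB_real.
  - rewrite RintegralZl//; last exact: integrableB_real.
    rewrite RintegralB// Rintegral_cst//= probability_setT mulr1//.
move/cvgrPdist_le : c1 => /(_ _ e'0) c1.
move/cvgrPdist_le : c2 => /(_ _ e'0) c2.
near=> n.
have h1 : `|\int[mu]_y (phi y * chi k y) - \int[m n]_y (phi y * chi k y)| <= e' by near: n; exact: c1.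
have h2 : `|\int[mu]_y chi k y - \int[m n]_y chi k y| <= e' by near: n; exact: c2.
have d1 := D mu; have d2 := D (m n).
have h3 : M * (1 - \int[mu]_y chi k y) <= M * e' by rewrite ler_wpM2l//; lra.
have h4 : M * (1 - \int[m n]_y chi k y) <= M * (2 * e').
  by rewrite ler_wpM2l//; move: h2; rewrite ler_norml; lra.
have h5 : (3 * M + 1) * e' <= e.
  have -> : (3 * M + 1) * e' = e / 2.
    by rewrite /e'; field; rewrite gt_eqF// ltr_pwDr// mulr_ge0.
  by rewrite ler_pdivrMr//; lra.
move: h1 d1 d2; rewrite !ler_norml; lra.
Unshelve. all: by end_near. Qed.

End levy_continuity.

(** * Importance weights under a policy *)

Lemma density_measure d (T : measurableType d) (R : realType)
    (mu : {measure set T -> \bar R}) (p : T -> R) :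
  measurable_fun [set: T] p -> (forall x, 0 <= p x) ->
  exists nu : {measure set T -> \bar R},
    forall A, measurable A -> nu A = (\int[mu]_(x in A) (p x)%:E)%E.
Proof.
move=> mp p0.
pose m (A : set T) := (\int[mu]_(x in A) (p x)%:E)%E.
have m0 : m set0 = 0%E by rewrite /m integral_set0.
have mge0 A : (0 <= m A)%E by apply: integral_ge0 => x _; rewrite lee_fin.
have msa : semi_sigma_additive m.
  by apply: semi_sigma_additive_nng_induced => //; exact/measurable_EFinP.
pose mm := isMeasure.Build _ _ _ m m0 mge0 msa.
pose nu : {measure set T -> \bar R} := HB.pack m mm.
by exists nu.
Qed.

(** * The sigma-algebra of the past *)

Section past_sigma_algebra.
Context {R : realType} {d : nat} {dO : measure_display}.
Context {Omega : measurableType dO} {P : probability Omega R}.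
Variables (X : nat -> {RV P >-> 'rV[R]_d}).
Local Notation past_type k := (g_sigma_algebraType (past X k)).

Lemma past_sigma_algebra k : sigma_algebra [set: Omega] (past X k).
Proof. exact: smallest_sigma_algebra. Qed.

Lemma measurable_pastE k (A : set Omega) : measurable (A : set (past_type k)) <-> past X k A.
Proof. by rewrite /measurable/= sigma_algebra_id//; exact: past_sigma_algebra. Qed.

Lemma past_generator k (j : nat) (B : set 'rV[R]_d) : (0 < j <= k)%N -> measurable B ->
  past X k (X j @^-1` B).
Proof.
case: j => // j /andP[_ jk] mB; apply: sub_sigma_algebra.
rewrite (bigD1 (Ordinal jk))//=; left.
by exists B; rewrite ?setTI.
Qed.

Lemma past_smallest k (S : set (set Omega)) : sigma_algebra [set: Omega] S ->
  (forall j B, (0 < j <= k)%N -> measurable B -> S (X j @^-1` B)) -> past X k `<=` S.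
Proof.
move=> sS XS; apply: smallest_sub => //.
elim/big_ind : _ => //.
- by move=> A B AS BS C [/AS|/BS].
- move=> i _ A [B mB <-]; rewrite setTI; apply: XS => //=.
Qed.

Lemma past_measurable k : past X k `<=` measurable.
Proof.
apply: past_smallest; first exact: sigma_algebra_measurable.
by move=> j B _ mB; rewrite -[X in measurable X]setTI; exact: measurable_funPT.
Qed.

Lemma past_le j k : (j <= k)%N -> past X j `<=` past X k.
Proof.
move=> jk; apply: past_smallest; first exact: past_sigma_algebra.
move=> i B /andP[i0 ij] mB; apply: past_generator => //.
by rewrite i0 (leq_trans ij).
Qed.

(** Measurability for the past is carried by the type [past_type k]; composing with this identity
    forgets it. *)
Lemma measurable_id_past k : measurable_fun [set: Omega] (id : Omega -> past_type k).
Proof.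
by move=> _ A /measurable_pastE pA; rewrite setTI; exact: past_measurable pA.
Qed.

Lemma measurable_id_past_le j k : (j <= k)%N ->
  measurable_fun [set: past_type k] (id : past_type k -> past_type j).
Proof.
move=> jk _ A /measurable_pastE pA; rewrite setTI; apply/measurable_pastE.
exact: past_le pA.
Qed.

Lemma measurable_X_past j k : (0 < j <= k)%N ->
  measurable_fun [set: past_type k] (X j : past_type k -> 'rV[R]_d).
Proof.
move=> jk _ B mB; rewrite setTI; apply/measurable_pastE; exact: past_generator.
Qed.

Lemma measurable_past_fun d' (T' : measurableType d') k (F : Omega -> T') :
  measurable_fun [set: past_type k] F -> measurable_fun [set: Omega] F.
Proof.
move=> mF.
have mid : measurable_fun [set: Omega] (id : Omega -> past_type k) by exact: measurable_id_past.
exact: (measurableT_comp mF mid).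
Qed.

End past_sigma_algebra.

Section disintegration.
Context {R : realType} {d : nat} {dO : measure_display}.
Context {Omega : measurableType dO} {P : probability Omega R}.
Variables (X : nat -> {RV P >-> 'rV[R]_d}) (q : nat -> Omega -> 'rV[R]_d -> R).
Hypothesis policyX : is_policy X q.
Local Notation past_type k := (g_sigma_algebraType (past X k)).
Local Notation leb := (@lebesgue_rV R d).

Let q_ge0 k w x : 0 <= q k w x.
Proof. by have [+ _ _] := policyX => /(_ k w)[]. Qed.

Let mq k : measurable_fun [set: past_type k * 'rV[R]_d] (fun z => q k z.1 z.2).
Proof. by have [_ + _] := policyX. Qed.

(* Both sides are integrals of F against measures on the product of the past and
   R^d, which the policy makes equal on rectangles. *)
Lemma policy_disintegration k (F : Omega -> 'rV[R]_d -> \bar R) :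
  measurable_fun [set: past_type k * 'rV[R]_d] (fun z => F z.1 z.2) ->
  (forall w x, 0 <= F w x)%E ->
  (\int[P]_w F w (X k.+1 w) = \int[P]_w \int[leb]_x (F w x * (q k w x)%:E))%E.
Proof.
move=> mF F0.
have mid : measurable_fun [set: Omega] (id : Omega -> past_type k) by exact: measurable_id_past.
pose mid_mixin := isMeasurableFun.Build _ _ _ _ _ mid.
pose idk : {mfun Omega >-> past_type k} := HB.pack (id : Omega -> past_type k) mid_mixin.
(* The restriction of [P] to the past, seen as a law on [past_type k]. *)
pose Pk : probability (past_type k) R := distribution P idk.
have mphi : measurable_fun [set: Omega] (fun w => (w : past_type k, X k.+1 w)).
  exact: measurable_fun_pair mid (measurable_funPT _).
pose mu1 := pushforward_measure P mphi.
have mqE : measurable_fun [set: past_type k * 'rV[R]_d] (fun z => (q k z.1 z.2)%:E).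
  exact/measurable_EFinP.
have mqk : measurable_fun [set: past_type k * 'rV[R]_d] (fun z => q k z.1 z.2) by exact: mq.
have [nu nuE] := density_measure (Pk \x leb)%E mqk (fun z => q_ge0 k z.1 z.2).
pose C : set (set (past_type k * 'rV[R]_d)) :=
  [set C | exists A, measurable A /\ exists B, measurable B /\ C = A `*` B].
have CI : setI_closed C.
  move=> /= _ _ [X1 [mX1 [X2 [mX2 ->]]]] [Y1 [mY1 [Y2 [mY2 ->]]]].
  rewrite -setXI; exists (X1 `&` Y1); split; first exact: measurableI.
  by exists (X2 `&` Y2); split => //; exact: measurableI.
have mu1nu A : measurable A -> mu1 A = nu A.
  move=> mA; apply: (measure_unique C (fun _ => setT `*` setT)) => //.
  - rewrite measurable_prod_measurableType//; congr (<<s _ >>).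
    rewrite predeqE; split => [[A1 mA1 [B mB <-]]|[A1 [mA1 [B [mB ->]]]]].
      by exists A1; split => //; exists B.
    by exists A1 => //; exists B.
  - by move=> _; exists setT; split => //; exists setT.
  - by rewrite setXTT bigcup_const//; exists 0%N.
  - move=> _ [A1 [mA1 [B [mB ->]]]].
    have /measurable_pastE pA1 := mA1.
    have [_ _ /(_ k A1 B pA1 mB) pE] := policyX.
    transitivity (P (A1 `&` X k.+1 @^-1` B)); first by [].
    rewrite pE nuE; last exact: measurableX.
    rewrite [RHS]integral_mkcond.
    pose G := fun z : past_type k * 'rV[R]_d => ((\1_A1 z.1 * \1_B z.2 * q k z.1 z.2)%:E).
    have GE : (fun z : past_type k * 'rV[R]_d => (q k z.1 z.2)%:E) \_ (A1 `*` B) = G.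
      apply/funext => -[w x]; rewrite /G patchE !indicE/= in_setX.
      by case: (w \in A1); case: (x \in B); rewrite ?mul1r ?mul0r ?mulr1.
    have mG : measurable_fun [set: past_type k * 'rV[R]_d] G.
      apply/measurable_EFinP; apply: measurable_funM => //; apply: measurable_funM.
        by apply: (measurableT_comp _ measurable_fst); exact: measurable_indic.
      by apply: (measurableT_comp _ measurable_snd); exact: measurable_indic.
    rewrite GE (fubini_tonelli1 G mG); last first.
      by move=> z; rewrite lee_fin !mulr_ge0.
    rewrite [LHS]integral_mkcond (ge0_integral_pushforward mid)//=; last 2 first.
      - apply: (measurable_fun_fubini_tonelli_F (m2 := leb) G mG).
        by move=> z; rewrite lee_fin !mulr_ge0.
      - move=> w _; apply: integral_ge0 => x _; rewrite lee_fin !mulr_ge0//.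
    apply: eq_integral => w _; rewrite patchE /fubini_F/= /G/=.
    case: ifPn => wA; last first.
      rewrite integral0_eq// => x _.
      by rewrite indicE (negbTE wA) mul0r mul0r.
    rewrite [LHS]integral_mkcond; apply: eq_integral => x _.
    by rewrite patchE !indicE wA mul1r; case: ifPn => xB; rewrite ?mul1r ?mul0r.
  - move=> _; rewrite setXTT; change (P ((fun w => (w : past_type k, X k.+1 w)) @^-1` setT) < +oo)%E.
    by rewrite preimage_setT probability_setT ltry.
transitivity (\int[mu1]_z F z.1 z.2)%E.
  by rewrite (ge0_integral_pushforward mphi).
rewrite (@eq_measure_integral _ _ _ _ nu); last by move=> A mA _; exact: mu1nu.
rewrite (ge0_integral_density mqk _ nuE)//.
have mFq : measurable_fun [set: past_type k * 'rV[R]_d] (fun z => F z.1 z.2 * (q k z.1 z.2)%:E)%E.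
  exact: emeasurable_funM.
have Fq0 (z : past_type k * 'rV[R]_d) : (0 <= F z.1 z.2 * (q k z.1 z.2)%:E)%E.
  by rewrite mule_ge0// lee_fin.
rewrite (fubini_tonelli1 _ mFq Fq0) (ge0_integral_pushforward mid)//.
- exact: measurable_fun_fubini_tonelli_F.
- by move=> w _; apply: integral_ge0 => x _; exact: (Fq0 (w, x)).
Qed.

End disintegration.

(** Inversion is continuous away from 0; the point 0, where it takes the default value 0, is treated
    as a separate measurable piece. *)
Lemma measurable_inv (R : realType) : measurable_fun [set: R] (@GRing.inv R).
Proof.
rewrite -(setvU [set 0]); apply/measurable_funU.
- by apply: measurableC; exact: measurable_set1.
- exact: measurable_set1.
split; last exact: measurable_fun_set1.
apply: open_continuous_measurable_fun.
  by apply: closed_openC; exact: closed_eq.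
move=> x; rewrite inE /= => /eqP x0; exact: inv_continuous.
Qed.

(** * First and second moments of weighted terms *)

Section weighted_moments.
Context {R : realType} {d : nat} {dO : measure_display}.
Context {Omega : measurableType dO} {P : probability Omega R}.
Variables (X : nat -> {RV P >-> 'rV[R]_d}) (q : nat -> Omega -> 'rV[R]_d -> R).
Variables (f : 'rV[R]_d -> R).
Hypothesis policyX : is_policy X q.
Hypothesis mf : measurable_fun [set: 'rV[R]_d] f.
Hypothesis f_ge0 : forall x, 0 <= f x.
(** Absolute continuity of [f] with respect to each policy density: where [q] vanishes, the quotient
    [f / q] is 0 by convention and no mass of [f] is lost. *)
Hypothesis fq : forall k w x, q k w x = 0 -> f x = 0.
Local Notation past_type k := (g_sigma_algebraType (past X k)).
Local Notation leb := (@lebesgue_rV R d).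
Local Notation W := (weight X q f).

Lemma policy_ge0 k w x : 0 <= q k w x.
Proof. by have [+ _ _] := policyX => /(_ k w)[]. Qed.

Lemma measurable_policy k : measurable_fun [set: past_type k * 'rV[R]_d] (fun z => q k z.1 z.2).
Proof. by have [_ + _] := policyX. Qed.

Lemma weight_ge0 k w : 0 <= W k w.
Proof. by rewrite divr_ge0 ?policy_ge0. Qed.

Lemma measurable_weight_past j k : (0 < j <= k)%N -> measurable_fun [set: past_type k] (W j).
Proof.
move=> jk; have mX : measurable_fun [set: past_type k] (X j : past_type k -> 'rV[R]_d).
  exact: measurable_X_past.
have mid : measurable_fun [set: past_type k] (id : past_type k -> past_type j.-1).
  by apply: measurable_id_past_le; case/andP : jk => _ /(leq_trans (leq_pred _)).
apply: measurable_funM; first exact: measurableT_comp.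
apply: (measurableT_comp (@measurable_inv R)).
have mpair : measurable_fun [set: past_type k] (fun w : past_type k => (w : past_type j.-1, X j w)).
  exact: measurable_fun_pair.
exact: (measurableT_comp (measurable_policy (k := j.-1)) mpair).
Qed.

Let mfE : measurable_fun [set: 'rV[R]_d] (EFin \o f).
Proof. exact/measurable_EFinP. Qed.

Lemma measurable_past_snd k d' (T' : measurableType d') (phi : 'rV[R]_d -> T') :
  measurable_fun [set: 'rV[R]_d] phi ->
  measurable_fun [set: past_type k * 'rV[R]_d] (fun z => phi z.2).
Proof. by move=> mphi; exact: (measurableT_comp mphi measurable_snd). Qed.

Lemma measurable_past_fst k d' (T' : measurableType d') (psi : Omega -> T') :
  measurable_fun [set: past_type k] psi ->
  measurable_fun [set: past_type k * 'rV[R]_d] (fun z => psi z.1).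
Proof. by move=> mpsi; exact: (measurableT_comp mpsi measurable_fst). Qed.

Let mratio k : measurable_fun [set: past_type k * 'rV[R]_d] (fun z => f z.2 / q k z.1 z.2).
Proof.
apply: measurable_funM; first exact: measurable_past_snd.
exact: (measurableT_comp (@measurable_inv R) (measurable_policy (k := k))).
Qed.

(** The denominator of the weight cancels the conditional density of [X k.+1], leaving the target
    [f]. *)
Lemma integral_weight k (H : Omega -> 'rV[R]_d -> \bar R) :
  measurable_fun [set: past_type k * 'rV[R]_d] (fun z => H z.1 z.2) ->
  (forall w x, 0 <= H w x)%E ->
  (\int[P]_w ((W k.+1 w)%:E * H w (X k.+1 w)) =
   \int[P]_w \int[leb]_x (H w x * (f x)%:E))%E.
Proof.
move=> mH H0.
rewrite (policy_disintegration policyX (k := k)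
  (F := fun w x => ((f x / q k w x)%:E * H w x)%E)); last 2 first.
- by apply: emeasurable_funM => //; exact/measurable_EFinP.
- by move=> w x; rewrite mule_ge0// lee_fin divr_ge0 ?policy_ge0.
apply: eq_integral => w _; apply: eq_integral => x _.
rewrite muleAC muleC; congr (_ * _)%E; rewrite -EFinM.
by have [q0|q0] := eqVneq (q k w x) 0; rewrite ?(fq q0) ?mul0r// divfK.
Qed.

(** One of the two weight factors is put into the function [H] of [integral_weight]; the other one
    cancels the density. *)
Lemma integral_sqr_weight k (H : Omega -> 'rV[R]_d -> \bar R) :
  measurable_fun [set: past_type k * 'rV[R]_d] (fun z => H z.1 z.2) ->
  (forall w x, 0 <= H w x)%E ->
  (\int[P]_w ((W k.+1 w ^+ 2)%:E * H w (X k.+1 w)) =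
   \int[P]_w \int[leb]_x (H w x * (f x ^+ 2 / q k w x)%:E))%E.
Proof.
move=> mH H0.
have := @integral_weight k (fun w x => ((f x / q k w x)%:E * H w x)%E).
move=> /(_ _ _)/= IH.
under eq_integral do rewrite expr2 EFinM -muleA.
rewrite IH.
- apply: eq_integral => w _; apply: eq_integral => x _.
  rewrite muleAC muleC; congr (_ * _)%E; rewrite -EFinM.
  by rewrite mulrAC expr2.
- by apply: emeasurable_funM => //; exact/measurable_EFinP.
- by move=> w x; rewrite mule_ge0// lee_fin divr_ge0 ?policy_ge0.
Qed.

Section conditional_expectation.
Variable k : nat.
Implicit Types (psi : Omega -> R) (phi : 'rV[R]_d -> R).

(** This expresses, tested against [psi], that the conditional mean of the weighted term given the
    past is the integral of [phi * f]. Tonelli wants both factors nonnegative; the next two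
    statements lift the sign condition on [phi], then on [psi]. *)
Let E_weight_ge0 psi phi : measurable_fun [set: past_type k] psi ->
  P.-integrable [set: Omega] (EFin \o psi) -> (forall w, 0 <= psi w) ->
  measurable_fun [set: 'rV[R]_d] phi ->
  leb.-integrable [set: 'rV[R]_d] (EFin \o (fun x => phi x * f x)) -> (forall x, 0 <= phi x) ->
  P.-integrable [set: Omega] (EFin \o (fun w => psi w * (W k.+1 w * phi (X k.+1 w)))) /\
  \int[P]_w (psi w * (W k.+1 w * phi (X k.+1 w))) = (\int[P]_w psi w) * (\int[leb]_x (phi x * f x)).
Proof.
move=> mpsi ipsi psi0 mphi iphi phi0.
have E : (\int[P]_w (psi w * (W k.+1 w * phi (X k.+1 w)))%:E =
    (\int[P]_w psi w)%:E * (\int[leb]_x (phi x * f x))%:E)%E.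
  under eq_integral do rewrite mulrCA EFinM.
  rewrite (@integral_weight k (fun w x => (psi w * phi x)%:E)); last 2 first.
  - apply/measurable_EFinP; apply: measurable_funM.
      exact: measurable_past_fst.
    exact: measurable_past_snd.
  - by move=> w x; rewrite lee_fin mulr_ge0.
  rewrite !EFin_Rintegral// -ge0_integralZr//.
  - apply: eq_integral => w _; rewrite -ge0_integralZl//.
    + by apply: eq_integral => x _; rewrite -!EFinM mulrA.
    + by apply/measurable_EFinP; exact: measurable_funM.
    + by move=> x _; rewrite lee_fin mulr_ge0.
    + by rewrite lee_fin.
  - by apply/measurable_EFinP; exact: integrable_measurable ipsi.
  - by move=> w _; rewrite lee_fin.
  - by apply: integral_ge0 => x _; rewrite lee_fin mulr_ge0.
split; last by rewrite /Rintegral E.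
apply: integrable_ge0_lty.
- apply: measurable_funM; first exact: integrable_measurable ipsi.
  apply: measurable_funM.
    apply: (@measurable_past_fun _ _ _ _ _ X _ _ k.+1).
    by apply: measurable_weight_past; rewrite /= leqnn.
  exact: measurableT_comp.
- by move=> w; apply: mulr_ge0 => //; apply: mulr_ge0 => //; exact: weight_ge0.
- by rewrite E ltry.
Qed.

Let E_weight_ge0l psi phi : measurable_fun [set: past_type k] psi ->
  P.-integrable [set: Omega] (EFin \o psi) -> (forall w, 0 <= psi w) ->
  measurable_fun [set: 'rV[R]_d] phi ->
  leb.-integrable [set: 'rV[R]_d] (EFin \o (fun x => phi x * f x)) ->
  P.-integrable [set: Omega] (EFin \o (fun w => psi w * (W k.+1 w * phi (X k.+1 w)))) /\
  \int[P]_w (psi w * (W k.+1 w * phi (X k.+1 w))) = (\int[P]_w psi w) * (\int[leb]_x (phi x * f x)).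
Proof.
move=> mpsi ipsi psi0 mphi iphi.
(* With [s] equal to 1 and to -1 this treats the positive and the negative part at once. *)
have part (s : R) : `|s| <= 1 ->
    leb.-integrable [set: 'rV[R]_d] (EFin \o (fun x => Num.max (s * phi x) 0 * f x)).
  move=> s1; apply: integrable_dominated (integrable_norm iphi).
    apply: measurable_funM => //; apply: measurable_maxr => //; exact: measurable_funM.
  move=> x /=; rewrite !normrM ler_wpM2r//.
  rewrite ger0_norm ?le_max ?lexx ?orbT// ge_max normr_ge0 andbT.
  by rewrite (le_trans (ler_norm _))// normrM ler_piMl.
have mpart (s : R) : measurable_fun [set: 'rV[R]_d] (fun x => Num.max (s * phi x) 0).
  by apply: measurable_maxr => //; exact: measurable_funM.
have part0 (s : R) x : 0 <= Num.max (s * phi x) 0 by rewrite le_max lexx orbT.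
have n1 : `|1 : R| <= 1 by rewrite normr1.
have nN1 : `|-1 : R| <= 1 by rewrite normrN1.
have [i1 e1] := E_weight_ge0 mpsi ipsi psi0 (mpart 1) (part _ n1) (part0 _).
have [i2 e2] := E_weight_ge0 mpsi ipsi psi0 (mpart (-1)) (part _ nN1) (part0 _).
have phiE x : phi x = Num.max (1 * phi x) 0 - Num.max (-1 * phi x) 0.
  by rewrite mul1r mulN1r; case: (leP (phi x) 0); case: (leP (- phi x) 0); lra.
have FE : (fun w => psi w * (W k.+1 w * phi (X k.+1 w))) =
  (fun w => psi w * (W k.+1 w * Num.max (1 * phi (X k.+1 w)) 0) -
            psi w * (W k.+1 w * Num.max (-1 * phi (X k.+1 w)) 0)).
  by apply/funext => w; rewrite {1}phiE; ring.
have GE : (fun x => phi x * f x) = (fun x => Num.max (1 * phi x) 0 * f x - Num.max (-1 * phi x) 0 * f x).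
  by apply/funext => x; rewrite {1}phiE; ring.
rewrite FE GE; split; first exact: integrableB_real.
rewrite (RintegralB measurableT i1 i2) e1 e2 (RintegralB measurableT (part _ n1) (part _ nN1)).
by ring.
Qed.

Lemma E_weight psi phi : measurable_fun [set: past_type k] psi ->
  P.-integrable [set: Omega] (EFin \o psi) ->
  measurable_fun [set: 'rV[R]_d] phi ->
  leb.-integrable [set: 'rV[R]_d] (EFin \o (fun x => phi x * f x)) ->
  P.-integrable [set: Omega] (EFin \o (fun w => psi w * (W k.+1 w * phi (X k.+1 w)))) /\
  \int[P]_w (psi w * (W k.+1 w * phi (X k.+1 w))) = (\int[P]_w psi w) * (\int[leb]_x (phi x * f x)).
Proof.
move=> mpsi ipsi mphi iphi.
have part (s : R) : `|s| <= 1 ->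
    P.-integrable [set: Omega] (EFin \o (fun w => Num.max (s * psi w) 0)).
  move=> s1; apply: integrable_dominated (integrable_norm ipsi).
    apply: measurable_maxr => //; apply: measurable_funM => //.
    exact: integrable_measurable ipsi.
  move=> x /=; rewrite ger0_norm ?le_max ?lexx ?orbT// ge_max normr_ge0 andbT.
  by rewrite (le_trans (ler_norm _))// normrM ler_piMl.
have mpart (s : R) : measurable_fun [set: past_type k] (fun w => Num.max (s * psi w) 0).
  by apply: measurable_maxr => //; exact: measurable_funM.
have part0 (s : R) x : 0 <= Num.max (s * psi x) 0 by rewrite le_max lexx orbT.
have n1 : `|1 : R| <= 1 by rewrite normr1.
have nN1 : `|-1 : R| <= 1 by rewrite normrN1.
have [i1 e1] := E_weight_ge0l (mpart 1) (part _ n1) (part0 _) mphi iphi.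
have [i2 e2] := E_weight_ge0l (mpart (-1)) (part _ nN1) (part0 _) mphi iphi.
have psiE x : psi x = Num.max (1 * psi x) 0 - Num.max (-1 * psi x) 0.
  by rewrite mul1r mulN1r; case: (leP (psi x) 0); case: (leP (- psi x) 0); lra.
have FE : (fun w => psi w * (W k.+1 w * phi (X k.+1 w))) =
  (fun w => Num.max (1 * psi w) 0 * (W k.+1 w * phi (X k.+1 w)) -
            Num.max (-1 * psi w) 0 * (W k.+1 w * phi (X k.+1 w))).
  by apply/funext => w; rewrite {1}psiE; ring.
have GE : psi = (fun w => Num.max (1 * psi w) 0 - Num.max (-1 * psi w) 0).
  by apply/funext => w; rewrite {1}psiE.
rewrite FE; split; first exact: integrableB_real.
rewrite (RintegralB measurableT i1 i2) e1 e2.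
rewrite [in RHS]GE (RintegralB measurableT (part _ n1) (part _ nN1)).
by ring.
Qed.

End conditional_expectation.

Section partial_sums.
Variable phi : 'rV[R]_d -> R.
Hypothesis mphi : measurable_fun [set: 'rV[R]_d] phi.
Hypothesis iphi : leb.-integrable [set: 'rV[R]_d] (EFin \o (fun x => phi x * f x)).
Hypothesis phi2 : forall k, P.-integrable [set: Omega] (EFin \o (fun w => (W k.+1 w * phi (X k.+1 w)) ^+ 2)).

Let m := \int[leb]_x (phi x * f x).
Let M n w := \sum_(0 <= i < n) (W i.+1 w * phi (X i.+1 w) - m).

Lemma measurable_weighted_term_past j k : (0 < j <= k)%N ->
  measurable_fun [set: past_type k] (fun w => W j w * phi (X j w)).
Proof.
move=> jk; apply: measurable_funM; first exact: measurable_weight_past.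
by apply: (measurableT_comp mphi); exact: measurable_X_past.
Qed.

Lemma measurable_partial_sum_past n : measurable_fun [set: past_type n] (M n).
Proof.
suff H k : (k <= n)%N -> measurable_fun [set: past_type n] (M k) by exact: H.
elim: k => [|k IH] kn; first by rewrite /M; under eq_fun do rewrite big_geq//; exact: measurable_cst.
have -> : M k.+1 = (fun w => M k w + (W k.+1 w * phi (X k.+1 w) - m)).
  by apply/funext => w; rewrite /M big_nat_recr.
apply: measurable_funD; first exact: (IH (ltnW kn)).
by apply: measurable_funB => //; exact: measurable_weighted_term_past.
Qed.

Lemma measurable_weighted_term k : measurable_fun [set: Omega] (fun w => W k.+1 w * phi (X k.+1 w)).
Proof.
apply: (@measurable_past_fun _ _ _ _ _ X _ _ k.+1).
by apply: measurable_weighted_term_past; rewrite /= leqnn.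
Qed.

Lemma integrable_of_sqr (F : Omega -> R) : measurable_fun [set: Omega] F ->
  P.-integrable [set: Omega] (EFin \o (fun w => F w ^+ 2)) -> P.-integrable [set: Omega] (EFin \o F).
Proof.
move=> mF iF.
apply: (@integrable_dominated _ _ _ P _ (fun w => 1 + F w ^+ 2)) => //.
  move=> w; rewrite -(real_normK (num_real (F w))); have := sqr_ge0 (`|F w| - 1); nra.
by apply: integrableD_real => //; exact: finite_measure_integrable_cst.
Qed.

(** Orthogonality of the increments: the cross term vanishes by [E_weight] with [psi := M n], and
    centring only lowers second moments. Integrability is carried through the induction because the
    cross term needs it at the next step. *)
Lemma variance_partial_sum n :
  P.-integrable [set: Omega] (EFin \o (fun w => M n w ^+ 2)) /\
  \int[P]_w (M n w ^+ 2) <= \sum_(0 <= i < n) \int[P]_w ((W i.+1 w * phi (X i.+1 w)) ^+ 2).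
Proof.
elim: n => [|n [iM IH]].
  rewrite /M; under eq_fun do rewrite big_geq// expr0n.
  split; first exact: finite_measure_integrable_cst.
  by rewrite big_geq// probability_Rintegral_cst.
have mMp : measurable_fun [set: past_type n] (M n) by exact: measurable_partial_sum_past.
have mM : measurable_fun [set: Omega] (M n) by exact: measurable_past_fun mMp.
have iM1 := integrable_of_sqr mM iM.
have iU1 := integrable_of_sqr (measurable_weighted_term n) (phi2 n).
have [iMU eMU] := E_weight mMp iM1 mphi iphi.
have [iU eU] := E_weight (k := n) (psi := cst 1) (measurable_cst _)
   (finite_measure_integrable_cst P 1 measurableT) mphi iphi.
rewrite probability_Rintegral_cst mul1r in eU.
have {}eU : \int[P]_w (W n.+1 w * phi (X n.+1 w)) = m.
  by rewrite /m -eU; apply: eq_Rintegral => w _; rewrite mul1r.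
have FE : (fun w => M n.+1 w ^+ 2) = (fun w =>
   (M n w ^+ 2 + 2 * (M n w * (W n.+1 w * phi (X n.+1 w)))) +
   ((W n.+1 w * phi (X n.+1 w)) ^+ 2 + ((- (2 * m)) * M n w + ((- (2 * m)) * (W n.+1 w * phi (X n.+1 w)) + m ^+ 2)))).
  by apply/funext => w; rewrite /M big_nat_recr//=; ring.
have ic : P.-integrable [set: Omega] (EFin \o (fun=> m ^+ 2)) by exact: finite_measure_integrable_cst.
have j1 := integrableD_real (integrableZl_real (- (2 * m)) iU1) ic.
have j2 := integrableD_real (integrableZl_real (- (2 * m)) iM1) j1.
have j3 := integrableD_real (phi2 n) j2.
have j4 := integrableD_real iM (integrableZl_real 2 iMU).
rewrite FE; split; first exact: integrableD_real.
rewrite (RintegralD measurableT j4 j3) (RintegralD measurableT iM (integrableZl_real 2 iMU)).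
rewrite (RintegralD measurableT (phi2 n) j2) (RintegralD measurableT (integrableZl_real (- (2 * m)) iM1) j1).
rewrite (RintegralD measurableT (integrableZl_real (- (2 * m)) iU1) ic).
rewrite (RintegralZl 2 measurableT iMU) (RintegralZl (- (2 * m)) measurableT iM1) (RintegralZl (- (2 * m)) measurableT iU1).
rewrite eMU -/m eU probability_Rintegral_cst big_nat_recr//=.
have := sqr_ge0 m; lra.
Qed.

End partial_sums.

(** * Conditional second moments *)

Section conditional_second_moment.
Variables (k : nat) (phi s : 'rV[R]_d -> R) (B : R).
Hypothesis mphi : measurable_fun [set: 'rV[R]_d] phi.
(** A crude bound, of order [1 / lam k] in the applications. It provides integrability and the
    exchange of integrals, while the estimates themselves carry other constants. *)
Hypothesis domq : forall w x, f x ^+ 2 / q k w x <= B * s x.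
Hypothesis iphi : leb.-integrable [set: 'rV[R]_d] (EFin \o (fun x => phi x ^+ 2 * s x)).

Let ratio x w := f x ^+ 2 / q k w x.

Let ratio_ge0 x w : 0 <= ratio x w.
Proof. by rewrite divr_ge0 ?sqr_ge0 ?policy_ge0. Qed.

Let mphi2 : measurable_fun [set: 'rV[R]_d] (fun x => phi x ^+ 2).
Proof. exact: measurable_funX. Qed.

Lemma measurable_swap_past : measurable_fun [set: 'rV[R]_d * Omega]
  (fun z => (z.2 : past_type k, z.1)).
Proof.
have mid : measurable_fun [set: Omega] (id : Omega -> past_type k) by exact: measurable_id_past.
apply: measurable_fun_pair; last exact: measurable_fst.
exact: (measurableT_comp mid measurable_snd).
Qed.

Lemma measurable_joint_ratio :
  measurable_fun [set: 'rV[R]_d * Omega] (fun z => f z.1 ^+ 2 / q k z.2 z.1).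
Proof.
apply: measurable_funM.
  by apply: measurable_funX; exact: (measurableT_comp mf measurable_fst).
apply: (measurableT_comp (@measurable_inv R)).
exact: (measurableT_comp (measurable_policy (k := k)) measurable_swap_past).
Qed.

Let mratio2 : measurable_fun [set: 'rV[R]_d * Omega] (fun z => ratio z.1 z.2).
Proof. exact: measurable_joint_ratio. Qed.

Let mphiratio : measurable_fun [set: 'rV[R]_d * Omega] (fun z => phi z.1 ^+ 2 * ratio z.1 z.2).
Proof.
by apply: measurable_funM => //; exact: (measurableT_comp mphi2 measurable_fst).
Qed.

Let dom x w : `|phi x ^+ 2 * ratio x w| <= B * (phi x ^+ 2 * s x).
Proof.
have x2 := sqr_ge0 (phi x).
rewrite ger0_norm; last exact: mulr_ge0.
by rewrite [leRHS]mulrCA; exact: (ler_wpM2l x2 (domq w x)).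
Qed.

Let idom : leb.-integrable [set: 'rV[R]_d] (EFin \o (fun x => B * (phi x ^+ 2 * s x))).
Proof. exact: integrableZl_real. Qed.

(** The conditional second moment of the weighted term given the past. *)
Let v w := \int[leb]_x (phi x ^+ 2 * ratio x w).

Let mv : measurable_fun [set: Omega] v.
Proof. exact: (@measurable_Rintegral2 _ _ _ _ _ leb P _ _ mphiratio dom idom). Qed.

Let iv w : leb.-integrable [set: 'rV[R]_d] (EFin \o (fun x => phi x ^+ 2 * ratio x w)).
Proof. exact: (@dominated_section2 _ _ _ _ _ leb _ _ mphiratio dom idom w). Qed.

Let v_le w : `|v w| <= \int[leb]_x (B * (phi x ^+ 2 * s x)).
Proof.
apply: (@norm_Rintegral_le _ _ _ leb _ (fun x => B * (phi x ^+ 2 * s x))) => //.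
exact: (integrable_measurable (iv w)).
Qed.

Let wphi w := W k.+1 w * phi (X k.+1 w).

Let mwphi : measurable_fun [set: Omega] wphi.
Proof. exact: measurable_weighted_term. Qed.

Let E_sqr_ge0 (psi : Omega -> R) (c : R) : measurable_fun [set: past_type k] psi ->
  (forall w, 0 <= psi w) -> (forall w, psi w <= c) ->
  P.-integrable [set: Omega] (EFin \o (fun w => psi w * wphi w ^+ 2)) /\
  \int[P]_w (psi w * wphi w ^+ 2) = \int[P]_w (psi w * v w).
Proof.
move=> mpsi psi0 psic.
have mpsi' : measurable_fun [set: Omega] psi by exact: measurable_past_fun mpsi.
have E : (\int[P]_w (psi w * wphi w ^+ 2)%:E = \int[P]_w (psi w * v w)%:E)%E.
  transitivity (\int[P]_w ((W k.+1 w ^+ 2)%:E * (psi w * phi (X k.+1 w) ^+ 2)%:E))%E.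
    by apply: eq_integral => w _; rewrite -EFinM /wphi exprMn mulrCA.
  rewrite (@integral_sqr_weight k (fun w x => (psi w * phi x ^+ 2)%:E)); last 2 first.
  - apply/measurable_EFinP; apply: measurable_funM.
      exact: measurable_past_fst.
    exact: (measurable_past_snd mphi2).
  - by move=> w x; rewrite lee_fin mulr_ge0 ?sqr_ge0.
  apply: eq_integral => w _; rewrite EFinM EFin_Rintegral//.
  rewrite -ge0_integralZl//.
  - by apply: eq_integral => x _; rewrite -!EFinM /ratio -mulrA.
  - by apply/measurable_EFinP; exact: (integrable_measurable (iv w)).
  - by move=> x _; rewrite lee_fin mulr_ge0 ?sqr_ge0.
  - by rewrite lee_fin.
have ipv : P.-integrable [set: Omega] (EFin \o (fun w => psi w * v w)).
  apply: (@integrable_bounded _ _ _ P _ (c * \int[leb]_x (B * (phi x ^+ 2 * s x)))).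
    exact: measurable_funM.
  by move=> w; rewrite normrM; apply: ler_pM => //; rewrite ger0_norm.
split; last by rewrite /Rintegral E.
apply: integrable_ge0_lty.
- by apply: measurable_funM => //; exact: measurable_funX.
- by move=> w; rewrite mulr_ge0 ?sqr_ge0.
- by rewrite E; exact: integrable_lty.
Qed.

Lemma integrable_sqr_weighted_term : P.-integrable [set: Omega] (EFin \o (fun w => wphi w ^+ 2)).
Proof.
have [|||i _] := @E_sqr_ge0 (cst 1) 1 => //.
by apply: eq_integrable i => // w _; rewrite /= mul1r.
Qed.

(** Fubini brings the expectation inside the integral over [x], so a bound on the mean of the ratio
    at each point suffices. *)
Lemma E_sqr_weighted_term_le (C : R) : (forall x, \int[P]_w ratio x w <= C * s x) ->
  \int[P]_w (wphi w ^+ 2) <= C * \int[leb]_x (phi x ^+ 2 * s x).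
Proof.
move=> HC.
have [|||_ E] := @E_sqr_ge0 (cst 1) 1 => //.
have -> : \int[P]_w (wphi w ^+ 2) = \int[P]_w v w.
  have -> : \int[P]_w (wphi w ^+ 2) = \int[P]_w (cst 1 w * wphi w ^+ 2).
    by apply: eq_Rintegral => w _; rewrite mul1r.
  by rewrite E; apply: eq_Rintegral => w _; rewrite mul1r.
rewrite -(@Rintegral_fubini _ _ _ _ _ leb P _ _ mphiratio dom idom).
rewrite -(RintegralZl C measurableT iphi).
apply: ler_Rintegral.
- apply: (@integrable_dominated _ _ _ leb _ _ _ _ idom).
    exact: (@measurable_Rintegral1 _ _ _ _ _ leb P _ _ mphiratio dom idom).
  move=> x; rewrite -(probability_Rintegral_cst P (B * (phi x ^+ 2 * s x))).
  apply: norm_Rintegral_le => //.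
    exact: (integrable_measurable (@dominated_section1 _ _ _ _ _ P _ _ mphiratio dom x)).
  exact: finite_measure_integrable_cst.
- exact: integrableZl_real.
- move=> x.
  rewrite RintegralZl//; first by rewrite mulrCA ler_wpM2l ?sqr_ge0.
  apply: (@integrable_bounded _ _ _ P _ (B * s x)).
    exact: (measurableT_comp mratio2 (pair1_measurable x)).
  by move=> w; rewrite ger0_norm; [exact: (domq w x)|exact: ratio_ge0].
Qed.

Hypothesis domf : forall x, f x <= B * s x.

Let V := \int[leb]_x (phi x ^+ 2 * f x).

Let iphif : leb.-integrable [set: 'rV[R]_d] (EFin \o (fun x => phi x ^+ 2 * f x)).
Proof.
apply: (@integrable_dominated _ _ _ leb _ _ _ _ idom).
  exact: measurable_funM.
move=> x; have x2 := sqr_ge0 (phi x).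
rewrite ger0_norm; last exact: mulr_ge0.
by rewrite [leRHS]mulrCA; exact: (ler_wpM2l x2 (domf x)).
Qed.

(** Under the test function the square may be replaced by its conditional mean [v]; then [v - V] is
    an integral of [ratio - f], and Fubini exchanges the integrals. *)
Lemma conditional_variance_bound (psi : Omega -> R) : measurable_fun [set: past_type k] psi ->
  (forall w, `|psi w| <= 1) ->
  `|\int[P]_w (psi w * (wphi w ^+ 2 - V))| <=
  \int[leb]_x (phi x ^+ 2 * \int[P]_w `|ratio x w - f x|).
Proof.
move=> mpsi psi1.
have mpsi' : measurable_fun [set: Omega] psi by exact: measurable_past_fun mpsi.
(* [E_sqr_ge0] needs a nonnegative test function, so [psi] is written as [(psi + 1) - 1]. *)
have [p1 p2] : (forall w, 0 <= psi w + 1) /\ (forall w, psi w + 1 <= 2).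
  by split => w; have := psi1 w; rewrite ler_norml; lra.
have mp1 : measurable_fun [set: past_type k] (fun w => psi w + 1) by exact: measurable_funD.
have [i1 e1] := E_sqr_ge0 mp1 p1 p2.
have [i0 e0] := @E_sqr_ge0 (cst 1) 1 (measurable_cst _) (fun _ => ler01) (fun _ => lexx _).
have iv1 : P.-integrable [set: Omega] (EFin \o (fun w => (psi w + 1) * v w)).
  apply: (@integrable_bounded _ _ _ P _ (2 * \int[leb]_x (B * (phi x ^+ 2 * s x)))).
    by apply: measurable_funM => //; exact: measurable_funD.
  by move=> w; rewrite normrM; apply: ler_pM => //; rewrite ger0_norm.
have iv0 : P.-integrable [set: Omega] (EFin \o (fun w => cst 1 w * v w)).
  apply: (@integrable_bounded _ _ _ P _ (\int[leb]_x (B * (phi x ^+ 2 * s x)))).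
    exact: measurable_funM.
  by move=> w; rewrite mul1r.
have iV : P.-integrable [set: Omega] (EFin \o (fun w => V * psi w)).
  by apply: integrableZl_real; apply: (@integrable_bounded _ _ _ P _ 1).
have -> : \int[P]_w (psi w * (wphi w ^+ 2 - V)) = \int[P]_w (psi w * (v w - V)).
  have FE (a : Omega -> R) : (fun w => psi w * (a w - V)) =
      (fun w => ((psi w + 1) * a w - cst 1 w * a w) - V * psi w).
    by apply/funext => w /=; ring.
  rewrite (FE (fun w => wphi w ^+ 2)) (FE v).
  rewrite (RintegralB measurableT (integrableB_real i1 i0) iV) (RintegralB measurableT i1 i0).
  rewrite (RintegralB measurableT (integrableB_real iv1 iv0) iV) (RintegralB measurableT iv1 iv0).
  by rewrite e1 e0.
pose gap x w := phi x ^+ 2 * `|ratio x w - f x|.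
have mgap : measurable_fun [set: 'rV[R]_d * Omega] (fun z => gap z.1 z.2).
  apply: measurable_funM; first exact: (measurableT_comp mphi2 measurable_fst).
  apply: measurableT_comp => //; apply: measurable_funB => //.
  exact: (measurableT_comp mf measurable_fst).
have gap_le x w : `|gap x w| <= 2 * (B * (phi x ^+ 2 * s x)).
  rewrite ger0_norm; last by rewrite mulr_ge0// sqr_ge0.
  rewrite /gap.
  have := domq w x; have := domf x; have := ratio_ge0 x w; have := f_ge0 x; rewrite -/(ratio x w) => h1 h2 h3 h4.
  have : `|ratio x w - f x| <= 2 * (B * s x).
    by rewrite ler_norml; lra.
  move=> /(ler_wpM2l (sqr_ge0 (phi x))); lra.
have igap : leb.-integrable [set: 'rV[R]_d] (EFin \o (fun x => 2 * (B * (phi x ^+ 2 * s x)))).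
  exact: integrableZl_real.
have igapw w := @dominated_section2 _ _ _ _ _ leb _ _ mgap gap_le igap w.
have -> : \int[leb]_x (phi x ^+ 2 * \int[P]_w `|ratio x w - f x|) = \int[P]_w \int[leb]_x gap x w.
  rewrite -(@Rintegral_fubini _ _ _ _ _ leb P _ _ mgap gap_le igap).
  apply: eq_Rintegral => x _; rewrite RintegralZl//.
  apply: (@integrable_bounded _ _ _ P _ (2 * (B * s x))).
    apply: measurableT_comp => //; apply: measurable_funB => //.
    exact: (measurableT_comp mratio2 (pair1_measurable x)).
  move=> w; rewrite normr_id.
  have := domq w x; have := domf x; have := ratio_ge0 x w; have := f_ge0 x; rewrite -/(ratio x w) => h1 h2 h3 h4.
  by rewrite ler_norml; lra.
apply: norm_Rintegral_le.
- by apply: measurable_funM => //; exact: measurable_funB.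
- move=> w; rewrite normrM -[leRHS]mul1r; apply: ler_pM => //.
  rewrite /v /V -(RintegralB measurableT (iv w) iphif).
  apply: norm_Rintegral_le (igapw w).
    exact: (integrable_measurable (integrableB_real (iv w) iphif)).
  by move=> x; rewrite -mulrBr normrM ger0_norm ?sqr_ge0.
- apply: (@integrable_bounded _ _ _ P _ (\int[leb]_x (2 * (B * (phi x ^+ 2 * s x))))).
    exact: (@measurable_Rintegral2 _ _ _ _ _ leb P _ _ mgap gap_le igap).
  move=> w; apply: norm_Rintegral_le => //.
  exact: (integrable_measurable (igapw w)).
Qed.

End conditional_second_moment.

End weighted_moments.

(** * Kernel smoothing and mixture policies *)

Lemma measurable_prob_density (R : realType) (d : nat) (p : 'rV[R]_d -> R) :
  prob_density p -> measurable_fun [set: 'rV[R]_d] p.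
Proof. by case. Qed.

Lemma prob_density_ge0 (R : realType) (d : nat) (p : 'rV[R]_d -> R) x :
  prob_density p -> 0 <= p x.
Proof. by case. Qed.

Lemma integrable_prob_density (R : realType) (d : nat) (p : 'rV[R]_d -> R) :
  prob_density p -> (@lebesgue_rV R d).-integrable [set: 'rV[R]_d] (EFin \o p).
Proof. by move=> [mp p0 p1]; apply: integrable_ge0_lty => //; rewrite p1 ltry. Qed.

Lemma Rintegral_prob_density (R : realType) (d : nat) (p : 'rV[R]_d -> R) :
  prob_density p -> \int[lebesgue_rV]_x p x = 1.
Proof. by move=> [mp p0 p1]; rewrite /Rintegral p1. Qed.

Lemma enorm_sqr (R : realType) (d : nat) (v : 'rV[R]_d) :
  enorm v ^+ 2 = \sum_(i < d) v ord0 i ^+ 2.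
Proof. by rewrite /enorm sqr_sqrtr// sumr_ge0// => i _; exact: sqr_ge0. Qed.

Lemma measurable_enorm_sqr (R : realType) (d : nat) :
  measurable_fun [set: 'rV[R]_d] (fun u => enorm u ^+ 2).
Proof.
under eq_fun do rewrite enorm_sqr.
apply: measurable_sum => i; apply: measurable_funX.
exact: (measurable_rV_coord i).
Qed.

Section kernel_smoothing.
Context {R : realType} {d : nat}.
Variables (K f : 'rV[R]_d -> R) (h F : R).
Hypothesis K_density : prob_density K.
Hypothesis f_density : prob_density f.
Hypothesis f_le : forall x, f x <= F.
Hypothesis h_gt0 : 0 < h.
Local Notation leb := (@lebesgue_rV R d).

Let K0 x : 0 <= K x. Proof. exact: prob_density_ge0. Qed.
Let f0 x : 0 <= f x. Proof. exact: prob_density_ge0. Qed.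
Let mK : measurable_fun [set: 'rV[R]_d] K. Proof. exact: measurable_prob_density. Qed.
Let mf : measurable_fun [set: 'rV[R]_d] f. Proof. exact: measurable_prob_density. Qed.

Lemma scaled_kernel_ge0 u : 0 <= scaled_kernel K h u.
Proof. by rewrite divr_ge0// exprn_ge0// ltW. Qed.

Lemma measurable_scaled_kernel x :
  measurable_fun [set: 'rV[R]_d] (fun y => scaled_kernel K h (x - y)).
Proof.
apply: measurable_funM => //.
apply: (measurableT_comp mK); apply/measurable_rVP => i.
under eq_fun do rewrite !mxE.
by apply: measurable_funM => //; apply: measurable_funB => //; exact: measurable_rV_coord.
Qed.

Lemma ge0_integral_scaled_kernel (phi : 'rV[R]_d -> R) x :
  measurable_fun [set: 'rV[R]_d] phi -> (forall y, 0 <= phi y) ->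
  (\int[leb]_y (phi y * scaled_kernel K h (x - y))%:E =
   \int[leb]_u (phi (x - h *: u) * K u)%:E)%E.
Proof.
move=> mphi phi0.
have hd : 0 < h ^+ d by rewrite exprn_gt0.
rewrite (ge0_integral_rV_affine x h_gt0); last 2 first.
- apply/measurable_EFinP; apply: measurable_funM => //; exact: measurable_scaled_kernel.
- by move=> y; rewrite lee_fin mulr_ge0 ?scaled_kernel_ge0.
rewrite -ge0_integralZl//.
- apply: eq_integral => u _; rewrite -EFinM /scaled_kernel; congr (_%:E).
  rewrite opprD opprK addrA subrr add0r scalerA mulVf ?gt_eqF// scale1r.
  by rewrite mulrCA [h ^+ d * _]mulrC divfK// gt_eqF.
- apply/measurable_EFinP; apply: measurable_funM.
    by apply: (measurableT_comp mphi); exact: measurable_rV_affine.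
  apply: (measurableT_comp (measurable_scaled_kernel x)); exact: measurable_rV_affine.
- by move=> u _; rewrite lee_fin mulr_ge0 ?scaled_kernel_ge0.
- by rewrite lee_fin ltW.
Qed.

Let mshift x : measurable_fun [set: 'rV[R]_d] (fun u => f (x - h *: u)).
Proof. by apply: (measurableT_comp mf); exact: measurable_rV_affine. Qed.

Lemma integrable_shift_kernel x :
  leb.-integrable [set: 'rV[R]_d] (EFin \o (fun u => f (x - h *: u) * K u)).
Proof.
apply: (integrable_dominated _ _ (integrableZl_real F (integrable_prob_density K_density))).
  exact: measurable_funM.
by move=> u; rewrite ger0_norm ?mulr_ge0// ler_wpM2r.
Qed.

Lemma integrable_smoothing x :
  leb.-integrable [set: 'rV[R]_d] (EFin \o (fun y => scaled_kernel K h (x - y) * f y)).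
Proof.
apply: integrable_ge0_lty.
- by apply: measurable_funM => //; exact: measurable_scaled_kernel.
- by move=> y; rewrite mulr_ge0 ?scaled_kernel_ge0.
under eq_integral do rewrite mulrC.
by rewrite ge0_integral_scaled_kernel//; exact: (integrable_lty measurableT (integrable_shift_kernel x)).
Qed.

Lemma Rintegral_smoothing x :
  \int[leb]_y (scaled_kernel K h (x - y) * f y) = \int[leb]_u (f (x - h *: u) * K u).
Proof.
rewrite /Rintegral; congr fine.
by under eq_integral do rewrite mulrC; rewrite ge0_integral_scaled_kernel.
Qed.

(** One kernel factor is bounded by [CK / h ^+ d]; the other one, integrated against [f], gives at
    most [F]. *)
Lemma smoothing_sqr_le (CK : R) x : (forall u, K u <= CK) ->
  leb.-integrable [set: 'rV[R]_d] (EFin \o (fun y => scaled_kernel K h (x - y) ^+ 2 * f y)) /\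
  \int[leb]_y (scaled_kernel K h (x - y) ^+ 2 * f y) <= CK * F / h ^+ d.
Proof.
move=> KCK.
have hd : 0 < h ^+ d by rewrite exprn_gt0.
have CK0 : 0 <= CK by exact: le_trans (K0 0) (KCK 0).
have F0 : 0 <= F by exact: le_trans (f0 0) (f_le 0).
have dom y : `|scaled_kernel K h (x - y) ^+ 2 * f y| <=
    CK / h ^+ d * (scaled_kernel K h (x - y) * f y).
  have s0 := scaled_kernel_ge0 (x - y).
  rewrite ger0_norm; last by rewrite mulr_ge0// sqr_ge0.
  rewrite mulrA; apply: ler_wpM2r => //; rewrite expr2; apply: ler_wpM2r => //.
  by rewrite /scaled_kernel ler_pM2r// invr_gt0.
have idom := integrableZl_real (CK / h ^+ d) (integrable_smoothing x).
have ms : measurable_fun [set: 'rV[R]_d] (fun y => scaled_kernel K h (x - y) ^+ 2 * f y).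
  by apply: measurable_funM => //; apply: measurable_funX; exact: measurable_scaled_kernel.
have ii := integrable_dominated ms dom idom.
split => //.
apply: le_trans (le_trans (ler_norm _) (norm_Rintegral_le ms dom idom)) _.
rewrite (RintegralZl _ measurableT (integrable_smoothing x)).
rewrite [leRHS]mulrAC; apply: ler_wpM2l; first by rewrite divr_ge0// ltW.
rewrite Rintegral_smoothing -[leRHS]mulr1 -(Rintegral_prob_density K_density).
rewrite -(RintegralZl F measurableT (integrable_prob_density K_density)).
apply: ler_Rintegral.
- exact: integrable_shift_kernel.
- exact: integrableZl_real (integrable_prob_density K_density).
- by move=> u; rewrite ler_wpM2r.
Qed.

(** The first-order Taylor terms integrate to zero because the kernel is centred, which leaves the
    order [h ^+ 2]. *)
Lemma smoothing_bias (M : R) x : 0 <= M ->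
  (forall i y, derivable f y 'e_i) ->
  (forall i j y, derivable (fun z => 'D_('e_i) f z) y 'e_j) ->
  (forall i j y, `|'D_('e_j) (fun z => 'D_('e_i) f z) y| <= M) ->
  (forall i : 'I_d, \int[leb]_u (u ord0 i * K u) = 0) ->
  (\int[leb]_u (enorm u ^+ 2 * K u)%:E < +oo)%E ->
  `|\int[leb]_y (scaled_kernel K h (x - y) * f y) - f x| <=
  M * d%:R ^+ 2 * (\int[leb]_u (enorm u ^+ 2 * K u)) * h ^+ 2.
Proof.
move=> M0 df d2f d2fM K1 K2.
have i2 : leb.-integrable [set: 'rV[R]_d] (EFin \o (fun u => enorm u ^+ 2 * K u)).
  apply: integrable_ge0_lty => //.
    by apply: measurable_funM => //; exact: measurable_enorm_sqr.
  by move=> u; rewrite mulr_ge0// sqr_ge0.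
have iK := integrable_prob_density K_density.
have i1 (i : 'I_d) : leb.-integrable [set: 'rV[R]_d] (EFin \o (fun u : 'rV[R]_d => u ord0 i * K u)).
  apply: (integrable_dominated _ _ (integrableD_real iK i2)).
    by apply: measurable_funM => //; exact: measurable_rV_coord.
  move=> u; rewrite normrM (ger0_norm (K0 u)) -[X in X + _]mul1r -mulrDl ler_wpM2r//.
  have := norm_coord_le_enorm u i; have := sqr_ge0 (enorm u - 1); nra.
have il (i : 'I_d) := integrableZl_real ('D_('e_i) f x) (i1 i).
have [isum esum] := @Rintegral_sum _ _ _ leb 'I_d (index_enum 'I_d)
  (fun i u => 'D_('e_i) f x * (u ord0 i * K u)) il.
have isum0 : \int[leb]_u (\sum_(i < d) 'D_('e_i) f x * (u ord0 i * K u)) = 0.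
  rewrite esum big1// => i _.
  by rewrite (RintegralZl _ measurableT (i1 i)) K1 mulr0.
(* Adding the linear term, of zero integral, turns the increment of [f] into a second-order
   remainder. *)
pose rem u := (f (x - h *: u) - f x) * K u + h * (\sum_(i < d) 'D_('e_i) f x * (u ord0 i * K u)).
have remE : rem = (fun u => (f (x - h *: u) * K u - f x * K u) +
    h * (\sum_(i < d) 'D_('e_i) f x * (u ord0 i * K u))).
  by apply/funext => u; rewrite /rem mulrBl.
have iB := integrableB_real (integrable_shift_kernel x) (integrableZl_real (f x) iK).
have irem : leb.-integrable [set: 'rV[R]_d] (EFin \o rem).
  by rewrite remE; apply: integrableD_real => //; exact: integrableZl_real.
have -> : \int[leb]_y (scaled_kernel K h (x - y) * f y) - f x = \int[leb]_u rem u.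
  rewrite remE (RintegralD measurableT iB (integrableZl_real h isum)).
  rewrite (RintegralB measurableT (integrable_shift_kernel x) (integrableZl_real (f x) iK)).
  rewrite (RintegralZl h measurableT isum) (RintegralZl (f x) measurableT iK).
  by rewrite isum0 (Rintegral_prob_density K_density) Rintegral_smoothing mulr0 mulr1 addr0.
have -> : M * d%:R ^+ 2 * (\int[leb]_u (enorm u ^+ 2 * K u)) * h ^+ 2 =
    \int[leb]_u (M * d%:R ^+ 2 * h ^+ 2 * (enorm u ^+ 2 * K u)).
  by rewrite (RintegralZl _ measurableT i2); ring.
apply: norm_Rintegral_le.
- exact: integrable_measurable irem.
- move=> u; rewrite /rem.
  have -> : \sum_(i < d) 'D_('e_i) f x * (u ord0 i * K u) =
      (\sum_(i < d) u ord0 i * 'D_('e_i) f x) * K u.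
    by rewrite mulr_suml; apply: eq_bigr => i _; ring.
  rewrite mulrA -mulrDl normrM (ger0_norm (K0 u)) mulrA; apply: ler_wpM2r => //.
  have := taylor_rV x (- (h *: u)) M0 df d2f d2fM.
  have -> : \sum_i (- (h *: u)) ord0 i * 'D_('e_i) f x = - (h * \sum_i u ord0 i * 'D_('e_i) f x).
    by rewrite mulr_sumr -sumrN; apply: eq_bigr => i _; rewrite !mxE; ring.
  rewrite opprK => /le_trans; apply.
  rewrite -[leRHS]mulrA; apply: ler_wpM2l; first by rewrite mulr_ge0// sqr_ge0.
  rewrite !enorm_sqr mulr_sumr; apply: ler_sum => i _; rewrite !mxE.
  by rewrite sqrrN exprMn.
- exact: integrableZl_real.
Qed.

End kernel_smoothing.

(** * Pointwise bounds for the ratio under a mixture *)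

Section mixture_ratio.
Context {R : realFieldType}.
(** Values at a fixed outcome and a fixed point: [a] is the target density, [D] the mean weight and
    [N] the unnormalized kernel estimate. *)
Variables (a q0 lam c fk q D N : R).
Hypotheses (a0 : 0 < a) (aq : a <= c * q0) (lam0 : 0 < lam) (lam2 : lam <= 2^-1).
Hypotheses (fk0 : 0 <= fk) (fkE : 0 < D -> fk = N / D).
Hypotheses (q00 : 0 <= q0) (c0 : 0 < c) (qE : q = (1 - lam) * fk + lam * q0).

(** The factor 4 makes [err] at least 1 as soon as [|D - 1|] or [|N - a| / a] reaches one half, as
    in Chebyshev's inequality. *)
Let err := 4 * ((D - 1) ^+ 2 + (N - a) ^+ 2 / a ^+ 2).
(* Dominates the indicator of the bad event {D < 1/2} u {D > 2} u {N < a/2}. *)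
Let beta := Num.min 1 err.

Let err0 : 0 <= err.
Proof. by rewrite mulr_ge0 ?addr_ge0 ?sqr_ge0// divr_ge0 ?sqr_ge0. Qed.

Let beta0 : 0 <= beta. Proof. by rewrite le_min ler01 err0. Qed.

Let q0_gt0 : 0 < q0. Proof. by rewrite -(pmulr_rgt0 _ c0) (lt_le_trans a0). Qed.

Let q_ge : lam * q0 <= q.
Proof. by rewrite qE lerDr mulr_ge0//; have := lam2; lra. Qed.

Let q_gt0 : 0 < q. Proof. by apply: lt_le_trans q_ge; rewrite mulr_gt0. Qed.

Let good : [/\ 1 <= 2 * D, D <= 2 & a <= 2 * N] \/ beta = 1.
Proof.
have errN : 0 <= (N - a) ^+ 2 / a ^+ 2 by rewrite divr_ge0 ?sqr_ge0.
have [D1|D1] := leP 1 (2 * D); last first.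
  by right; apply/min_idPl; rewrite /err mulrDr; nra.
have [D2|D2] := leP D 2; last first.
  by right; apply/min_idPl; rewrite /err mulrDr; nra.
have [N1|N1] := leP a (2 * N); first by left.
right; apply/min_idPl; rewrite /err mulrDr.
have : 4^-1 <= (N - a) ^+ 2 / a ^+ 2.
  rewrite ler_pdivlMr ?exprn_gt0//.
  have : 0 <= (a - 2 * N) * (3 * a - 2 * N) by apply: mulr_ge0; have := a0; lra.
  by rewrite -subr_ge0; lra.
have := sqr_ge0 (D - 1); lra.
Qed.

(** On the good event [N / D >= a / 4], and the mixture keeps at least half of [fk]. *)
Let good_ge : 1 <= 2 * D -> D <= 2 -> a <= 2 * N -> a <= 8 * q.
Proof.
move=> D1 D2 N1.
have D0 : 0 < D by lra.
have : a <= 4 * fk.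
  rewrite fkE// mulrA ler_pdivlMr//.
  have : 0 <= a * (2 - D) by apply: mulr_ge0; [exact: ltW|lra].
  lra.
have h1 : 0 <= (2^-1 - lam) * fk by apply: mulr_ge0 => //; have := lam2; lra.
have h2 : 0 <= lam * q0 by rewrite mulr_ge0// ltW.
rewrite qE; lra.
Qed.

Let a2q_le : a ^+ 2 / q <= a ^+ 2 / (lam * q0).
Proof.
apply: ler_wpM2l; first exact: sqr_ge0.
by rewrite lef_pV2// posrE mulr_gt0.
Qed.

Lemma mixture_ratio_le : a ^+ 2 / q <= 8 * a + a ^+ 2 / (lam * q0) * beta.
Proof.
have [[D1 D2 N1]|->] := good; last by rewrite mulr1 ler_wpDl// mulr_ge0// ltW.
apply: ler_wpDr; first by rewrite mulr_ge0// divr_ge0 ?sqr_ge0// mulr_ge0// ltW.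
rewrite ler_pdivrMr// expr2 [8 * a]mulrC -mulrA ler_wpM2l ?(ltW a0)//.
exact: good_ge.
Qed.

(** On the good event [a / q <= 8], and [a - q] splits into an estimation error and a mixing error
    of order [lam]. On the bad event the left side is at most [(c / lam + 1) * a], and [err >= 1]
    may be inserted as a factor. *)
Lemma mixture_ratio_dist : `|a ^+ 2 / q - a| <=
  16 * (`|N - a| + a * `|D - 1|) + 8 * lam * (q0 + a) + (c / lam + 1) * a * err.
Proof.
have a0' := ltW a0; have lam0' := ltW lam0; have c0' := ltW c0.
have cl0 : 0 <= c / lam by rewrite divr_ge0.
have t1 : 0 <= 16 * (`|N - a| + a * `|D - 1|) by rewrite !(mulr_ge0, addr_ge0).
have t2 : 0 <= 8 * lam * (q0 + a) by rewrite !(mulr_ge0, addr_ge0).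
have ca : 0 <= (c / lam + 1) * a by apply: mulr_ge0 => //; exact: addr_ge0.
have t3 : 0 <= (c / lam + 1) * a * err by exact: mulr_ge0.
have [[D1 D2 N1]|b1] := good.
  apply: le_trans (_ : 16 * (`|N - a| + a * `|D - 1|) + 8 * lam * (q0 + a) <= _); last by rewrite lerDl.
  have D0 : 0 < D by lra.
  have aq8 := good_ge D1 D2 N1.
  have -> : a ^+ 2 / q - a = (a / q) * (a - q).
    by field; rewrite gt_eqF.
  rewrite normrM; apply: le_trans (_ : 8 * `|a - q| <= _).
    apply: ler_wpM2r => //; rewrite ger0_norm; last by rewrite divr_ge0// ltW.
    by rewrite ler_pdivrMr.
  have E : `|a - q| <= `|fk - a| + lam * (q0 + a).
    have -> : a - q = (1 - lam) * (a - fk) + lam * (a - q0) by rewrite qE; ring.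
    apply: le_trans (ler_normD _ _) _; apply: lerD.
      rewrite normrM (distrC fk a) ler_piMl// ger0_norm; have := lam2; lra.
    rewrite normrM (ger0_norm lam0'); apply: ler_wpM2l => //.
    apply: le_trans (ler_normB _ _) _.
    by rewrite (ger0_norm a0') (ger0_norm q00) addrC.
  have E2 : `|fk - a| <= 2 * (`|N - a| + a * `|D - 1|).
    have -> : fk - a = ((N - a) - a * (D - 1)) / D by rewrite fkE//; field; rewrite gt_eqF.
    rewrite normrM mulrC; apply: ler_pM => //.
      rewrite normfV (gtr0_norm D0) invf_ple ?posrE//; lra.
    apply: le_trans (ler_normB _ _) _; by rewrite (normrM a) (ger0_norm a0').
  by move: E E2; lra.
apply: le_trans (_ : (c / lam + 1) * a * err <= _); last by rewrite lerDr addr_ge0.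
have e1 : 1 <= err by apply/min_idPl.
apply: le_trans (_ : (c / lam + 1) * a <= _); last by rewrite ler_peMr.
have r0 : 0 <= a ^+ 2 / q by rewrite divr_ge0 ?sqr_ge0// ltW.
have r1 : a ^+ 2 / q <= c / lam * a.
  apply: le_trans a2q_le _; rewrite ler_pdivrMr ?mulr_gt0//.
  have -> : c / lam * a * (lam * q0) = a * (c * q0) by field; rewrite gt_eqF.
  by rewrite expr2; apply: ler_wpM2l.
by rewrite ler_norml; lra.
Qed.

End mixture_ratio.

(** * Rates *)

Lemma minr_le_powR (R : realType) (z p : R) : 0 <= z -> 0 < p <= 1 -> Num.min 1 z <= z `^ p.
Proof.
move=> z0 /andP[p0 p1]; have [z1|z1] := leP z 1.
  move: z0; rewrite le_eqVlt => /orP[/eqP <-|z0].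
    by rewrite powR0// gt_eqF.
  by apply: ger1_powR => //; rewrite z0.
have -> : 1 = 1 `^ p :> R by rewrite powR1.
by apply: ge0_ler_powR; rewrite ?nnegrE// ltW.
Qed.

(* Interpolation: min 1 z <= z^p keeps the factor l while giving up only the power a^(2p), so that
   1/l cancels and a^(2(1-p)) remains, which is still dominated by b^2. *)
Lemma truncated_ratio_le (R : realType) (a b l B c p z : R) : 0 < a -> 0 < b -> 0 < l -> 0 <= B ->
  0 < p < 1 -> a `^ (1 - p) <= c * b -> 0 <= z -> z <= B * l `^ p^-1 / a ^+ 2 ->
  a ^+ 2 / (l * b) * Num.min 1 z <= B `^ p * c ^+ 2 * b.
Proof.
move=> a0 b0 l0 B0 /andP[p0 p1] acb z0 zB.
have ap : 0 < a `^ p by exact: powR_gt0.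
have lp : (l `^ p^-1) `^ p = l by rewrite -powRrM mulVf ?gt_eqF// powRr1// ltW.
have minle : Num.min 1 z <= B `^ p * l / (a `^ p) ^+ 2.
  have p01 : 0 < p <= 1 by rewrite p0 ltW.
  apply: le_trans (minr_le_powR z0 p01) _.
  apply: le_trans (_ : (B * l `^ p^-1 / a ^+ 2) `^ p <= _).
    by apply: ge0_ler_powR; rewrite ?nnegrE ?(ltW p0)//; exact: le_trans zB.
  rewrite powRM ?mulr_ge0 ?powR_ge0 ?invr_ge0 ?exprn_ge0 ?(ltW a0)//.
  rewrite powRM ?powR_ge0// lp -powR_inv1 ?exprn_ge0 ?(ltW a0)//.
  rewrite -powR_mulrn ?(ltW a0)// -!powRrM.
  have -> : 2%:R * (-1 * p) = p * - 2%:R :> R by ring.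
  by rewrite powRrM powRN powR_mulrn// ltW.
have aE : a = a `^ p * a `^ (1 - p).
  rewrite -powRD; last by rewrite addrC subrK oner_eq0.
  by rewrite addrC subrK powRr1// ltW.
have r0 : 0 <= a ^+ 2 / (l * b) by rewrite divr_ge0 ?sqr_ge0// mulr_ge0// ltW.
apply: le_trans (ler_wpM2l r0 minle) _.
have -> : a ^+ 2 / (l * b) * (B `^ p * l / (a `^ p) ^+ 2) = B `^ p * (a `^ (1 - p)) ^+ 2 / b.
  by rewrite [in a ^+ 2]aE; field; rewrite !gt_eqF.
rewrite ler_pdivrMr// -2![leRHS]mulrA; apply: ler_wpM2l; first exact: powR_ge0.
by rewrite mulrA -mulrA -expr2 -exprMn; apply: lerXn2r; rewrite ?nnegrE ?powR_ge0//; apply: le_trans acb; exact: powR_ge0.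
Qed.

Lemma cvg_powR_0 (R : realType) (u : nat -> R) (p : R) : 0 < p -> (forall n, 0 <= u n) ->
  u @ \oo --> 0 -> (fun n => u n `^ p) @ \oo --> 0.
Proof.
move=> p0 u0 u_0; apply/cvgr0Pnorm_lt => e e0.
have ep : 0 < e `^ p^-1 by exact: powR_gt0.
move/cvgr0Pnorm_lt : u_0 => /(_ _ ep); apply: filterS => n.
rewrite ger0_norm// ger0_norm ?powR_ge0// => un.
have -> : e = (e `^ p^-1) `^ p by rewrite -powRrM mulVf ?gt_eqF// powRr1// ltW.
by apply: gt0_ltr_powR; rewrite ?nnegrE// powR_ge0.
Qed.

Section rates.
Context {R : realType}.
Variables (d : nat) (h lambda : nat -> R) (H eps : R).
Hypothesis h_gt0 : forall k, (0 < k)%N -> 0 < h k.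
Hypothesis h_le : forall k, (0 < k)%N -> h k <= H.
Hypothesis lambda_itv : forall k, (0 < k)%N -> 0 < lambda k <= 1.
Hypothesis eps_gt0 : 0 < eps.
Hypothesis fast : much_less (fun n => a_seq d h n + h n ^+ 4) (fun n => lambda n `^ (1 + eps)).
Hypothesis slow : much_less (fun n => lambda n `^ (1 + eps)) (fun=> 1).

Let eps1 : 0 < 1 + eps. Proof. by rewrite addr_gt0. Qed.

Let u_cvg : (fun n => lambda n `^ (1 + eps)) @ \oo --> 0.
Proof. by move: slow; rewrite /much_less; under eq_fun do rewrite divr1. Qed.

(** Every positive power of [lambda] is a positive power of [lambda ^ (1 + eps)]. *)
Let pow_cvg (s : R) : 0 < s -> (fun n => lambda n `^ s) @ \oo --> 0.
Proof.
move=> s0; have -> : (fun n => lambda n `^ s) = (fun n => (lambda n `^ (1 + eps)) `^ (s / (1 + eps))).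
  by apply/funext => n; rewrite -powRrM mulrCA divff ?mulr1// gt_eqF.
by apply: cvg_powR_0 => // [|n]; [rewrite divr_gt0|exact: powR_ge0].
Qed.

Lemma cvg_lambda : lambda @ \oo --> 0.
Proof.
apply: cvg_trans (pow_cvg ltr01); apply: near_eq_cvg.
exists 1%N => // n /= n0; rewrite powRr1//.
by have /andP[/ltW] := lambda_itv n0.
Qed.

(** Variance plus squared bias of the kernel average, up to constants; the importance weights
    account for the factor [lambda k] in the first term. *)
Let rho k := (k%:R * lambda k * h k ^+ d)^-1 + h k ^+ 4.

Let powS n : (0 < n)%N -> lambda n `^ (1 + eps) = lambda n * lambda n `^ eps.
Proof.
move=> n0; have /andP[l0 _] := lambda_itv n0.
rewrite powRD; last by rewrite gt_eqF ?implybT.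
by rewrite powRr1// ltW.
Qed.

Let pow_le1 n : (0 < n)%N -> lambda n `^ eps <= 1.
Proof.
move=> n0; have /andP[l0 l1] := lambda_itv n0.
by rewrite -(powRr0 (lambda n)); apply: ger_powR; rewrite ?l0//; exact: ltW.
Qed.

Let bounds : \forall n \near \oo, (0 < n)%N /\
  (n%:R * h n ^+ d)^-1 <= (lambda n `^ (1 + eps)) ^+ 2 /\ h n ^+ 4 <= lambda n `^ (1 + eps).
Proof.
move: fast; rewrite /much_less => /cvgr0Pnorm_lt /(_ _ ltr01) fst.
near=> n.
have n0 : (0 < n)%N by near: n; exists 1%N.
have hp := h_gt0 n0; have /andP[l0 _] := lambda_itv n0.
have up : 0 < lambda n `^ (1 + eps) by exact: powR_gt0.
have a0 : 0 <= a_seq d h n by exact: sqrtr_ge0.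
have h4 : 0 <= h n ^+ 4 by rewrite exprn_ge0// ltW.
have : `|(a_seq d h n + h n ^+ 4) / lambda n `^ (1 + eps)| < 1 by near: n.
rewrite ger0_norm; last by rewrite divr_ge0 ?addr_ge0// ltW.
rewrite ltr_pdivrMr// mul1r => lt; split => //; split; last by lra.
have nh : 0 < n%:R * h n ^+ d by rewrite mulr_gt0 ?ltr0n// exprn_gt0.
have ln1 : 1 <= ln (n%:R : R).
  rewrite -[leLHS](expRK 1); rewrite ler_ln ?posrE ?expR_gt0 ?ltr0n//.
  by near: n; exact: nbhs_infty_ger.
apply: le_trans (_ : a_seq d h n ^+ 2 <= _); last first.
  by apply: lerXn2r; rewrite ?nnegrE ?(ltW up)//; lra.
rewrite /a_seq sqr_sqrtr; last by rewrite divr_ge0 ?(ltW nh)// (le_trans ler01).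
by rewrite -[leLHS]mul1r ler_wpM2r// invr_ge0 ltW.
Unshelve. all: by end_near. Qed.

(** The square of [a_seq] gives 1 / (n h^d) <= lambda^(2 + 2 eps); dividing by lambda leaves
    lambda^(1 + 2 eps), which is at most lambda^(1 + eps). *)
Lemma near_rho_le : \forall n \near \oo, rho n <= 2 * lambda n `^ (1 + eps).
Proof.
apply: filterS bounds => n [n0 [b1 b2]].
have /andP[l0 l1] := lambda_itv n0; have hp := h_gt0 n0.
rewrite /rho mulrAC invfM (_ : 2 * _ = lambda n `^ (1 + eps) + lambda n `^ (1 + eps)); last by ring.
apply: lerD => //; rewrite ler_pdivrMr//; apply: le_trans b1 _.
rewrite expr2; apply: ler_wpM2l; first exact: powR_ge0.
by rewrite powS// ler_piMr ?pow_le1// ltW.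
Qed.

Lemma cvg_rho_lambda : (fun n => rho n / lambda n) @ \oo --> 0.
Proof.
apply: (@squeeze_cvgr _ _ _ _ (cst 0) (fun n => 2 * lambda n `^ eps)); last 2 first.
- exact: cvg_cst.
- by rewrite -[X in _ --> X](mulr0 2); apply: cvgMr; exact: pow_cvg.
near=> n.
have n0 : (0 < n)%N by near: n; exists 1%N.
have /andP[l0 l1] := lambda_itv n0; have hp := h_gt0 n0.
apply/andP; split.
  by rewrite divr_ge0 ?(ltW l0)// addr_ge0 ?invr_ge0 ?mulr_ge0 ?exprn_ge0// ltW.
rewrite ler_pdivrMr// -mulrA [lambda n `^ eps * _]mulrC -powS//.
by near: n; exact: near_rho_le.
Unshelve. all: by end_near. Qed.

(** Since 1 <= n h^d lambda^(2 + 2 eps) eventually and [h] is bounded, n lambda^2 tends to infinity.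
    Both the Lindeberg condition and the replacement of the mean weight by 1 depend on this. *)
Lemma near_sample_lambda (B : R) : \forall n \near \oo, B <= n%:R * lambda n ^+ 2.
Proof.
have H0 : 0 < H by apply: lt_le_trans (h_le (ltn0Sn 0)); exact: h_gt0.
have Hd : 0 < H ^+ d by rewrite exprn_gt0.
have e0 : 0 < (H ^+ d * (`|B| + 1))^-1 by rewrite invr_gt0 mulr_gt0// addr_gt0.
have /cvgr0Pnorm_lt /(_ _ e0) small := pow_cvg eps_gt0.
near=> n.
have n0 : (0 < n)%N by near: n; exists 1%N.
have /andP[l0 l1] := lambda_itv n0; have hp := h_gt0 n0.
have [_ [b1 _]] : (0 < n)%N /\
  (n%:R * h n ^+ d)^-1 <= (lambda n `^ (1 + eps)) ^+ 2 /\ h n ^+ 4 <= lambda n `^ (1 + eps).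
  by near: n; exact: bounds.
have sm : `|lambda n `^ eps| < (H ^+ d * (`|B| + 1))^-1 by near: n.
rewrite ger0_norm ?powR_ge0// in sm.
have np : 0 < n%:R :> R by rewrite ltr0n.
have hd : 0 < h n ^+ d by rewrite exprn_gt0.
have hH : h n ^+ d <= H ^+ d by apply: lerXn2r; rewrite ?nnegrE ?(ltW hp) ?(ltW H0)//; exact: h_le.
rewrite powS// in b1.
set v := lambda n `^ eps in sm b1.
have v0 : 0 <= v by exact: powR_ge0.
have v1 : v <= 1 by exact: pow_le1.
rewrite -[_^-1]mul1r ltr_pdivlMr in sm; last by rewrite mulr_gt0// addr_gt0.
rewrite -[_^-1]mul1r ler_pdivrMr in b1; last by rewrite mulr_gt0.
have B1 := ler_norm B; have B0 := normr_ge0 B.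
set y := n%:R * lambda n ^+ 2.
have y0 : 0 <= y by rewrite mulr_ge0 ?sqr_ge0// ltW.
have b2 : 1 <= y * (H ^+ d * v).
  apply: le_trans b1 _.
  have -> : (lambda n * v) ^+ 2 * (n%:R * h n ^+ d) = y * (h n ^+ d * (v * v)) by rewrite /y; ring.
  apply: ler_wpM2l => //; apply: ler_pM => //; first exact: ltW.
    exact: mulr_ge0.
  by rewrite ler_piMl.
rewrite leNgt; apply/negP => yB.
have Hv : 0 <= H ^+ d * v by rewrite mulr_ge0// ltW.
have : y * (H ^+ d * v) <= (`|B| + 1) * (H ^+ d * v) by apply: ler_wpM2r => //; lra.
lra.
Unshelve. all: by end_near. Qed.

End rates.

(** * The adaptive sampler *)

Section adaptive_sampling.
Context {R : realType} {d : nat} {dO : measure_display}.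
Context {Omega : measurableType dO} {P : probability Omega R}.
Variables (X : nat -> {RV P >-> 'rV[R]_d}) (q fk : nat -> Omega -> 'rV[R]_d -> R).
Variables (f q0 K : 'rV[R]_d -> R) (h lam : nat -> R) (F c : R).
Hypothesis policyX : is_policy X q.
Hypotheses (f_density : prob_density f) (q0_density : prob_density q0) (K_density : prob_density K).
Hypotheses (f_le : forall x, f x <= F) (c_gt0 : 0 < c) (f_le_q0 : forall x, f x <= c * q0 x).
Hypothesis h_gt0 : forall k, (0 < k)%N -> 0 < h k.
Hypotheses (lam_gt0 : forall k, 0 < lam k) (lam_le1 : forall k, lam k <= 1) (lam_0 : lam 0%N = 1).
Hypothesis lam_ni : forall j k, (j <= k)%N -> lam k <= lam j.
Hypothesis q_0 : forall w x, q 0%N w x = q0 x.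
Hypothesis fkE : is_kernel_estimate X q f K h fk.
Hypothesis q_S : forall k w x, (0 < k)%N -> q k w x = (1 - lam k) * fk k w x + lam k * q0 x.
Local Notation past_type k := (g_sigma_algebraType (past X k)).
Local Notation leb := (@lebesgue_rV R d).
Local Notation W := (weight X q f).

Let f_ge0 x : 0 <= f x. Proof. exact: prob_density_ge0. Qed.
Let q0_ge0 x : 0 <= q0 x. Proof. exact: prob_density_ge0. Qed.
Let mf : measurable_fun [set: 'rV[R]_d] f. Proof. exact: measurable_prob_density. Qed.
Let if1 := integrable_prob_density f_density.

Lemma kernel_estimate_ratio k w x :
  kernel_estimate X q f K h k w x =
  (\sum_(1 <= j < k.+1) W j w * scaled_kernel K (h k) (x - X j w)) / total_weight X q f k w.
Proof.
rewrite /kernel_estimate mulr_suml; apply: eq_bigr => j _.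
by rewrite /normalized_weight mulrAC.
Qed.

Lemma estimate_ge0 k w x : (0 < k)%N -> 0 <= fk k w x.
Proof.
move=> k0; have := fkE w k0; case: ifPn => [T0 ->|_ fkd]; last exact: prob_density_ge0.
rewrite kernel_estimate_ratio; apply: divr_ge0; last exact: ltW.
apply: sumr_ge0 => j _; apply: mulr_ge0; first exact: weight_ge0.
by apply: scaled_kernel_ge0 => //; exact: h_gt0.
Qed.

(** The component [q0] is the source of every deterministic bound on the weights; the convention
    [lam 0 = 1] includes time 0. *)
Lemma policy_ge_mixture k w x : lam k * q0 x <= q k w x.
Proof.
case: k => [|k]; first by rewrite q_0 lam_0 mul1r.
by rewrite q_S// lerDr; apply: mulr_ge0; [rewrite subr_ge0|exact: estimate_ge0].
Qed.

Let q_ge := policy_ge_mixture.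

Let fq k w x : q k w x = 0 -> f x = 0.
Proof.
move=> q00; apply/eqP; rewrite eq_le f_ge0 andbT (le_trans (f_le_q0 x))//.
have := q_ge k w x; rewrite q00 pmulr_rle0// => q0le.
by rewrite pmulr_rle0.
Qed.

Lemma ratio_le_f k w x : f x ^+ 2 / q k w x <= c / lam k * f x.
Proof.
have [q00|qn0] := eqVneq (q k w x) 0.
  by rewrite q00 invr0 mulr0 mulr_ge0// divr_ge0// ltW.
have qp : 0 < q k w x by rewrite lt_def qn0 (policy_ge0 policyX).
rewrite ler_pdivrMr// expr2 mulrAC; apply: ler_wpM2r => //.
rewrite mulrAC ler_pdivlMr//; apply: le_trans (_ : c * q0 x * lam k <= _).
  by apply: ler_wpM2r => //; exact: ltW.
by rewrite -mulrA; apply: ler_wpM2l; [exact: ltW|rewrite mulrC q_ge].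
Qed.

Lemma ratio_le_q0 k w x : f x ^+ 2 / q k w x <= c ^+ 2 / lam k * q0 x.
Proof.
apply: le_trans (ratio_le_f k w x) _.
have -> : c ^+ 2 / lam k * q0 x = c / lam k * (c * q0 x) by ring.
by apply: ler_wpM2l => //; rewrite divr_ge0// ltW.
Qed.

Let ratio_ge0 k w x : 0 <= f x ^+ 2 / q k w x.
Proof. by rewrite divr_ge0 ?sqr_ge0 ?(policy_ge0 policyX). Qed.

Lemma measurable_ratio k x : measurable_fun [set: Omega] (fun w => f x ^+ 2 / q k w x).
Proof.
apply: measurable_funM => //; apply: (measurableT_comp (@measurable_inv R)).
have mq : measurable_fun [set: past_type k] (fun w => q k w x).
  exact: (measurableT_comp (measurable_policy policyX (k := k)) (pair2_measurable x)).
exact: measurable_past_fun mq.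
Qed.

Lemma integrable_ratio k x : P.-integrable [set: Omega] (EFin \o (fun w => f x ^+ 2 / q k w x)).
Proof.
apply: (@integrable_bounded _ _ _ P _ (c / lam k * f x)); first exact: measurable_ratio.
by move=> w; rewrite ger0_norm//; exact: ratio_le_f.
Qed.

Section averages.
Variables (phi : 'rV[R]_d -> R).
Hypothesis mphi : measurable_fun [set: 'rV[R]_d] phi.
Hypothesis iphi : leb.-integrable [set: 'rV[R]_d] (EFin \o (fun x => phi x * f x)).
Hypothesis iphi2 : leb.-integrable [set: 'rV[R]_d] (EFin \o (fun x => phi x ^+ 2 * f x)).

Let m := \int[leb]_x (phi x * f x).
Let average k w := (\sum_(1 <= j < k.+1) W j w * phi (X j w)) / k%:R.

Lemma measurable_weighted_average k : measurable_fun [set: Omega] (average k).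
Proof.
apply: measurable_funM => //.
rewrite /average; under eq_fun do rewrite big_add1/=.
apply: measurable_sum => j; exact: measurable_weighted_term.
Qed.

(** The bound on second moments is the crude [ratio_le_f]: the sharper [E_ratio_dominated] is itself
    deduced from this variance. Monotonicity of [lam] replaces every [c / lam i] by [c / lam k], and
    averaging gains [1 / k]. *)
Lemma variance_weighted_average k : (0 < k)%N ->
  P.-integrable [set: Omega] (EFin \o (fun w => (average k w - m) ^+ 2)) /\
  \int[P]_w (average k w - m) ^+ 2 <= c / (k%:R * lam k) * \int[leb]_x (phi x ^+ 2 * f x).
Proof.
move=> k0.
have isq j := integrable_sqr_weighted_term policyX mf f_ge0 fq mphi (ratio_le_f j) iphi2.
have [iM EM] := variance_partial_sum policyX mf f_ge0 fq mphi iphi isq k.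
set M := fun w => \sum_(0 <= i < k) (W i.+1 w * phi (X i.+1 w) - m).
have kn0 : k%:R != 0 :> R by rewrite pnatr_eq0 -lt0n.
have kp : 0 < k%:R :> R by rewrite ltr0n.
have -> : (fun w => (average k w - m) ^+ 2) = (fun w => k%:R ^- 2 * M w ^+ 2).
  apply/funext => w; rewrite /average big_add1/= /M sumrB sumr_const_nat subn0.
  by rewrite -mulr_natr; field.
split; first exact: integrableZl_real.
rewrite (RintegralZl (k%:R ^- 2) measurableT iM).
have I0 : 0 <= \int[leb]_x (phi x ^+ 2 * f x).
  by apply: Rintegral_ge0 => x _; rewrite mulr_ge0// sqr_ge0.
have EM2 : \int[P]_w (M w ^+ 2) <= k%:R * (c / lam k * \int[leb]_x (phi x ^+ 2 * f x)).
  apply: le_trans EM _.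
  have -> : k%:R * (c / lam k * \int[leb]_x (phi x ^+ 2 * f x)) =
      \sum_(0 <= i < k) (c / lam k * \int[leb]_x (phi x ^+ 2 * f x)).
    by rewrite sumr_const_nat subn0 mulr_natl.
  apply: ler_sum_nat => i /andP[_ ik].
  apply: le_trans (E_sqr_weighted_term_le policyX mf f_ge0 fq mphi (ratio_le_f i) iphi2 (C := c / lam i) _) _.
    move=> x; rewrite -[leRHS](probability_Rintegral_cst P).
    apply: ler_Rintegral; last by move=> w; exact: ratio_le_f.
      exact: integrable_ratio.
    exact: finite_measure_integrable_cst.
  apply: ler_wpM2r => //; apply: ler_wpM2l; first exact: ltW.
  by rewrite lef_pV2 ?posrE// lam_ni// ltnW.
apply: le_trans (ler_wpM2l _ EM2) _; first by rewrite invr_ge0 exprn_ge0.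
rewrite le_eqVlt; apply/orP; left; apply/eqP; field.
by rewrite kn0 gt_eqF.
Qed.

End averages.

(** [D] has mean 1 and [N k x] has mean the smoothed density at [x]; where [D] is positive, [fk] is
    their quotient. *)
Let D k w := total_weight X q f k w / k%:R.
Let N k x w := (\sum_(1 <= j < k.+1) W j w * scaled_kernel K (h k) (x - X j w)) / k%:R.
Let rho k := (k%:R * lam k * h k ^+ d)^-1 + h k ^+ 4.

Let i1 : leb.-integrable [set: 'rV[R]_d] (EFin \o (fun x => cst 1 x * f x)).
Proof. by apply: eq_integrable if1 => // x _; rewrite /= mul1r. Qed.

Let i12 : leb.-integrable [set: 'rV[R]_d] (EFin \o (fun x => cst 1 x ^+ 2 * f x)).
Proof. by apply: eq_integrable if1 => // x _; rewrite /= expr1n mul1r. Qed.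

Let DE k : D k = (fun w => (\sum_(1 <= j < k.+1) W j w * cst 1 (X j w)) / k%:R).
Proof. by apply/funext => w; rewrite /D /total_weight; under [in RHS]eq_bigr do rewrite mulr1. Qed.

Let int1 : \int[leb]_x (cst 1 x * f x) = 1.
Proof.
rewrite -[RHS](Rintegral_prob_density f_density); apply: eq_Rintegral => x _.
by rewrite mul1r.
Qed.

Lemma variance_mean_weight k : (0 < k)%N ->
  P.-integrable [set: Omega] (EFin \o (fun w => (D k w - 1) ^+ 2)) /\
  \int[P]_w (D k w - 1) ^+ 2 <= c / (k%:R * lam k).
Proof.
move=> k0; rewrite DE.
have [] := variance_weighted_average (measurable_cst (1 : R)) i1 i12 k0.
rewrite int1 => iM EM; split => //; apply: le_trans EM _.
under eq_Rintegral do rewrite expr1n mul1r.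
by rewrite (Rintegral_prob_density f_density) mulr1.
Qed.

(** * The ratio of the squared target to the policy, in mean *)

Section kernel_bounds.
Variables (CK Cb H : R).
Hypothesis K_le : forall u, K u <= CK.
Hypothesis bias : forall k x, (0 < k)%N ->
  `|\int[leb]_y (scaled_kernel K (h k) (x - y) * f y) - f x| <= Cb * h k ^+ 2.
Hypothesis h_le : forall k, (0 < k)%N -> h k <= H.

(** One constant for both variances: the terms with factor 2 come from splitting the squared kernel
    error into variance and squared bias, and [c * H ^+ d] from 1 / (k lam) <= H^d / (k lam h^d). *)
Let A := 2 * c * CK * F + 2 * Cb ^+ 2 + c * H ^+ d.

Let CK0 : 0 <= CK. Proof. by apply: le_trans (K_le 0); exact: prob_density_ge0. Qed.
Let F0 : 0 <= F. Proof. exact: le_trans (f_ge0 0) (f_le 0). Qed.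
Let c0 : 0 <= c. Proof. exact: ltW. Qed.

Lemma variance_mean_weight_rho k : (0 < k)%N -> \int[P]_w (D k w - 1) ^+ 2 <= A * rho k.
Proof.
move=> k0; have [_ /le_trans] := variance_mean_weight k0; apply.
have hp := h_gt0 k0; have hd : 0 < h k ^+ d by exact: exprn_gt0.
have kl : 0 < k%:R * lam k by rewrite mulr_gt0// ltr0n.
have Hd : h k ^+ d <= H ^+ d by apply: lerXn2r; rewrite ?nnegrE ?(ltW hp)//; [exact: le_trans (ltW hp) (h_le k0)|exact: h_le].
apply: le_trans (_ : c * H ^+ d * (k%:R * lam k * h k ^+ d)^-1 <= _).
  rewrite (invfM _ (h k ^+ d)); set r := (k%:R * lam k)^-1.
  have -> : c * H ^+ d * (r * (h k ^+ d)^-1) = c * r * (H ^+ d / h k ^+ d) by ring.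
  rewrite ler_peMr//; first by rewrite mulr_ge0// invr_ge0 ltW.
  by rewrite ler_pdivlMr// mul1r.
have r1 : 0 <= (k%:R * lam k * h k ^+ d)^-1 by rewrite invr_ge0 mulr_ge0// ltW.
have r2 : 0 <= h k ^+ 4 by rewrite exprn_ge0// ltW.
have A1 : 0 <= 2 * c * CK * F by rewrite !mulr_ge0.
have A2 : 0 <= Cb ^+ 2 by exact: sqr_ge0.
have A3 : 0 <= c * H ^+ d by rewrite mulr_ge0// (le_trans _ Hd)// ltW.
rewrite /A /rho mulrDr; apply: ler_wpDr; first by apply: mulr_ge0 => //; lra.
by apply: ler_wpM2r => //; lra.
Qed.

Lemma variance_kernel_average k x : (0 < k)%N ->
  [/\ measurable_fun [set: Omega] (N k x),
     P.-integrable [set: Omega] (EFin \o (fun w => (N k x w - f x) ^+ 2)) &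
     \int[P]_w (N k x w - f x) ^+ 2 <= A * rho k].
Proof.
move=> k0; have hp := h_gt0 k0; have hd : 0 < h k ^+ d by exact: exprn_gt0.
have mk : measurable_fun [set: 'rV[R]_d] (fun y => scaled_kernel K (h k) (x - y)).
  exact: measurable_scaled_kernel.
have is1 := integrable_smoothing K_density f_density f_le hp x.
have [is2 s2] := smoothing_sqr_le K_density f_density f_le hp x K_le.
have mN : measurable_fun [set: Omega] (N k x) by exact: (measurable_weighted_average mk).
have [iM EM] := variance_weighted_average mk is1 is2 k0.
set m := \int[leb]_y _ in iM EM.
have idom : P.-integrable [set: Omega] (EFin \o (fun w => 2 * (N k x w - m) ^+ 2 + 2 * (Cb * h k ^+ 2) ^+ 2)).
  apply: integrableD_real; first exact: integrableZl_real.
  exact: finite_measure_integrable_cst.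
have b := bias x k0; rewrite -/m in b.
have b2 : (m - f x) ^+ 2 <= (Cb * h k ^+ 2) ^+ 2.
  rewrite -[leLHS]real_normK ?num_real//; apply: lerXn2r => //; rewrite nnegrE//.
  exact: le_trans b.
have dom w : `|(N k x w - f x) ^+ 2| <= 2 * (N k x w - m) ^+ 2 + 2 * (Cb * h k ^+ 2) ^+ 2.
  rewrite ger0_norm ?sqr_ge0//.
  have -> : N k x w - f x = (N k x w - m) + (m - f x) by ring.
  have := sqr_ge0 ((N k x w - m) - (m - f x)); nra.
have mN2 : measurable_fun [set: Omega] (fun w => (N k x w - f x) ^+ 2).
  by apply: measurable_funX; apply: measurable_funB.
split => //; first exact: integrable_dominated idom.
apply: le_trans (le_trans (ler_norm _) (norm_Rintegral_le mN2 dom idom)) _.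
rewrite (RintegralD measurableT (integrableZl_real 2 iM)); last exact: finite_measure_integrable_cst.
rewrite (RintegralZl 2 measurableT iM) probability_Rintegral_cst.
have kl : 0 < k%:R * lam k by rewrite mulr_gt0// ltr0n.
have EM2 : \int[P]_w (N k x w - m) ^+ 2 <= c * CK * F * (k%:R * lam k * h k ^+ d)^-1.
  apply: le_trans EM _; apply: le_trans (_ : c / (k%:R * lam k) * (CK * F / h k ^+ d) <= _).
    by apply: ler_wpM2l => //; rewrite divr_ge0// ltW.
  by rewrite le_eqVlt; apply/orP; left; apply/eqP; rewrite (invfM _ (h k ^+ d)); set r := (k%:R * lam k)^-1; ring.
set r := (k%:R * lam k * h k ^+ d)^-1 in EM2 *.
have r1 : 0 <= r by rewrite invr_ge0 mulr_ge0// ltW.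
have r2 : 0 <= h k ^+ 4 by rewrite exprn_ge0// ltW.
have A1 : 0 <= c * CK * F by rewrite !mulr_ge0.
have A2 : 0 <= Cb ^+ 2 by exact: sqr_ge0.
have A3 : 0 <= c * H ^+ d by rewrite mulr_ge0// exprn_ge0// (le_trans (ltW hp))// h_le.
have -> : (Cb * h k ^+ 2) ^+ 2 = Cb ^+ 2 * h k ^+ 4 by ring.
rewrite /A /rho -/r.
have t1 : 0 <= Cb ^+ 2 * r by exact: mulr_ge0.
have t2 : 0 <= c * H ^+ d * r by exact: mulr_ge0.
have t3 : 0 <= c * CK * F * h k ^+ 4 by exact: mulr_ge0.
have t4 : 0 <= c * H ^+ d * h k ^+ 4 by exact: mulr_ge0.
nra.
Qed.

Let err k x w := 4 * ((D k w - 1) ^+ 2 + (N k x w - f x) ^+ 2 / f x ^+ 2).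

Let estimate_eq k x w (k0 : (0 < k)%N) :
  (0 < D k w -> fk k w x = N k x w / D k w).
Proof.
have kp : 0 < k%:R :> R by rewrite ltr0n.
rewrite /D pmulr_lgt0 ?invr_gt0// => T0.
have := fkE w k0; rewrite T0 => ->; rewrite kernel_estimate_ratio /N.
by field; rewrite !gt_eqF.
Qed.

Let E_err k x : 0 < f x -> (0 < k)%N ->
  [/\ measurable_fun [set: Omega] (err k x), P.-integrable [set: Omega] (EFin \o err k x) &
  \int[P]_w err k x w <= 4 * (A * rho k) * (1 + f x ^- 2)].
Proof.
move=> f0 k0; have [iD _] := variance_mean_weight k0; have eD := variance_mean_weight_rho k0.
have [mN iN eN] := variance_kernel_average x k0.
have -> : err k x = (fun w => 4 * (D k w - 1) ^+ 2 + (4 * f x ^- 2) * (N k x w - f x) ^+ 2).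
  by apply/funext => w; rewrite /err; ring.
have ie := integrableD_real (integrableZl_real 4 iD) (integrableZl_real (4 * f x ^- 2) iN).
split => //; first exact: (integrable_measurable ie).
rewrite (RintegralD measurableT (integrableZl_real 4 iD) (integrableZl_real (4 * f x ^- 2) iN)).
rewrite (RintegralZl _ measurableT iD) (RintegralZl _ measurableT iN).
have f2 : 0 <= f x ^- 2 by rewrite invr_ge0 exprn_ge0// ltW.
have := ler_wpM2l f2 eN; lra.
Qed.

(** The expectation passes inside the minimum, because [min 1 err] lies below both 1 and [err].
    Keeping this truncation is what allows the interpolation of [truncated_ratio_le]. *)
Lemma E_ratio_le k x : (0 < k)%N -> lam k <= 2^-1 -> 0 < f x ->
  \int[P]_w (f x ^+ 2 / q k w x) <=
  8 * f x + f x ^+ 2 / (lam k * q0 x) * Num.min 1 (4 * (A * rho k) * (1 + f x ^- 2)).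
Proof.
move=> k0 lk f0; have [me ie ee] := E_err f0 k0.
have e0 w : 0 <= err k x w.
  by apply: mulr_ge0 => //; rewrite addr_ge0 ?sqr_ge0// divr_ge0 ?sqr_ge0.
pose beta w := Num.min 1 (err k x w).
have b0 w : 0 <= beta w by rewrite le_min ler01 e0.
have b1 w : beta w <= 1 by rewrite ge_min lexx.
have ib : P.-integrable [set: Omega] (EFin \o beta).
  apply: (@integrable_bounded _ _ _ P _ 1); first exact: measurable_minr.
  by move=> w; rewrite ger0_norm.
have r0 : 0 <= f x ^+ 2 / (lam k * q0 x) by rewrite divr_ge0 ?sqr_ge0// mulr_ge0// ltW.
have ic : P.-integrable [set: Omega] (EFin \o (fun=> 8 * f x)) by exact: finite_measure_integrable_cst.
apply: le_trans (_ : \int[P]_w (8 * f x + f x ^+ 2 / (lam k * q0 x) * beta w) <= _).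
  apply: ler_Rintegral; first exact: integrable_ratio.
    by apply: integrableD_real => //; exact: integrableZl_real.
  move=> w.
  exact: (mixture_ratio_le f0 (f_le_q0 x) (lam_gt0 k) lk (estimate_ge0 w x k0) (estimate_eq x k0 (w := w))
     (q0_ge0 x) c_gt0 (q_S w x k0)).
rewrite (RintegralD measurableT ic (integrableZl_real _ ib)) (RintegralZl _ measurableT ib).
rewrite probability_Rintegral_cst lerD2l; apply: ler_wpM2l => //.
rewrite le_min; apply/andP; split.
  rewrite -[leRHS](probability_Rintegral_cst P).
  by apply: ler_Rintegral => //; exact: finite_measure_integrable_cst.
apply: le_trans ee; apply: ler_Rintegral => // w.
by rewrite ge_min lexx orbT.
Qed.

Lemma E_ratio_dist k x : (0 < k)%N -> lam k <= 2^-1 -> 0 < f x ->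
  \int[P]_w `|f x ^+ 2 / q k w x - f x| <=
  8 * (lam k + A * rho k / lam k) * (1 + f x) + 8 * lam k * (q0 x + f x) +
  (c / lam k + 1) * f x * (4 * (A * rho k) * (1 + f x ^- 2)).
Proof.
move=> k0 lk f0; have [me ie ee] := E_err f0 k0.
have [iD _] := variance_mean_weight k0; have eD := variance_mean_weight_rho k0.
have [mN iN eN] := variance_kernel_average x k0.
have l0 := lam_gt0 k.
pose u := fun w => (8 / lam k) * (N k x w - f x) ^+ 2 + (8 * f x / lam k) * (D k w - 1) ^+ 2.
pose v := 8 * lam k * (1 + f x) + 8 * lam k * (q0 x + f x).
have iu : P.-integrable [set: Omega] (EFin \o u).
  by apply: integrableD_real; exact: integrableZl_real.
have ic : P.-integrable [set: Omega] (EFin \o cst v) by exact: finite_measure_integrable_cst.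
have ice := integrableZl_real ((c / lam k + 1) * f x) ie.
have iuc := integrableD_real iu ic.
apply: le_trans (_ : \int[P]_w ((u w + v) + (c / lam k + 1) * f x * err k x w) <= _).
  apply: ler_Rintegral.
  - apply: (integrable_norm (f := fun w => f x ^+ 2 / q k w x - f x)).
    apply: integrableB_real; first exact: integrable_ratio.
    exact: finite_measure_integrable_cst.
  - exact: integrableD_real.
  move=> w.
  apply: le_trans (mixture_ratio_dist f0 (f_le_q0 x) (lam_gt0 k) lk (estimate_ge0 w x k0) (estimate_eq x k0 (w := w))
     (q0_ge0 x) c_gt0 (q_S w x k0)) _.
  apply: lerD => //; rewrite /u /v addrA; apply: lerD => //.
  (* AM-GM weighted by [lam k], which turns second moments into first ones. *)
  have amgm (t : R) : 2 * `|t| <= lam k + t ^+ 2 / lam k.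
    rewrite -subr_ge0.
    have -> : lam k + t ^+ 2 / lam k - 2 * `|t| = (`|t| - lam k) ^+ 2 / lam k.
      by rewrite -(real_normK (num_real t)); field; rewrite gt_eqF.
    by rewrite divr_ge0 ?sqr_ge0// ltW.
  have a1 := amgm (N k x w - f x).
  have a2 := ler_wpM2l (ltW f0) (amgm (D k w - 1)).
  have -> : 8 / lam k * (N k x w - f x) ^+ 2 + 8 * f x / lam k * (D k w - 1) ^+ 2 + 8 * lam k * (1 + f x) =
    8 * (lam k + (N k x w - f x) ^+ 2 / lam k) + 8 * (f x * (lam k + (D k w - 1) ^+ 2 / lam k)) by ring.
  lra.
rewrite (RintegralD measurableT iuc ice) (RintegralD measurableT iu ic) (RintegralZl _ measurableT ie).
rewrite (RintegralD measurableT (integrableZl_real (8 / lam k) iN) (integrableZl_real (8 * f x / lam k) iD)).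
rewrite (RintegralZl _ measurableT iN) (RintegralZl _ measurableT iD) probability_Rintegral_cst.
have il0 : 0 <= (lam k)^-1 by rewrite invr_ge0 ltW.
have e1 := ler_wpM2l il0 eN.
have e2 := ler_wpM2l (mulr_ge0 (ltW f0) il0) eD.
have cl : 0 <= (c / lam k + 1) * f x by apply: mulr_ge0; [rewrite addr_ge0// divr_ge0// ltW|exact: ltW].
have e3 := ler_wpM2l cl ee.
apply: lerD => //; rewrite /v; move: e1 e2; lra.
Qed.

Variable eps : R.
Hypothesis eps_gt0 : 0 < eps.
Hypothesis fast : much_less (fun n => a_seq d h n + h n ^+ 4) (fun n => lam n `^ (1 + eps)).
Hypothesis slow : much_less (fun n => lam n `^ (1 + eps)) (fun=> 1).
Hypothesis f_powR_le : forall eta : R, 0 < eta <= 1 ->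
  exists2 c', 0 < c' & forall x, f x `^ eta <= c' * q0 x.

Let lam_itv k : (0 < k)%N -> 0 < lam k <= 1. Proof. by rewrite lam_gt0 lam_le1. Qed.

Let lam_cvg0 : lam @ \oo --> 0.
Proof. exact: (cvg_lambda lam_itv eps_gt0 slow). Qed.

Let rho_cvg0 : (fun n => rho n / lam n) @ \oo --> 0.
Proof. exact: (cvg_rho_lambda h_gt0 lam_itv eps_gt0 fast slow). Qed.

Let near_lam_small : \forall k \near \oo, lam k <= 2^-1.
Proof.
have half : 0 < 2^-1 :> R by rewrite invr_gt0.
move/cvgr0Pnorm_le : lam_cvg0 => /(_ _ half); apply: filterS => k.
by rewrite ger0_norm// ltW.
Qed.

Let A_ge0 : 0 <= A.
Proof.
have A1 : 0 <= 2 * c * CK * F by rewrite !mulr_ge0.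
have A2 : 0 <= Cb ^+ 2 by exact: sqr_ge0.
have A3 : 0 <= c * H ^+ d.
  by rewrite mulr_ge0// exprn_ge0// (le_trans _ (h_le (ltn0Sn 0)))// ltW// h_gt0.
rewrite /A; lra.
Qed.

Let rho_ge0 k : (0 < k)%N -> 0 <= rho k.
Proof.
move=> k0; have hp := ltW (h_gt0 k0).
rewrite /rho addr_ge0 ?exprn_ge0// invr_ge0; apply: mulr_ge0; last exact: exprn_ge0.
by apply: mulr_ge0 => //; exact: ltW.
Qed.

Let q0_gt0 x : 0 < f x -> 0 < q0 x.
Proof. by move=> f0; rewrite -(pmulr_rgt0 _ c_gt0) (lt_le_trans f0). Qed.

Lemma E_ratio_dominated : exists2 C, 0 <= C & forall k x, \int[P]_w (f x ^+ 2 / q k w x) <= C * q0 x.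
Proof.
pose p := (1 + eps)^-1.
have e1 : 0 < 1 + eps by rewrite addr_gt0.
have p0 : 0 < p by rewrite invr_gt0.
have p1 : p < 1 by rewrite invf_lt1// ltrDl.
have [|c' c'0 c'f] := f_powR_le (eta := 1 - p); first by rewrite subr_gt0 p1/= gerBl ltW.
have [k0 _ Hk0] : \forall k \near \oo, (0 < k)%N /\ lam k <= 2^-1 /\ rho k <= 2 * lam k `^ (1 + eps).
  near=> k; split; first by near: k; exists 1%N.
  split; first by near: k; exact: near_lam_small.
  by near: k; exact: (near_rho_le h_gt0 lam_itv eps_gt0 fast).
(* From [rho k <= 2 * lam k ^ (1 + eps)] and [f x <= F], the second argument of the minimum takes
   the form expected by [truncated_ratio_le]. *)
pose B := 8 * A * (F ^+ 2 + 1).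
have B0 : 0 <= B by rewrite /B mulr_ge0 ?mulr_ge0// addr_ge0// sqr_ge0.
have c2 : 0 <= c ^+ 2 / lam k0 by rewrite divr_ge0 ?sqr_ge0// ltW.
have Bp : 0 <= B `^ p * c' ^+ 2 by rewrite mulr_ge0 ?sqr_ge0// powR_ge0.
(* The three terms serve the finitely many times before [k0], the good event and the bad event. *)
exists (c ^+ 2 / lam k0 + 8 * c + B `^ p * c' ^+ 2); first by rewrite !addr_ge0// mulr_ge0.
move=> k x.
have q0x := q0_ge0 x.
have t1 : 0 <= c ^+ 2 / lam k0 * q0 x by exact: mulr_ge0.
have t2 : 0 <= c * q0 x by exact: mulr_ge0.
have t3 : 0 <= B `^ p * c' ^+ 2 * q0 x by exact: mulr_ge0.
have [kk0|kk0] := leqP k0 k; last first.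
  apply: le_trans (_ : c ^+ 2 / lam k0 * q0 x <= _); last by lra.
  rewrite -[leRHS](probability_Rintegral_cst P); apply: ler_Rintegral.
  - exact: integrable_ratio.
  - exact: finite_measure_integrable_cst.
  move=> w; apply: le_trans (ratio_le_q0 k w x) _; apply: ler_wpM2r => //.
  by apply: ler_wpM2l; rewrite ?sqr_ge0// lef_pV2 ?posrE// lam_ni// ltnW.
have [kp [lk rk]] := Hk0 _ kk0.
have := f_ge0 x; rewrite le_eqVlt => /orP[/eqP fx0|f0].
  rewrite -fx0; under eq_Rintegral do rewrite expr0n mul0r.
  by rewrite probability_Rintegral_cst; lra.
apply: le_trans (E_ratio_le kp lk f0) _.
have z0 : 0 <= 4 * (A * rho k) * (1 + f x ^- 2).
  by rewrite !mulr_ge0// ?rho_ge0// addr_ge0// invr_ge0 exprn_ge0// ltW.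
have zB : 4 * (A * rho k) * (1 + f x ^- 2) <= B * lam k `^ p^-1 / f x ^+ 2.
  rewrite /p invrK ler_pdivlMr ?exprn_gt0//.
  have -> : 4 * (A * rho k) * (1 + f x ^- 2) * f x ^+ 2 = 4 * A * (rho k * (f x ^+ 2 + 1)).
    by field; rewrite gt_eqF.
  have -> : B * lam k `^ (1 + eps) = 4 * A * (2 * lam k `^ (1 + eps) * (F ^+ 2 + 1)) by rewrite /B; ring.
  apply: ler_wpM2l; first by rewrite mulr_ge0.
  apply: ler_pM => //; [exact: rho_ge0|by rewrite addr_ge0// sqr_ge0|].
  by rewrite lerD2r; apply: lerXn2r; rewrite ?nnegrE.
have p01 : 0 < p < 1 by rewrite p0.
have := truncated_ratio_le f0 (q0_gt0 f0) (lam_gt0 k) B0 p01 (c'f x) z0 zB.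
have := f_le_q0 x; lra.
Unshelve. all: by end_near. Qed.

(** For fixed [x] the bound of [E_ratio_dist] is a combination of [lam k], [rho k / lam k] and
    [rho k], all tending to 0, with coefficients depending on [x] only. *)
Lemma cvg_E_ratio x : \int[P]_w `|f x ^+ 2 / q k w x - f x| @[k --> \oo] --> 0.
Proof.
have := f_ge0 x; rewrite le_eqVlt => /orP[/eqP fx0|f0].
  rewrite -fx0; under eq_fun do (under eq_Rintegral do rewrite expr0n mul0r subr0 normr0).
  by under eq_fun do rewrite probability_Rintegral_cst; exact: cvg_cst.
pose a1 := 8 * (1 + f x) + 8 * (q0 x + f x).
pose z := 4 * A * (1 + f x ^- 2).
pose a2 := 8 * A * (1 + f x) + c * f x * z.
pose a3 := f x * z.
apply: (@squeeze_cvgr _ _ _ _ (cst 0) (fun k => a1 * lam k + a2 * (rho k / lam k) + a3 * (rho k / lam k * lam k))).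
- near=> k.
  have k0 : (0 < k)%N by near: k; exists 1%N.
  have lk : lam k <= 2^-1 by near: k; exact: near_lam_small.
  apply/andP; split; first exact: Rintegral_ge0.
  apply: le_trans (E_ratio_dist k0 lk f0) _.
  rewrite le_eqVlt; apply/orP; left; apply/eqP; rewrite /a1 /a2 /a3 /z; field.
  by rewrite !gt_eqF.
- exact: cvg_cst.
- have -> : 0 = a1 * 0 + a2 * 0 + a3 * (0 * 0) by ring.
  apply: cvgD; last by apply: cvgMr; exact: cvgM.
  by apply: cvgD; exact: cvgMr.
Unshelve. all: by end_near. Qed.

(** * The limit theorem for the normalized target *)

Section limit_theorem.
Variable g : 'rV[R]_d -> R.
Hypothesis mg : measurable_fun [set: 'rV[R]_d] g.
Hypothesis g2q0 : leb.-integrable [set: 'rV[R]_d] (EFin \o (fun x => g x ^+ 2 * q0 x)).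

Let iq0 := integrable_prob_density q0_density.
Let mq0 : measurable_fun [set: 'rV[R]_d] q0. Proof. exact: measurable_prob_density. Qed.

Lemma integrable_sqr_density (phi : 'rV[R]_d -> R) : measurable_fun [set: 'rV[R]_d] phi ->
  leb.-integrable [set: 'rV[R]_d] (EFin \o (fun x => phi x ^+ 2 * q0 x)) ->
  leb.-integrable [set: 'rV[R]_d] (EFin \o (fun x => phi x ^+ 2 * f x)).
Proof.
move=> mphi iphi; apply: (integrable_dominated _ _ (integrableZl_real c iphi)).
  by apply: measurable_funM => //; exact: measurable_funX.
move=> x; have x2 := sqr_ge0 (phi x).
rewrite ger0_norm; last exact: mulr_ge0.
by rewrite [leRHS]mulrCA; apply: ler_wpM2l.
Qed.

Lemma integrable_density_mul (phi : 'rV[R]_d -> R) : measurable_fun [set: 'rV[R]_d] phi ->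
  leb.-integrable [set: 'rV[R]_d] (EFin \o (fun x => phi x ^+ 2 * f x)) ->
  leb.-integrable [set: 'rV[R]_d] (EFin \o (fun x => phi x * f x)).
Proof.
move=> mphi iphi; apply: (integrable_dominated _ _ (integrableD_real if1 iphi)).
  exact: measurable_funM.
move=> x; rewrite normrM (ger0_norm (f_ge0 x)) -[X in X + _]mul1r -mulrDl; apply: ler_wpM2r => //.
rewrite -(real_normK (num_real (phi x))); have := sqr_ge0 (`|phi x| - 1); nra.
Qed.

Let mu := \int[leb]_x (g x * f x).
Let gc x := g x - mu.

Let mgc : measurable_fun [set: 'rV[R]_d] gc. Proof. exact: measurable_funB. Qed.

Let igc2q : leb.-integrable [set: 'rV[R]_d] (EFin \o (fun x => gc x ^+ 2 * q0 x)).
Proof.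
apply: (integrable_dominated _ _ (integrableD_real (integrableZl_real 2 g2q0) (integrableZl_real (2 * mu ^+ 2) iq0))).
  by apply: measurable_funM => //; exact: measurable_funX.
move=> x; rewrite ger0_norm; last by rewrite mulr_ge0// sqr_ge0.
rewrite mulrA -mulrDl; apply: ler_wpM2r => //.
rewrite /gc; have := sqr_ge0 (g x + mu); nra.
Qed.

Let igc2f := integrable_sqr_density mgc igc2q.
Let igcf := integrable_density_mul mgc igc2f.
Let ig2f := integrable_sqr_density mg g2q0.
Let igf := integrable_density_mul mg ig2f.

Let mean_gc : \int[leb]_x (gc x * f x) = 0.
Proof.
have -> : (fun x => gc x * f x) = (fun x => g x * f x - mu * f x).
  by apply/funext => x; rewrite /gc mulrBl.
rewrite (RintegralB measurableT igf (integrableZl_real mu if1)) (RintegralZl mu measurableT if1).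
by rewrite (Rintegral_prob_density f_density) mulr1 subrr.
Qed.

Let V := \int[leb]_x (gc x ^+ 2 * f x).

Lemma asymptotic_variance_centered : V = asymptotic_variance f g.
Proof.
rewrite /asymptotic_variance -/mu /V.
have -> : (fun x => gc x ^+ 2 * f x) = (fun x => (g x ^+ 2 * f x - (2 * mu) * (g x * f x)) + mu ^+ 2 * f x).
  by apply/funext => x; rewrite /gc; ring.
have i2 := integrableZl_real (2 * mu) igf.
rewrite (RintegralD measurableT (integrableB_real ig2f i2) (integrableZl_real (mu ^+ 2) if1)).
rewrite (RintegralB measurableT ig2f i2) (RintegralZl (2 * mu) measurableT igf).
rewrite (RintegralZl (mu ^+ 2) measurableT if1) (Rintegral_prob_density f_density) -/mu.
by ring.
Qed.

Let V_ge0 : 0 <= V.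
Proof. by apply: Rintegral_ge0 => x _; rewrite mulr_ge0// sqr_ge0. Qed.

Let xi k w := W k.+1 w * gc (X k.+1 w).
Let S n w := \sum_(0 <= i < n) xi i w.
Let delta k := \int[leb]_x (gc x ^+ 2 * \int[P]_w `|f x ^+ 2 / q k w x - f x|).

Let mxi k : measurable_fun [set: Omega] (xi k).
Proof. exact: (measurable_weighted_term policyX mf mgc). Qed.

Let ixi2 k : P.-integrable [set: Omega] (EFin \o (fun w => xi k w ^+ 2)).
Proof. exact: (integrable_sqr_weighted_term policyX mf f_ge0 fq mgc (ratio_le_f k) igc2f). Qed.

Let SE n : S n = (fun w => \sum_(0 <= i < n) (W i.+1 w * gc (X i.+1 w) - \int[leb]_x (gc x * f x))).
Proof. by apply/funext => w; rewrite mean_gc; under [in RHS]eq_bigr do rewrite subr0. Qed.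

Let mS_past n : measurable_fun [set: past_type n] (S n).
Proof. by rewrite SE; exact: (measurable_partial_sum_past policyX mf mgc). Qed.

Let mS n : measurable_fun [set: Omega] (S n).
Proof. exact: measurable_past_fun (@mS_past n). Qed.

Let mcos n th b : measurable_fun [set: past_type n] (fun w => cos (th * S n w + b)).
Proof. exact: (measurableT_comp (measurable_cos_affine th b) (@mS_past n)). Qed.

Let orth k (th b : R) : \int[P]_w (cos (th * S k w + b) * xi k w) = 0.
Proof.
have icos : P.-integrable [set: Omega] (EFin \o (fun w => cos (th * S k w + b))).
  apply: (@integrable_bounded _ _ _ P _ 1); last by move=> w; exact: cos_max.
  exact: measurable_past_fun (@mcos k th b).
have [_ ->] := E_weight policyX mf f_ge0 fq (@mcos k th b) icos mgc igcf.
by rewrite mean_gc mulr0.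
Qed.

Let condvar k (th b : R) : `|\int[P]_w (cos (th * S k w + b) * (xi k w ^+ 2 - V))| <= delta k.
Proof.
(* [B] has to dominate both [f] and the ratio with respect to [q0], hence the sum of the two
   constants. *)
apply: (conditional_variance_bound policyX mf f_ge0 fq mgc (s := q0) (B := c + c ^+ 2 / lam k)) => //.
- move=> w x; apply: le_trans (ratio_le_q0 k w x) _.
  by apply: ler_wpM2r => //; rewrite lerDr.
- move=> x; apply: le_trans (f_le_q0 x) _; apply: ler_wpM2r => //.
  by rewrite lerDl divr_ge0 ?sqr_ge0// ltW.
- by move=> w; exact: cos_max.
Qed.

Let E_dist_le C k x : (forall k x, \int[P]_w (f x ^+ 2 / q k w x) <= C * q0 x) ->
  \int[P]_w `|f x ^+ 2 / q k w x - f x| <= (C + c) * q0 x.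
Proof.
move=> HC.
have ic : P.-integrable [set: Omega] (EFin \o (fun=> f x)) by exact: finite_measure_integrable_cst.
have ir := integrable_ratio k x.
apply: le_trans (_ : \int[P]_w (f x ^+ 2 / q k w x + f x) <= _).
  apply: ler_Rintegral.
  - by apply: (integrable_norm (f := fun w => f x ^+ 2 / q k w x - f x)); exact: integrableB_real.
  - exact: integrableD_real.
  move=> w; apply: le_trans (ler_normB _ _) _.
  by rewrite (ger0_norm (ratio_ge0 k w x)) (ger0_norm (f_ge0 x)).
rewrite (RintegralD measurableT ir ic) probability_Rintegral_cst mulrDl.
exact: lerD.
Qed.

Let delta_cvg0 : delta @ \oo --> 0.
Proof.
have [C C0 HC] := E_ratio_dominated.
have mgc2 : measurable_fun [set: 'rV[R]_d] (fun x => gc x ^+ 2) by exact: measurable_funX.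
have mE k : measurable_fun [set: 'rV[R]_d] (fun x => \int[P]_w `|f x ^+ 2 / q k w x - f x|).
  have mj : measurable_fun [set: 'rV[R]_d * Omega] (fun z => `|f z.1 ^+ 2 / q k z.2 z.1 - f z.1|).
    apply: measurableT_comp => //; apply: measurable_funB.
      exact: (measurable_joint_ratio policyX mf).
    exact: (measurableT_comp mf measurable_fst).
  have dom x w : `| `|f x ^+ 2 / q k w x - f x| | <= (c / lam k + 1) * f x.
    rewrite normr_id; apply: le_trans (ler_normB _ _) _.
    rewrite (ger0_norm (ratio_ge0 k w x)) (ger0_norm (f_ge0 x)) mulrDl mul1r lerD2r.
    exact: ratio_le_f.
  exact: (@measurable_Rintegral1 _ _ _ _ _ leb P _ _ mj dom (integrableZl_real _ if1)).
have -> : 0 = \int[leb]_x (gc x ^+ 2 * 0).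
  by under eq_Rintegral do rewrite mulr0; rewrite /Rintegral integral0.
apply: (@Rintegral_dominated_cvg _ _ _ leb _ _ (fun x => (C + c) * (gc x ^+ 2 * q0 x))).
- by move=> k; exact: measurable_funM.
- by under eq_fun do rewrite mulr0; exact: measurable_cst.
- by move=> x; apply: cvgMr; exact: cvg_E_ratio.
- move=> k x; have x2 := sqr_ge0 (gc x).
  have E0 : 0 <= \int[P]_w `|f x ^+ 2 / q k w x - f x| by exact: Rintegral_ge0.
  rewrite ger0_norm; last exact: mulr_ge0.
  by rewrite [leRHS]mulrCA; apply: ler_wpM2l => //; exact: E_dist_le.
- exact: integrableZl_real.
Qed.

(** The weight of [X k.+1] has denominator [q k], so it is at most [c / lam k], and [lam] is
    nonincreasing. *)
Let weight_le k n w : (k <= n)%N -> W k.+1 w <= c / lam n.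
Proof.
move=> kn; rewrite /weight /=; set x := X k.+1 w.
have cl : 0 <= c / lam n by rewrite divr_ge0// ltW.
have [q00|qn0] := eqVneq (q k w x) 0; first by rewrite q00 invr0 mulr0.
have qp : 0 < q k w x by rewrite lt_def qn0 (policy_ge0 policyX).
rewrite ler_pdivrMr// mulrAC ler_pdivlMr//.
apply: le_trans (_ : c * q0 x * lam k <= _).
  apply: ler_pM => //; [exact: ltW|exact: lam_ni].
by rewrite -mulrA; apply: ler_wpM2l; [exact: ltW|rewrite mulrC q_ge].
Qed.

Let lindeberg (e eta : R) : 0 < e -> 0 < eta ->
  \forall n \near \oo, forall k, (k < n)%N ->
    \int[P]_w (xi k w ^+ 2 * (e * Num.sqrt n%:R < `|xi k w|)%R%:R) <= eta.
Proof.
move=> e0 eta0; have [C C0 HC] := E_ratio_dominated.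
(* Since weights up to time n are at most c / lam n, a large increment forces a large [gc]. *)
pose tau n := e * Num.sqrt n%:R * lam n / c.
pose tail n x := gc x * (tau n < `|gc x|)%R%:R.
have mtail n : measurable_fun [set: 'rV[R]_d] (tail n).
  apply: measurable_funM => //; apply: measurable_fun_lt_nat => //.
  exact: measurableT_comp.
have tail2 n x : tail n x ^+ 2 <= gc x ^+ 2.
  by rewrite /tail; case: ltP => _; rewrite ?mulr1// mulr0 expr0n sqr_ge0.
have itail n : leb.-integrable [set: 'rV[R]_d] (EFin \o (fun x => tail n x ^+ 2 * q0 x)).
  apply: (integrable_dominated _ _ igc2q).
    by apply: measurable_funM => //; exact: measurable_funX.
  move=> x; rewrite ger0_norm; last by rewrite mulr_ge0// sqr_ge0.
  exact: ler_wpM2r.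
have tail_cvg : (fun n => C * \int[leb]_x (tail n x ^+ 2 * q0 x)) @ \oo --> 0.
  have -> : 0 = C * \int[leb]_x (0 * q0 x).
    by under eq_Rintegral do rewrite mul0r; rewrite /Rintegral integral0 mulr0.
  apply: cvgMr.
  apply: (@Rintegral_dominated_cvg _ _ _ leb _ _ (fun x => gc x ^+ 2 * q0 x)) => //.
  - by move=> n; apply: measurable_funM => //; exact: measurable_funX.
  - by under eq_fun do rewrite mul0r; exact: measurable_cst.
  - move=> x; apply: cvg_near_cst.
    (* The threshold [tau n] tends to infinity because n lam^2 does; the constant supplied here is
       what [|gc x| <= tau n] becomes after squaring. *)
    have := near_sample_lambda h_gt0 h_le lam_itv eps_gt0 fast slow ((gc x * c / e) ^+ 2).
    apply: filterS => n Hn; rewrite /tail ltNge.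
    suff -> : `|gc x| <= tau n by rewrite mulr0 expr0n.
    rewrite /tau ler_pdivlMr// -mulrA [leRHS]mulrC -ler_pdivrMr//.
    have s0 : 0 <= Num.sqrt n%:R * lam n by rewrite mulr_ge0// ltW.
    rewrite -(ger0_norm s0) -(ger0_norm (ltW c_gt0)) -(ger0_norm (ltW e0)) -normfV -!normrM.
    rewrite -(ler_pXn2r (n := 2))// ?nnegrE// !real_normK ?num_real//.
    by rewrite [leRHS]exprMn sqr_sqrtr.
  - move=> n x; rewrite ger0_norm; last by rewrite mulr_ge0// sqr_ge0.
    exact: ler_wpM2r.
move/cvgr0Pnorm_le : tail_cvg => /(_ _ eta0); apply: filterS => n Hn k kn.
apply: le_trans (le_trans (ler_norm _) Hn).
have domq w x : f x ^+ 2 / q k w x <= c ^+ 2 / lam k * q0 x by exact: ratio_le_q0.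
have it := integrable_sqr_weighted_term policyX mf f_ge0 fq (mtail n) domq (itail n).
have := E_sqr_weighted_term_le policyX mf f_ge0 fq (mtail n) domq (itail n) (HC k).
apply: le_trans; apply: ler_Rintegral => //.
  apply: (integrable_dominated _ _ (ixi2 k)).
    apply: measurable_funM; first exact: measurable_funX.
    by apply: measurable_fun_lt_nat => //; exact: measurableT_comp.
  move=> w; rewrite normrM (ger0_norm (sqr_ge0 _)) ler_piMr ?sqr_ge0//.
  by case: ltP => _; rewrite ?normr0 ?normr1.
move=> w; case: ltP => [lt|_]; last by rewrite mulr0 sqr_ge0.
rewrite mulr1 /xi /tail.
suff -> : tau n < `|gc (X k.+1 w)| by rewrite mulr1.
have W0 := weight_ge0 policyX f_ge0 k.+1 w.
rewrite /tau ltr_pdivrMr//; move: lt; rewrite /xi normrM (ger0_norm W0) => lt.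
apply: lt_le_trans (_ : W k.+1 w * `|gc (X k.+1 w)| * lam n <= _); first by rewrite ltr_pM2r.
rewrite mulrAC [leRHS]mulrC; apply: ler_wpM2r => //.
by rewrite -ler_pdivlMr//; apply: weight_le; exact: ltnW.
Qed.

Lemma clt_cos (t b : R) :
  \int[P]_w cos (t * (S n w / Num.sqrt n%:R) + b) @[n --> \oo] --> expR (- (t ^+ 2 * V / 2)) * cos b.
Proof.
have [C C0 HC] := E_ratio_dominated.
apply: (martingale_clt_cos mxi ixi2 V_ge0 orth condvar delta_cvg0 _ lindeberg
  (C := C * \int[leb]_x (gc x ^+ 2 * q0 x))) => k.
exact: (E_sqr_weighted_term_le policyX mf f_ge0 fq mgc (ratio_le_q0 k) igc2q (HC k)).
Qed.

Let Sn n w := S n w / Num.sqrt n%:R.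

Let variance_Sn : exists2 C, 0 <= C & forall n, (0 < n)%N ->
  P.-integrable [set: Omega] (EFin \o (fun w => Sn n w ^+ 2)) /\ \int[P]_w (Sn n w ^+ 2) <= C.
Proof.
have [C C0 HC] := E_ratio_dominated.
pose C' := C * \int[leb]_x (gc x ^+ 2 * q0 x).
exists C'; first by apply: mulr_ge0 => //; apply: Rintegral_ge0 => x _; rewrite mulr_ge0// sqr_ge0.
move=> n n0; have np : 0 < n%:R :> R by rewrite ltr0n.
have [iS ES] := variance_partial_sum policyX mf f_ge0 fq mgc igcf ixi2 n.
have -> : (fun w => Sn n w ^+ 2) = (fun w => n%:R^-1 * S n w ^+ 2).
  by apply/funext => w; rewrite /Sn exprMn exprVn sqr_sqrtr ?(ltW np)// mulrC.
rewrite SE; split; first exact: integrableZl_real.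
rewrite (RintegralZl n%:R^-1 measurableT iS) mulrC ler_pdivrMr//; apply: le_trans ES _.
have -> : C' * n%:R = \sum_(0 <= i < n) C' by rewrite sumr_const_nat subn0 mulr_natr.
apply: ler_sum_nat => i _.
exact: (E_sqr_weighted_term_le policyX mf f_ge0 fq mgc (ratio_le_q0 i) igc2q (HC i)).
Qed.

Let Z n w := Num.sqrt n%:R * (weighted_sum X q f g n w - mu).

Lemma measurable_weighted_sum n : measurable_fun [set: Omega] (weighted_sum X q f g n).
Proof.
have m1 : measurable_fun [set: 'rV[R]_d] (cst 1 : 'rV[R]_d -> R) by exact: measurable_cst.
have mW j : measurable_fun [set: Omega] (W j.+1).
  have -> : W j.+1 = (fun w => W j.+1 w * cst 1 (X j.+1 w)) by apply/funext => w; rewrite mulr1.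
  exact: (measurable_weighted_term policyX mf m1).
have mT : measurable_fun [set: Omega] (total_weight X q f n).
  by rewrite /total_weight; under eq_fun do rewrite big_add1/=; exact: measurable_sum.
rewrite /weighted_sum; under eq_fun do rewrite big_add1/=.
apply: measurable_sum => j; apply: measurable_funM; last exact: measurableT_comp.
by apply: measurable_funM => //; apply: (measurableT_comp (@measurable_inv R)).
Qed.

Let mZ n : measurable_fun [set: Omega] (Z n).
Proof. by apply: measurable_funM => //; apply: measurable_funB => //; exact: measurable_weighted_sum. Qed.

Let ZE n w : (0 < n)%N -> 0 < D n w -> Z n w = Sn n w / D n w.
Proof.
move=> n0; have np : 0 < n%:R :> R by rewrite ltr0n.
rewrite /D pmulr_lgt0 ?invr_gt0// => T0.
have sn : 0 < Num.sqrt n%:R :> R by rewrite sqrtr_gt0.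
rewrite /Z; have -> : weighted_sum X q f g n w = (S n w + mu * total_weight X q f n w) / total_weight X q f n w.
  rewrite /weighted_sum /S /total_weight mulr_sumr !big_add1/= -big_split/= mulr_suml.
  by apply: eq_bigr => j _; rewrite /xi /gc /normalized_weight /total_weight big_add1/=; ring.
rewrite /Sn -[X in _ / (_ / X)](sqr_sqrtr (ltW np)); field.
by rewrite !gt_eqF.
Qed.

(* On {D >= 1/2} the two arguments differ by at most 2 |t| |Sn| |D - 1|, which AM-GM with
   weight [lam n] bounds by second moments; on {D < 1/2}, 2 <= 8 (D - 1)^2. *)
Let slutsky (t b : R) :
  \int[P]_w cos (t * Z n w + b) - \int[P]_w cos (t * Sn n w + b) @[n --> \oo] --> 0.
Proof.
have [C C0 HC] := variance_Sn.
have kap_cvg : (fun n => (n%:R * lam n ^+ 2)^-1) @ \oo --> 0.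
  apply/cvgr0Pnorm_le => e e0.
  have := near_sample_lambda h_gt0 h_le lam_itv eps_gt0 fast slow e^-1.
  apply: filterS => n Hn.
  have np : 0 < n%:R * lam n ^+ 2 by apply: lt_le_trans Hn; rewrite invr_gt0.
  by rewrite ger0_norm ?invr_ge0 ?(ltW np)// invf_ple ?posrE.
(* With factor [|t|]: [lam n] times the second moment of [Sn], plus the variance of [D] over
   [lam n]. The last term is 8 times the variance of [D], enlarged by [lam n <= 1]. *)
pose bound n := `|t| * (C * lam n + c * (n%:R * lam n ^+ 2)^-1) + 8 * c * (n%:R * lam n ^+ 2)^-1.
have bound_cvg : bound @ \oo --> 0.
  have -> : 0 = `|t| * (C * 0 + c * 0) + 8 * c * 0 by ring.
  apply: cvgD; last exact: cvgMr.
  by apply: cvgMr; apply: cvgD; exact: cvgMr.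
apply/cvgr0Pnorm_le => e e0.
move/cvgr0Pnorm_le : bound_cvg => /(_ _ e0) small.
near=> n.
have n0 : (0 < n)%N by near: n; exists 1%N.
have np : 0 < n%:R :> R by rewrite ltr0n.
have bn : `|bound n| <= e by near: n; exact: small.
apply: le_trans (le_trans (ler_norm _) bn).
have l0 := lam_gt0 n.
have [iS ES] := HC _ n0.
have [iD ED] := variance_mean_weight n0.
have mSn : measurable_fun [set: Omega] (Sn n) by exact: measurable_funM.
have icZ : P.-integrable [set: Omega] (EFin \o (fun w => cos (t * Z n w + b))).
  apply: (@integrable_bounded _ _ _ P _ 1); last by move=> w; exact: cos_max.
  exact: (measurableT_comp (measurable_cos_affine t b) (mZ n)).
have icS : P.-integrable [set: Omega] (EFin \o (fun w => cos (t * Sn n w + b))).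
  apply: (@integrable_bounded _ _ _ P _ 1); last by move=> w; exact: cos_max.
  exact: (measurableT_comp (measurable_cos_affine t b) mSn).
rewrite -(RintegralB measurableT icZ icS).
have i1' := integrableZl_real (`|t| * lam n) iS.
have i2' := integrableZl_real (`|t| / lam n + 8) iD.
apply: le_trans (norm_Rintegral_le _ _ (integrableD_real i1' i2')) _.
- exact: (integrable_measurable (integrableB_real icZ icS)).
- move=> w; set Sw := Sn n w; set Dw := D n w.
  have il : 0 <= `|t| / lam n by rewrite divr_ge0// ltW.
  have [D2|D2] := leP 1 (2 * Dw); last first.
    apply: le_trans (_ : 2 <= _).
      apply: le_trans (ler_normB _ _) _.
      by have := cos_max (t * Z n w + b); have := cos_max (t * Sw + b); lra.
    have s1 : 0 <= `|t| * lam n * Sw ^+ 2 by rewrite mulr_ge0 ?sqr_ge0// mulr_ge0// ltW.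
    have s2 : 0 <= `|t| / lam n * (Dw - 1) ^+ 2 by rewrite mulr_ge0// sqr_ge0.
    rewrite mulrDl; have : 1 <= 4 * (Dw - 1) ^+ 2 by nra.
    lra.
  have D0 : 0 < Dw by lra.
  apply: le_trans (cos_lipschitz _ _) _.
  have -> : t * Z n w + b - (t * Sw + b) = t * (Sw * (1 - Dw) / Dw).
    by rewrite ZE// -/Sw -/Dw; field; rewrite gt_eqF.
  rewrite normrM mulrDl -[`|t| * lam n * _]mulrA -[`|t| / lam n * _]mulrA addrA -mulrDr.
  apply: ler_wpDr; first by rewrite mulr_ge0// sqr_ge0.
  apply: ler_wpM2l => //.
  apply: le_trans (_ : 2 * (`|Sw| * `|Dw - 1|) <= _).
    rewrite normrM normfV (gtr0_norm D0) normrM (distrC 1) mulrC; apply: ler_wpM2r.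
      exact: mulr_ge0.
    by rewrite invf_ple ?posrE//; lra.
  rewrite -(real_normK (num_real Sw)) -(real_normK (num_real (Dw - 1))).
  rewrite -subr_ge0.
  have -> : lam n * `|Sw| ^+ 2 + (lam n)^-1 * `|Dw - 1| ^+ 2 - 2 * (`|Sw| * `|Dw - 1|) =
    (lam n * `|Sw| - `|Dw - 1|) ^+ 2 / lam n by field; rewrite gt_eqF.
  by rewrite divr_ge0 ?sqr_ge0// ltW.
rewrite (RintegralD measurableT i1' i2') (RintegralZl _ measurableT iS) (RintegralZl _ measurableT iD).
have tl : 0 <= `|t| * lam n by rewrite mulr_ge0// ltW.
have tl2 : 0 <= `|t| / lam n by rewrite divr_ge0// ltW.
have e1 := ler_wpM2l tl ES.
have e2 := ler_wpM2l tl2 ED.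
have ED8 : 8 * \int[P]_w (D n w - 1) ^+ 2 <= 8 * c * (n%:R * lam n ^+ 2)^-1.
  rewrite -mulrA; apply: ler_wpM2l => //; apply: le_trans ED _; apply: ler_wpM2l => //.
  rewrite lef_pV2 ?posrE ?mulr_gt0 ?exprn_gt0//; apply: ler_wpM2l; first exact: ltW.
  by rewrite expr2 ler_piMl// ltW.
have E2 : `|t| / lam n * (c / (n%:R * lam n)) = `|t| * (c * (n%:R * lam n ^+ 2)^-1).
  by field; rewrite !gt_eqF.
rewrite /bound; rewrite E2 in e2; move: e1 e2 ED8.
set eS := \int[P]_w _; set eD := \int[P]_w _.
lra.
Unshelve. all: by end_near. Qed.

Lemma weighted_sum_cvg_in_distribution : cvg_in_distribution P Z (centered_normal (asymptotic_variance f g)).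
Proof.
split=> // phi cphi [M phiM].
have mphi : measurable_fun [set: R] phi by exact: continuous_measurable_fun.
rewrite -asymptotic_variance_centered.
have mZ' n : measurable_fun [set: Omega] (Z n : Omega -> measurableTypeR R) by exact: mZ.
pose Zrv n : {mfun Omega >-> measurableTypeR R} := @mfun_Sub _ _ Omega (measurableTypeR R) (Z n) (mem_set (mZ' n)).
pose law n : probability (measurableTypeR R) R := @distribution _ _ Omega (measurableTypeR R) R P (Zrv n).
have lawE (G : R -> R) n : measurable_fun [set: R] G -> (exists M, forall y, `|G y| <= M) ->
    \int[law n]_y G y = \int[P]_w G (Z n w).
  move=> mG [B GB]; rewrite /Rintegral; congr fine.
  rewrite (@integral_distribution _ _ Omega (measurableTypeR R) R P (Zrv n) (EFin \o G))//.
  - exact/measurable_EFinP.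
  - by apply: (@integrable_bounded _ _ _ P _ B) => //; exact: measurableT_comp.
have char_cvg t b : \int[law n]_y cos (t * y + b) @[n --> \oo] -->
    \int[centered_normal V]_y cos (t * y + b).
  rewrite Rintegral_cos_centered_normal//.
  have -> : (fun n => \int[law n]_y cos (t * y + b)) = (fun n =>
     (\int[P]_w cos (t * Z n w + b) - \int[P]_w cos (t * Sn n w + b)) + \int[P]_w cos (t * Sn n w + b)).
    apply/funext => n; rewrite subrK lawE//; first exact: measurable_cos_affine.
    by exists 1 => y; exact: cos_max.
  by rewrite -[X in _ --> X]add0r; apply: cvgD; [exact: slutsky|exact: clt_cos].
have := levy_continuity char_cvg cphi phiM.
have -> : (fun n => \int[law n]_y phi y) = (fun n => \int[P]_w phi (Z n w)).
  by apply/funext => n; apply: lawE => //; exists M.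
have iphi (nu : probability (measurableTypeR R) R) : nu.-integrable [set: measurableTypeR R] (EFin \o phi).
  exact: (@integrable_bounded _ _ _ nu phi M).
have iphiZ n : P.-integrable [set: Omega] (EFin \o (phi \o Z n)).
  apply: (@integrable_bounded _ _ _ P _ M); last by move=> w; exact: phiM.
  exact: (measurableT_comp mphi (mZ n)).
rewrite -(EFin_Rintegral (iphi (centered_normal V))).
have -> : (fun n => 'E_P[phi \o Z n])%E = (fun n => (\int[P]_w phi (Z n w))%:E).
  by apply/funext => n; rewrite unlock -EFin_Rintegral.
by move=> cv; apply: (cvg_comp _ _ cv).
Qed.

End limit_theorem.

End kernel_bounds.

End adaptive_sampling.

Lemma powR_decay_le1 (R : realType) (d : nat) (x : 'rV[R]_d) (r : R) : 0 <= r -> (1 + enorm x) `^ (- r) <= 1.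
Proof.
move=> r0; have e1 : 1 <= 1 + enorm x by rewrite lerDl sqrtr_ge0.
by rewrite -[leRHS](powRr0 (1 + enorm x)); apply: ler_powR => //; rewrite oppr_le0.
Qed.

(** * Normalizing the target *)

Section rescaled_weights.
Context {R : realType} {d : nat} {dO : measure_display}.
Context {Omega : measurableType dO} {P : probability Omega R}.
Variables (X : nat -> {RV P >-> 'rV[R]_d}) (q : nat -> Omega -> 'rV[R]_d -> R).
Variables (fU f : 'rV[R]_d -> R) (I0 : R).
Hypotheses (I0_gt0 : 0 < I0) (fE : forall x, f x = fU x / I0).

Lemma weight_rescaled k w : weight X q f k w = weight X q fU k w / I0.
Proof. by rewrite /weight fE mulrAC. Qed.

Lemma total_weight_rescaled k w : total_weight X q f k w = total_weight X q fU k w / I0.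
Proof. by rewrite /total_weight mulr_suml; apply: eq_bigr => j _; exact: weight_rescaled. Qed.

(** The constant cancels between the weight and the total weight. The argument can thus use the
    normalized target, whose weights have mean 1, while the statement uses [fU]. *)
Lemma normalized_weight_rescaled n k w : normalized_weight X q f n k w = normalized_weight X q fU n k w.
Proof.
rewrite /normalized_weight weight_rescaled total_weight_rescaled invfM invrK.
by rewrite mulrACA mulVf ?mulr1// gt_eqF.
Qed.

Lemma weighted_sum_rescaled g n w : weighted_sum X q f g n w = weighted_sum X q fU g n w.
Proof. by apply: eq_bigr => k _; rewrite normalized_weight_rescaled. Qed.

Lemma is_kernel_estimate_rescaled K h fk :
  is_kernel_estimate X q fU K h fk -> is_kernel_estimate X q f K h fk.
Proof.
move=> est k w k0; have := est k w k0.
rewrite total_weight_rescaled pmulr_lgt0 ?invr_gt0//; case: ifP => // _ ->.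
by apply/funext => x; apply: eq_bigr => j _; rewrite normalized_weight_rescaled.
Qed.

End rescaled_weights.

Lemma bounded_second_derivatives (R : realType) (d : nat) (f : 'rV[R]_d -> R) :
  C2_bounded_second_derivatives f ->
  exists2 M, 0 <= M & forall i j y, `|'D_('e_j) (fun z => 'D_('e_i) f z) y| <= M.
Proof.
move=> [_ _ _ _ d2f].
have /choice[Mf HM] : forall ij : 'I_d * 'I_d, exists M, forall y,
    `|'D_('e_ij.2) (fun z => 'D_('e_ij.1) f z) y| <= M.
  by move=> [i j]; have [_ [M HM]] := d2f i j; exists M.
exists (\sum_ij `|Mf ij|); first exact: sumr_ge0.
move=> i j y; apply: le_trans (HM (i, j) y) _; apply: le_trans (ler_norm _) _.
by rewrite (bigD1 (i, j))//= lerDl sumr_ge0.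
Qed.

Theorem theorem8 (R : realType) (d : nat) (d_gt0 : (0 < d)%N)
    (dO : measure_display) (Omega : measurableType dO) (P : probability Omega R)
    (fU f q0 K g : 'rV[R]_d -> R)
    (X : nat -> {RV P >-> 'rV[R]_d})
    (q fk : nat -> Omega -> 'rV[R]_d -> R)
    (h lambda : nat -> R)
    (mfU : measurable_fun [set: 'rV[R]_d] fU)
    (fU_ge0 : forall x, 0 <= fU x)
    (int_fU : (0 < \int[lebesgue_rV]_x (fU x)%:E < +oo)%E)
    (fE : forall x, f x = fU x / \int[lebesgue_rV]_y fU y)
    (h_gt0 : forall k, (0 < k)%N -> 0 < h k)
    (h_bounded : exists M, forall k, (0 < k)%N -> h k <= M)
    (lambda_itv : forall k, (0 < k)%N -> 0 < lambda k <= 1)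
    (lambda_ni : forall j k, (0 < j <= k)%N -> lambda k <= lambda j)
    (hH1 : H1 f) (hH2 : H2 f q0) (hH3 : H3 K)
    (policyX : is_policy X q)
    (q_0 : forall w x, q 0%N w x = q0 x)
    (fkE : is_kernel_estimate X q fU K h fk)
    (q_S : forall k w x, (0 < k)%N ->
       q k w x = (1 - lambda k) * fk k w x + lambda k * q0 x)
    (rates : exists2 eps : R, 0 < eps &
       much_less (fun n => a_seq d h n + h n ^+ 4)
                 (fun n => lambda n `^ (1 + eps)) /\
       much_less (fun n => lambda n `^ (1 + eps)) (fun=> 1))
    (mg : measurable_fun [set: 'rV[R]_d] g)
    (g2q0 : (\int[lebesgue_rV]_x (g x ^+ 2 * q0 x)%:E < +oo)%E) :
  cvg_in_distribution P
    (fun n w => Num.sqrt n%:R *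
       (weighted_sum X q fU g n w - \int[lebesgue_rV]_x (g x * f x)))
    (centered_normal (asymptotic_variance f g)).
Proof.
have I0 : 0 < \int[lebesgue_rV]_y fU y.
  by rewrite /Rintegral fine_gt0.
have [f_density C2f] := hH1.
have [q0_density f_powR [C0 [r0 [C00 r00 q0_le]]]] := hH2.
have [K_density _ K1 K2 [CK [rK [CK0 rK0 K_le]]]] := hH3.
have [eps eps0 [fast slow]] := rates.
have [H h_le] := h_bounded.
have f_ge0 x : 0 <= f x by exact: prob_density_ge0.
(* (H2) with exponent 1; together with the boundedness of [q0] it also makes [f] bounded, by
   [c * C0]. *)
have [c c0 fc] : exists2 c, 0 < c & forall x, f x <= c * q0 x.
  have [|c c0 fc] := f_powR 1; first by rewrite ltr01 lexx.
  by exists c => // x; have := fc x; rewrite powRr1.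
have f_le x : f x <= c * C0.
  apply: le_trans (fc x) _; apply: ler_wpM2l; first exact: ltW.
  by apply: le_trans (q0_le x) _; rewrite ger_pMr// powR_decay_le1// ltW.
have K_leC x : K x <= CK.
  by apply: le_trans (K_le x) _; rewrite ger_pMr// powR_decay_le1// ltW.
have [M M0 d2fM] := bounded_second_derivatives C2f.
have [_ df _ d2f _] := C2f.
have bias k x : (0 < k)%N -> `|\int[lebesgue_rV]_y (scaled_kernel K (h k) (x - y) * f y) - f x| <=
    M * d%:R ^+ 2 * (\int[lebesgue_rV]_u (enorm u ^+ 2 * K u)) * h k ^+ 2.
  by move=> k0; exact: (smoothing_bias K_density f_density f_le (h_gt0 _ k0) x M0 df d2f d2fM K1 K2).
(* At time 0 the policy is q0 itself: a mixture of weight 1. *)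
pose lam k := if k is 0%N then 1 else lambda k.
have lamE k : (0 < k)%N -> lam k = lambda k by case: k.
have lam_itv k : 0 < lam k <= 1 by case: k => [|k]; [rewrite ltr01 lexx|exact: lambda_itv].
have lam_gt0 k : 0 < lam k by case/andP: (lam_itv k).
have lam_le1 k : lam k <= 1 by case/andP: (lam_itv k).
have lam_ni j k : (j <= k)%N -> lam k <= lam j.
  case: j => [|j] jk; first exact: lam_le1.
  by case: k jk => // k jk; apply: lambda_ni.
(* [lam] and [lambda] may differ at index 0 only, which limits do not see. *)
have much_lessE (u v u' v' : nat -> R) : (forall n, (0 < n)%N -> u n = u' n /\ v n = v' n) ->
    much_less u v -> much_less u' v'.
  move=> E; apply: cvg_trans; apply: near_eq_cvg; exists 1%N => // n /= n0.
  by have [-> ->] := E n n0.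
have q_S' k w x : (0 < k)%N -> q k w x = (1 - lam k) * fk k w x + lam k * q0 x.
  by move=> k0; rewrite lamE// q_S.
have fast' : much_less (fun n => a_seq d h n + h n ^+ 4) (fun n => lam n `^ (1 + eps)).
  by apply: much_lessE fast => n n0; rewrite lamE.
have slow' : much_less (fun n => lam n `^ (1 + eps)) (fun=> 1).
  by apply: much_lessE slow => n n0; rewrite lamE.
have ig : (@lebesgue_rV R d).-integrable [set: 'rV[R]_d] (EFin \o (fun x => g x ^+ 2 * q0 x)).
  apply: integrable_ge0_lty => //.
    apply: measurable_funM; first exact: measurable_funX.
    exact: measurable_prob_density.
  by move=> x; rewrite mulr_ge0 ?sqr_ge0// prob_density_ge0.
have := weighted_sum_cvg_in_distribution policyX f_density q0_density K_density f_le c0 fc h_gt0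
  lam_gt0 lam_le1 erefl lam_ni q_0 (is_kernel_estimate_rescaled I0 fE fkE) q_S' K_leC bias h_le
  eps0 fast' slow' f_powR mg ig.
congr cvg_in_distribution; apply/funext => n; apply/funext => w.
by rewrite (weighted_sum_rescaled X q I0 fE).
Qed.
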